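(* The decision version of SMC-1 (given an instance and an integer $b$, decide whether there is a feasible matching with at most $b$ blocking pairs) is $\mathsf{W}[1]$-hard when parameterized by $b+\Delta_{\mathcal M}$, even when restricted to instances with a master list over men and a master list over women, $|\mathcal W^\star|=2$, $\Delta_{\mathcal W}\le 3$, and $|L(w)|=1$ for each $w\in\mathcal W^\star$.
   Context: An instance of Stable Marriage with Covering Constraints (SMC) consists of a finite set $\mathcal M$ of men, a finite set $\mathcal W$ of women, for each person $x$ a preference list $L(x)$ strictly ordering a subset of the opposite sex (the persons acceptable to $x$), and subsets $\mathcal W^\star\subseteq\mathcal W$, $\mathcal M^\star\subseteq\mathcal M$ of distinguished persons. A matching is a set of disjoint man–woman pairs $\{m,w\}$ with $m$ and $w$ in each other's lists; $M(x)$ denotes the partner of $x$. A pair $\{m,w\}$ of mutually acceptable persons is blocking for $M$ if $m$ is unmatched or prefers $w$ to $M(m)$, and $w$ is unmatched or prefers $m$ to $M(w)$. A matching is feasible if it matches every person in $\mathcal W^\star\cup\mathcal M^\star$. SMC-1 is the special case $\mathcal M^\star=\emptyset$. $\Delta_{\mathcal M}$ and $\Delta_{\mathcal W}$ denote the maximum length of the preference list of a man and of a woman, respectively. A master list over women is a total order of all women such that every man's list is its restriction to the women he finds acceptable; master lists over men are defined symmetrically. *)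

(* Defs.v *)
From mathcomp Require Import all_boot.
Set Implicit Arguments.
Unset Strict Implicit.
Unset Printing Implicit Defensive.

(** * Model of computation

    The WHILE language of N. D. Jones (Computability and Complexity from a
    Programming Perspective) on binary trees.  Every evaluation of an
    expression is charged the full size of the variables it copies, hence the
    values written during a run are never larger than its cost, and the cost is
    polynomially related to the running time of a Turing machine. *)

Inductive tree := Nil | Cons of tree & tree.

Fixpoint tsize (t : tree) : nat :=
  if t is Cons a b then (tsize a + tsize b).+1 else 1.

Definition thd (t : tree) : tree := if t is Cons a _ then a else Nil.
Definition ttl (t : tree) : tree := if t is Cons _ b then b else Nil.

Inductive expr :=
| EVar of nat
| ENil
| ECons of expr & expr
| EHd of expr
| ETl of expr.

Definition store := nat -> tree.

Fixpoint eval (e : expr) (s : store) : tree :=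
  match e with
  | EVar x => s x
  | ENil => Nil
  | ECons e1 e2 => Cons (eval e1 s) (eval e2 s)
  | EHd e1 => thd (eval e1 s)
  | ETl e1 => ttl (eval e1 s)
  end.

Fixpoint ecost (e : expr) (s : store) : nat :=
  match e with
  | EVar x => tsize (s x)
  | ENil => 1
  | ECons e1 e2 => (ecost e1 s + ecost e2 s).+1
  | EHd e1 => (ecost e1 s).+1
  | ETl e1 => (ecost e1 s).+1
  end.

Inductive cmd :=
| CSkip
| CAssign of nat & expr
| CSeq of cmd & cmd
| CIf of expr & cmd & cmd
| CWhile of expr & cmd.

Definition update (s : store) (x : nat) (t : tree) : store :=
  fun y => if y == x then t else s y.

(** [exec c s n s']: started in store [s], the command [c] halts with store [s']
    at cost [n].  In tests, [Nil] is false and every other tree is true. *)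
Inductive exec : cmd -> store -> nat -> store -> Prop :=
| ExecSkip s : exec CSkip s 1 s
| ExecAssign x e s :
    exec (CAssign x e) s (ecost e s).+1 (update s x (eval e s))
| ExecSeq c1 c2 s s1 s2 n1 n2 :
    exec c1 s n1 s1 -> exec c2 s1 n2 s2 ->
    exec (CSeq c1 c2) s (n1 + n2) s2
| ExecIfTrue e c1 c2 s s1 n :
    eval e s <> Nil -> exec c1 s n s1 ->
    exec (CIf e c1 c2) s ((ecost e s).+1 + n) s1
| ExecIfFalse e c1 c2 s s1 n :
    eval e s = Nil -> exec c2 s n s1 ->
    exec (CIf e c1 c2) s ((ecost e s).+1 + n) s1
| ExecWhileTrue e c s s1 s2 n1 n2 :
    eval e s <> Nil -> exec c s n1 s1 -> exec (CWhile e c) s1 n2 s2 ->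
    exec (CWhile e c) s ((ecost e s).+1 + n1 + n2) s2
| ExecWhileFalse e c s :
    eval e s = Nil -> exec (CWhile e c) s (ecost e s).+1 s.

(** Input and output are passed in variable 0; the others start as [Nil]. *)
Definition init_store (t : tree) : store := update (fun=> Nil) 0 t.

Definition runs_within (p : cmd) (input output : tree) (n : nat) : Prop :=
  exists n' s, [/\ exec p (init_store input) n' s, s 0 = output & n' <= n].

(** * Encodings *)

Fixpoint enc_seq (T : Type) (enc : T -> tree) (s : seq T) : tree :=
  if s is x :: s' then Cons (enc x) (enc_seq enc s') else Nil.

(** Numbers are written in unary: all those that get encoded are indices of
    listed objects, solution sizes or bounds. *)
Definition enc_nat (n : nat) : tree := enc_seq (fun=> Nil) (nseq n tt).

Definition enc_pair (T U : Type) (encT : T -> tree) (encU : U -> tree)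
  (x : T * U) : tree := Cons (encT x.1) (encU x.2).

Lemma enc_seq_inj (T : Type) (enc : T -> tree) :
  injective enc -> injective (enc_seq enc).
Proof.
by move=> encI; elim=> [|x s IH] [|y t] //= [/encI-> /IH->].
Qed.

Lemma enc_nat_inj : injective enc_nat.
Proof. by elim=> [|m IH] [|n] // [/IH->]. Qed.

Lemma enc_pair_inj (T U : Type) (encT : T -> tree) (encU : U -> tree) :
  injective encT -> injective encU -> injective (enc_pair encT encU).
Proof. by move=> tI uI [a b] [c d] [/tI/= -> /uI/= ->]. Qed.

(** * Parameterized problems and fpt-reductions *)

Definition computable (f : nat -> nat) : Prop :=
  exists p, forall n, exists t, runs_within p (enc_nat n) (enc_nat (f n)) t.

(** [valid] singles out the instances of the problem in the carrier. *)
Record pproblem := PProblem {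
  carrier : Type;
  encode : carrier -> tree;
  encode_inj : injective encode;
  valid : carrier -> Prop;
  param : carrier -> nat;
  yes : carrier -> Prop
}.

Definition restrict (P : pproblem) (A : carrier P -> Prop) : pproblem :=
  PProblem (@encode_inj P) (fun x => valid x /\ A x) (@param P) (@yes P).

Definition fpt_reducible (P Q : pproblem) : Prop :=
  exists (r : carrier P -> carrier Q) (p : cmd) (f g : nat -> nat) (c : nat),
    [/\ computable f,
        computable g &
        forall x : carrier P, valid x ->
          [/\ valid (r x),
              yes x <-> yes (r x),
              param (r x) <= g (param x) &
              runs_within p (encode x) (encode (r x))
                (f (param x) * tsize (encode x) ^ c)]].

(** * Weighted circuit satisfiability and the W-hierarchy *)

Inductive gate_op := GIn | GNot | GAnd | GOr.

(** A gate is an operator together with its list of in-neighbours. *)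
Definition gate : Type := gate_op * seq nat.

(** The nodes are listed in a topological order and named by their position. *)
Record circuit := Circuit { gates : seq gate; output : nat }.

Definition is_input (g : gate) : bool := if g.1 is GIn then true else false.

Definition arity_ok (g : gate) : bool :=
  match g.1 with
  | GIn => size g.2 == 0
  | GNot => size g.2 == 1
  | GAnd | GOr => 2 <= size g.2
  end.

Definition node (c : circuit) (i : nat) : gate := nth (GIn, [::]) (gates c) i.

Definition wf_circuit (c : circuit) : Prop :=
  output c < size (gates c) /\
  forall i, i < size (gates c) ->
    [/\ arity_ok (node c i), uniq (node c i).2 &
        all (fun j => j < i) (node c i).2].

(** [F vs g] is the attribute of the gate [g] at position [size vs], where [vs]
    lists the attributes of the previous gates. *)
Definition node_attributes (T : Type) (F : seq T -> gate -> T)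
  (gs : seq gate) : seq T :=
  foldl (fun vs g => rcons vs (F vs g)) [::] gs.

(** [S] lists the input nodes that are set to true. *)
Definition gate_value (S : seq nat) (vs : seq bool) (g : gate) : bool :=
  match g.1 with
  | GIn => size vs \in S
  | GNot => ~~ nth false vs (head 0 g.2)
  | GAnd => all (nth false vs) g.2
  | GOr => has (nth false vs) g.2
  end.

Definition circuit_value (c : circuit) (S : seq nat) : bool :=
  nth false (node_attributes (gate_value S) (gates c)) (output c).

Definition gate_depth (vs : seq nat) (g : gate) : nat :=
  if g.2 is [::] then 0 else (\max_(j <- g.2) nth 0 vs j).+1.

Definition depth (c : circuit) : nat :=
  nth 0 (node_attributes gate_depth (gates c)) (output c).

(** A gate is large if it has more than two in-neighbours; the weft is the
    maximum number of large gates on a path from an input to the output. *)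
Definition gate_weft (vs : seq nat) (g : gate) : nat :=
  (2 < size g.2) + \max_(j <- g.2) nth 0 vs j.

Definition weft (c : circuit) : nat :=
  nth 0 (node_attributes gate_weft (gates c)) (output c).

Definition has_weight_sat (c : circuit) (k : nat) : Prop :=
  exists S : seq nat,
    [/\ uniq S,
        forall i, i \in S -> i < size (gates c) /\ is_input (node c i),
        size S = k &
        circuit_value c S].

Definition op_code (o : gate_op) : nat :=
  match o with GIn => 0 | GNot => 1 | GAnd => 2 | GOr => 3 end.

Definition enc_gate : gate -> tree :=
  enc_pair (fun o => enc_nat (op_code o)) (enc_seq enc_nat).

Definition enc_circuit (c : circuit) : tree :=
  Cons (enc_seq enc_gate (gates c)) (enc_nat (output c)).

Lemma enc_circuit_inj : injective enc_circuit.
Proof.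
move=> [gs o] [gs' o'] [] /enc_seq_inj-/(_ _)/= gsE /enc_nat_inj->.
rewrite gsE //; apply: enc_pair_inj; last exact/enc_seq_inj/enc_nat_inj.
by move=> a b /enc_nat_inj; case: a; case: b.
Qed.

Definition WCS (t d : nat) : pproblem :=
  @PProblem (circuit * nat) (enc_pair enc_circuit enc_nat)
    (enc_pair_inj enc_circuit_inj enc_nat_inj)
    (fun x => [/\ wf_circuit x.1, weft x.1 <= t & depth x.1 <= d])
    (fun x => x.2)
    (fun x => has_weight_sat x.1 x.2).

Definition in_W (t : nat) (P : pproblem) : Prop :=
  exists d, fpt_reducible P (WCS t d).

Definition W_hard (t : nat) (P : pproblem) : Prop :=
  forall Q : pproblem, in_W t Q -> fpt_reducible Q P.

(** * Stable marriage with covering constraints *)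

(** Preference lists are ordered from most to least preferred. *)
Record smc (M W : finType) := SMC {
  man_list : {ffun M -> seq W};
  woman_list : {ffun W -> seq M};
  dist_women : {set W};
  dist_men : {set M};
  man_list_uniq : [forall m, uniq (man_list m)];
  woman_list_uniq : [forall w, uniq (woman_list w)]
}.

Definition prefers (T : eqType) (L : seq T) (x y : T) : bool :=
  index x L < index y L.

Section Matchings.
Variables (M W : finType) (I : smc M W).
Implicit Type mu : {set M * W}.

Definition acceptable (m : M) (w : W) : bool :=
  (w \in man_list I m) && (m \in woman_list I w).

Definition is_matching mu : Prop :=
  (forall m w, (m, w) \in mu -> acceptable m w) /\
  (forall p q, p \in mu -> q \in mu -> (p.1 = q.1) \/ (p.2 = q.2) -> p = q).

Definition wife mu (m : M) : option W := [pick w | (m, w) \in mu].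
Definition husband mu (w : W) : option M := [pick m | (m, w) \in mu].

Definition feasible mu : Prop :=
  (forall w, w \in dist_women I -> husband mu w <> None) /\
  (forall m, m \in dist_men I -> wife mu m <> None).

Definition blocking mu (m : M) (w : W) : bool :=
  [&& acceptable m w,
      if wife mu m is Some w' then prefers (man_list I m) w w' else true &
      if husband mu w is Some m' then prefers (woman_list I w) m m' else true].

Definition blocking_pairs mu : {set M * W} :=
  [set p | blocking mu p.1 p.2].

Definition max_man_list : nat := \max_(m : M) size (man_list I m).
Definition max_woman_list : nat := \max_(w : W) size (woman_list I w).

Definition master_list_over_women : Prop :=
  exists ml : seq W, [/\ uniq ml, ml =i W &
    forall m, man_list I m = [seq w <- ml | w \in man_list I m]].

Definition master_list_over_men : Prop :=
  exists ml : seq M, [/\ uniq ml, ml =i M &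
    forall w, woman_list I w = [seq m <- ml | m \in woman_list I w]].

End Matchings.

Record smc_instance := SMCInstance {
  nmen : nat;
  nwomen : nat;
  market :> smc 'I_nmen 'I_nwomen
}.

Definition enc_ord (n : nat) (i : 'I_n) : tree := enc_nat i.

Definition enc_smc (I : smc_instance) : tree :=
  Cons (Cons (enc_seq (enc_seq (@enc_ord _)) (codom (man_list I)))
             (enc_seq (enc_seq (@enc_ord _)) (codom (woman_list I))))
       (Cons (enc_seq (@enc_ord _) (enum (dist_women I)))
             (enc_seq (@enc_ord _) (enum (dist_men I)))).

Lemma size_enc_seq (T U : Type) (f : T -> tree) (g : U -> tree) s t :
  enc_seq f s = enc_seq g t -> size s = size t.
Proof. by elim: s t => [|x s IH] [|y t] //= [_ /IH->]. Qed.

Lemma enc_smc_inj : injective enc_smc.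
Proof.
have ordI n : injective (@enc_ord n) by move=> i j /enc_nat_inj/val_inj.
have codomI (n : nat) (U : Type) (f g : {ffun 'I_n -> U}) :
    codom f = codom g -> f = g.
  move=> fg; apply/ffunP => i; move: fg.
  rewrite /codom /image_mem => /eq_in_map/(_ i); apply.
  by rewrite mem_enum.
have enumI (n : nat) (A B : {set 'I_n}) : enum A = enum B -> A = B.
  by move=> AB; apply/setP => i; rewrite -mem_enum AB mem_enum.
move=> [m w [ml wl dw dm u1 u2]] [m' w' [ml' wl' dw' dm' u1' u2']].
rewrite /enc_smc /= => -[e1 e2 e3 e4].
have := size_enc_seq e1; have := size_enc_seq e2.
rewrite !size_codom !card_ord => ww mm; subst m' w'.
have ? : ml = ml' by apply/codomI/(enc_seq_inj (enc_seq_inj (ordI _))).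
have ? : wl = wl' by apply/codomI/(enc_seq_inj (enc_seq_inj (ordI _))).
have ? : dw = dw' by apply/enumI/(enc_seq_inj (ordI _)).
have ? : dm = dm' by apply/enumI/(enc_seq_inj (ordI _)).
subst ml' wl' dw' dm'.
by rewrite (bool_irrelevance u1 u1') (bool_irrelevance u2 u2').
Qed.

(** An instance [(I, b)] asks for a feasible matching of [I] with at most [b]
    blocking pairs. *)
Definition SMC_problem : pproblem :=
  @PProblem (smc_instance * nat) (enc_pair enc_smc enc_nat)
    (enc_pair_inj enc_smc_inj enc_nat_inj)
    (fun=> True)
    (fun x => x.2 + max_man_list x.1)
    (fun x => exists mu : {set 'I_(nmen x.1) * 'I_(nwomen x.1)},
       [/\ is_matching x.1 mu, feasible x.1 mu & #|blocking_pairs x.1 mu| <= x.2]).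

Definition SMC1_problem : pproblem :=
  @restrict SMC_problem (fun x => dist_men x.1 = set0).

(* Main.v *)
(** Weighted satisfiability of circuits of weft 1 and depth [d] is reduced to the
    marriage problem in polynomial time.

    From circuits to cells.  In a gate of weft at most 1, a truth value is
    certified by at most [2 ^ d] claims, each about an input, a large AND gate
    being true or a large OR gate being false; below a large gate the subcircuit
    has weft 0, so that refuting a claim takes at most [2 ^ d] input values, each
    visible from at most two of the positions [s_0 < s_1 < ... < s_(k+1)] of the
    true inputs.  Hence the circuit has a solution of weight [k] iff one can
    choose claims and positions such that the claims certify the output and no
    [2 * 2 ^ d] of the positions refute a claim.  Such a choice amounts to picking
    one cell in each of [O(k ^ (2 * 2 ^ d))] families, the cells of some families
    depending on cells of the others.

    From cells to marriages.  Each family is a segment of women [o_e] and men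
    [x_e].  The only man acceptable to the first distinguished woman prefers the
    last woman of each segment, so she must be taken by a man of the segment, and
    shifting these men costs one blocking pair, which frees a woman [o_e] of our
    choice.  The budget allows no other blocking pair, so this picks one cell per
    family.  A free woman is a token: the man [t_(u,v)] that takes her frees his own
    partner, and since he has two better places he acts as a comparator of two
    lanes, the or of the tokens going to lane [u] and the and to the other one.  A
    missing dependency thus moves a token to the lane of an unselected cell; its
    family gets two tokens, and the second one reaches a woman whose freedom costs
    another blocking pair.  All lists follow the order of the indices, which gives
    both master lists. *)

Require Import Defs.
From mathcomp Require Import all_boot.
From mathcomp Require Import zify.
Set Implicit Arguments.
Unset Strict Implicit.
Unset Printing Implicit Defensive.

(** * Running times in the WHILE language *)

(* The constructors and [tsize] are shadowed by notions of [seq] and [tuple]. *)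
Local Notation tsize := Defs.tsize.
Local Notation Nil := Defs.Nil.
Local Notation Cons := Defs.Cons.

(** The parameter of the target contains the budget and the length of the men's lists, and [m1*] and
    [m2*] accept one woman per family; so the number of families may depend only on [k] and the
    fixed [d], while a family may have polynomially many cells. This rules out one big test of all
    claims against all [k + 2] positions: listing its outcomes would take a power of the circuit
    size whose exponent grows with [k]. Testing each tuple of [2 * 2 ^ d] positions separately makes
    the exponent a constant and costs only [(k + 2) ^ (2 * 2 ^ d)] families. It works because the
    falsity of an input, a statement about all true inputs at once, becomes local for sorted
    positions: the input lies strictly between two consecutive ones, the sentinels covering the two
    ends. Since the reduction has to be given as a program, a calculus of polynomial-time functions
    precedes the construction. *)

Lemma tsize_gt0 t : 0 < tsize t.
Proof. by case: t. Qed.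

Lemma ecost_ge_eval e s : tsize (eval e s) <= ecost e s.
Proof.
elim: e => //= [e1 IH1 e2 IH2|e IH|e IH]; first by rewrite ltnS leq_add.
  by case: (eval e s) IH => //= a b; lia.
by case: (eval e s) IH => //= a b; lia.
Qed.

(** Outputs are no larger than the input plus the cost; composition relies on this, since the second
    program is charged for the size of what the first one wrote. *)
Lemma exec_tsize c s n s' x : exec c s n s' -> tsize (s' x) <= tsize (s x) + n.
Proof.
elim=> {c s n s'} //=; try by move=> *; lia.
move=> y e s; rewrite /update; case: eqP => [_|_]; last by lia.
by have := ecost_ge_eval e s; lia.
Qed.

(** Shifting all variables by an offset lets one program run inside another without disturbing the
    variables below the offset. *)
Fixpoint eshift (o : nat) (e : expr) : expr :=
  match e with
  | EVar x => EVar (o + x)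
  | ENil => ENil
  | ECons e1 e2 => ECons (eshift o e1) (eshift o e2)
  | EHd e1 => EHd (eshift o e1)
  | ETl e1 => ETl (eshift o e1)
  end.

Fixpoint cshift (o : nat) (c : cmd) : cmd :=
  match c with
  | CSkip => CSkip
  | CAssign x e => CAssign (o + x) (eshift o e)
  | CSeq c1 c2 => CSeq (cshift o c1) (cshift o c2)
  | CIf e c1 c2 => CIf (eshift o e) (cshift o c1) (cshift o c2)
  | CWhile e c1 => CWhile (eshift o e) (cshift o c1)
  end.

Fixpoint ebound (e : expr) : nat :=
  match e with
  | EVar x => x.+1
  | ENil => 0
  | ECons e1 e2 => maxn (ebound e1) (ebound e2)
  | EHd e1 | ETl e1 => ebound e1
  end.

Fixpoint cbound (c : cmd) : nat :=
  match c with
  | CSkip => 0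
  | CAssign x e => maxn x.+1 (ebound e)
  | CSeq c1 c2 => maxn (cbound c1) (cbound c2)
  | CIf e c1 c2 => maxn (ebound e) (maxn (cbound c1) (cbound c2))
  | CWhile e c1 => maxn (ebound e) (cbound c1)
  end.

Definition agree (o B : nat) (S s : store) := forall x, x < B -> S (o + x) = s x.

Lemma eval_shift o B e S s : agree o B S s -> ebound e <= B ->
  eval (eshift o e) S = eval e s /\ ecost (eshift o e) S = ecost e s.
Proof.
move=> Ss; elim: e => //= [x xB|e1 IH1 e2 IH2|e IH|e IH].
- by rewrite Ss.
- by rewrite geq_max => /andP[/IH1[-> ->] /IH2[-> ->]].
- by move=> /IH[-> ->].
- by move=> /IH[-> ->].
Qed.

Lemma exec_shift o B c s n s' : exec c s n s' -> cbound c <= B ->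
  forall S, agree o B S s ->
  exists S', [/\ exec (cshift o c) S n S', agree o B S' s' &
    forall y, y < o -> S' y = S y].
Proof.
elim=> {c s n s'} /=.
- by move=> s _ S Ss; exists S; split=> //; constructor.
- move=> x e s; rewrite geq_max => /andP[xB eB] S Ss.
  have [e1 e2] := eval_shift Ss eB.
  exists (update S (o + x) (eval (eshift o e) S)); split.
  + by rewrite -e2; constructor.
  + by move=> z zB; rewrite /update eqn_add2l e1 Ss.
  + by move=> z zo; rewrite /update; case: eqP => // ?; lia.
- move=> c1 c2 s s1 s2 n1 n2 _ IH1 _ IH2.
  rewrite geq_max => /andP[/IH1{}IH1 /IH2{}IH2] S /IH1[S1 [E1 /IH2[S2 [E2 A2 F2]] F1]].
  exists S2; split=> //; first by econstructor; eauto.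
  by move=> y yo; rewrite F2 // F1.
- move=> e c1 c2 s s1 n ev _ IH.
  rewrite !geq_max => /and3P[eB c1B c2B] S Ss.
  have [e1 e2] := eval_shift Ss eB; have [S1 [E1 A1 F1]] := IH c1B S Ss.
  by exists S1; split=> //; rewrite -e2; apply: ExecIfTrue; rewrite ?e1.
- move=> e c1 c2 s s1 n ev _ IH.
  rewrite !geq_max => /and3P[eB c1B c2B] S Ss.
  have [e1 e2] := eval_shift Ss eB; have [S1 [E1 A1 F1]] := IH c2B S Ss.
  by exists S1; split=> //; rewrite -e2; apply: ExecIfFalse; rewrite ?e1.
- move=> e c s s1 s2 n1 n2 ev _ IH1 _ IH2 cB.
  have /andP[eB c1B] : (ebound e <= B) && (cbound c <= B) by rewrite -geq_max.
  move=> S Ss; have [e1 e2] := eval_shift Ss eB.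
  have [S1 [E1 A1 F1]] := IH1 c1B S Ss; have [S2 [E2 A2 F2]] := IH2 cB S1 A1.
  exists S2; split=> //; last by move=> y yo; rewrite F2 // F1.
  by rewrite -e2; apply: ExecWhileTrue E1 E2; rewrite e1.
- move=> e c s ev; rewrite geq_max => /andP[eB cB] S Ss.
  have [e1 e2] := eval_shift Ss eB.
  by exists S; split=> //; rewrite -e2; apply: ExecWhileFalse; rewrite e1.
Qed.

Fixpoint clear (o B : nat) : cmd :=
  if B is B'.+1 then CSeq (clear o B') (CAssign (o + B') ENil) else CSkip.

Lemma exec_clear o B S : exists S', [/\ exec (clear o B) S (2 * B).+1 S',
  forall x, x < B -> S' (o + x) = Nil & forall y, y < o -> S' y = S y].
Proof.
elim: B => [|B [S' [E N F]]]; first by exists S; split=> //; constructor.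
exists (update S' (o + B) Nil); split=> /=.
- rewrite (_ : (2 * B.+1).+1 = (2 * B).+1 + (ecost ENil S').+1); last by rewrite /=; lia.
  by econstructor; [exact: E|exact: ExecAssign].
- move=> x; rewrite ltnS leq_eqVlt /update eqn_add2l => /orP[->//|xB].
  by rewrite N // if_same.
- by move=> y yo; rewrite /update F //; case: eqP => // ?; lia.
Qed.

(** A program expects [Nil] in all variables but its input. The extra variable beyond [cbound p]
    makes the agreement of stores always include variable [0], which holds the result. *)
Definition call (o : nat) (p : cmd) (x : nat) : cmd :=
  CSeq (clear o (cbound p).+1) (CSeq (CAssign o (EVar x)) (cshift o p)).

Lemma exec_call o p x S t u n : x < o -> S x = t -> runs_within p t u n ->
  exists S' n', [/\ exec (call o p x) S n' S', S' o = u,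
    forall y, y < o -> S' y = S y & n' <= n + tsize t + 2 * cbound p + 4].
Proof.
move=> xo Sx [n1 [s [E su n1n]]].
have [S1 [E1 N1 F1]] := exec_clear o (cbound p).+1 S.
pose S2 := update S1 o t.
have A2 : agree o (cbound p) S2 (init_store t).
  move=> z zB; rewrite /S2 /init_store /update -{2}[o]addn0 eqn_add2l.
  by case: eqP => // _; rewrite N1 // ltnW.
have A2' : agree o (cbound p).+1 S2 (init_store t).
  move=> z zB; rewrite /S2 /init_store /update -{2}[o]addn0 eqn_add2l.
  by case: eqP => // _; rewrite N1.
have [S3 [E3 A3 F3]] := exec_shift E (leqnSn _) A2'.
exists S3, ((2 * (cbound p).+1).+1 + ((tsize (S1 x)).+1 + n1)); split.
- econstructor; first exact: E1.
  apply: ExecSeq E3.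
  have -> : S2 = update S1 o (eval (EVar x) S1) by rewrite /S2 /= F1 // Sx.
  exact: (ExecAssign o (EVar x)).
- by rewrite -su -[o]addn0 A3.
- by move=> y yo; rewrite F3 // /S2 /update; case: eqP => [?|_]; [lia|rewrite F1].
- by rewrite F1 // Sx; lia.
Qed.

(** * Polynomial bounds *)

Definition poly_bounded (F : nat -> nat) : Prop :=
  exists c, forall n, 0 < n -> F n <= c * n ^ c.

Lemma poly_bounded_le F G : (forall n, 0 < n -> F n <= G n) ->
  poly_bounded G -> poly_bounded F.
Proof. by move=> FG [c Gc]; exists c => n n0; apply: leq_trans (FG n n0) (Gc n n0). Qed.

Lemma poly_bounded_const k : poly_bounded (fun=> k).
Proof. by exists k => n n0; rewrite leq_pmulr // expn_gt0 n0. Qed.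

Lemma poly_bounded_id : poly_bounded id.
Proof. by exists 1 => n n0; rewrite mul1n expn1. Qed.

Lemma poly_bounded_add F G : poly_bounded F -> poly_bounded G ->
  poly_bounded (fun n => F n + G n).
Proof.
move=> [a Fa] [b Gb]; exists (a + b) => n n0; rewrite mulnDl leq_add //.
  by apply: leq_trans (Fa n n0) _; rewrite leq_mul // leq_pexp2l // leq_addr.
by apply: leq_trans (Gb n n0) _; rewrite leq_mul // leq_pexp2l // leq_addl.
Qed.

Lemma poly_bounded_mul F G : poly_bounded F -> poly_bounded G ->
  poly_bounded (fun n => F n * G n).
Proof.
move=> [a Fa] [b Gb]; exists (a * b + (a + b)) => n n0.
apply: leq_trans (leq_mul (Fa n n0) (Gb n n0)) _.
by rewrite mulnACA -expnD leq_mul ?leq_addr // leq_pexp2l // leq_addl.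
Qed.

Lemma poly_bounded_exp F k : poly_bounded F -> poly_bounded (fun n => F n ^ k).
Proof.
move=> Fp; elim: k => [|k IH]; first exact: poly_bounded_const.
apply: poly_bounded_le (poly_bounded_mul Fp IH) => n _.
by rewrite expnS.
Qed.

Ltac polyb := repeat first
  [ exact: poly_bounded_id | exact: poly_bounded_const | assumption
  | apply: poly_bounded_add | apply: poly_bounded_mul | apply: poly_bounded_exp ].

(** * Functions computable in polynomial time *)

Class Enc (T : Type) := encoding : T -> tree.
#[export] Instance Enc_nat : Enc nat := enc_nat.
#[export] Instance Enc_bool : Enc bool := fun b => if b then Cons Nil Nil else Nil.
#[export] Instance Enc_prod T U (eT : Enc T) (eU : Enc U) : Enc (T * U) :=
  enc_pair eT eU.
#[export] Instance Enc_seq T (eT : Enc T) : Enc (seq T) := enc_seq eT.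
#[export] Instance Enc_unit : Enc unit := fun=> Nil.
#[export] Instance Enc_op : Enc gate_op := fun o => enc_nat (op_code o).
#[export] Instance Enc_circuit : Enc circuit := enc_circuit.

Definition size_of T {eT : Enc T} (x : T) : nat := tsize (encoding x).

Definition ptime A B {eA : Enc A} {eB : Enc B} (f : A -> B) : Prop :=
  exists p c, forall a,
    runs_within p (encoding a) (encoding (f a)) (c * size_of a ^ c).

Lemma size_of_gt0 T {eT : Enc T} (x : T) : 0 < size_of x.
Proof. exact: tsize_gt0. Qed.
#[export] Hint Resolve size_of_gt0 : core.

Lemma runs_weaken p t u n m : runs_within p t u n -> n <= m ->
  runs_within p t u m.
Proof. by move=> [n' [s [E so le]]] nm; exists n', s; split=> //; apply: leq_trans nm. Qed.

Lemma runs_size p t u n : runs_within p t u n -> tsize u <= tsize t + n.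
Proof.
move=> [n' [s [E <- le]]]; have := exec_tsize 0 E.
by rewrite /init_store /update eqxx; lia.
Qed.

Definition ccomp (p q : cmd) : cmd :=
  CSeq (call 1 p 0) (CSeq (call 2 q 1) (CAssign 0 (EVar 2))).

Lemma runs_comp p q t u v n1 n2 :
  runs_within p t u n1 -> runs_within q u v n2 ->
  runs_within (ccomp p q) t v
    (2 * (n1 + n2 + tsize t + cbound p + cbound q) + 2 * tsize u + 10).
Proof.
move=> Hp Hq.
have [S1 [m1 [E1 o1 F1 l1]]] :=
  @exec_call 1 p 0 (init_store t) t u n1 isT (erefl _) Hp.
have [S2 [m2 [E2 o2 F2 l2]]] := @exec_call 2 q 1 S1 u v n2 isT o1 Hq.
eexists _, _; split.
- apply: ExecSeq E1 (ExecSeq E2 _); exact: ExecAssign.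
- by rewrite /update eqxx.
- have sv := runs_size Hq; rewrite /= o2; lia.
Qed.

Definition cpair (p q : cmd) : cmd :=
  CSeq (call 1 p 0) (CSeq (call 2 q 0) (CAssign 0 (ECons (EVar 1) (EVar 2)))).

Lemma runs_pair p q t u v n1 n2 :
  runs_within p t u n1 -> runs_within q t v n2 ->
  runs_within (cpair p q) t (Cons u v)
    (2 * (n1 + n2 + cbound p + cbound q) + 4 * tsize t + 12).
Proof.
move=> Hp Hq.
have [S1 [m1 [E1 o1 F1 l1]]] :=
  @exec_call 1 p 0 (init_store t) t u n1 isT (erefl _) Hp.
have S10 : S1 0 = t by rewrite F1.
have [S2 [m2 [E2 o2 F2 l2]]] := @exec_call 2 q 0 S1 t v n2 isT S10 Hq.
eexists _, _; split.
- apply: ExecSeq E1 (ExecSeq E2 _); exact: ExecAssign.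
- by rewrite /update eqxx /= o2 F2 // o1.
- have sv := runs_size Hq; have su := runs_size Hp; rewrite /= o2 F2 // o1; lia.
Qed.

Definition cif (b p q : cmd) : cmd :=
  CSeq (call 1 b 0)
    (CSeq (CIf (EVar 1) (call 2 p 0) (call 2 q 0)) (CAssign 0 (EVar 2))).

Lemma runs_if b p q t (c : bool) u nb n :
  runs_within b t (encoding c) nb ->
  runs_within (if c then p else q) t u n ->
  runs_within (cif b p q) t u
    (2 * (nb + n + cbound b + cbound p + cbound q) + 4 * tsize t + 20).
Proof.
move=> Hb H.
have [S1 [m1 [E1 o1 F1 l1]]] :=
  @exec_call 1 b 0 (init_store t) t _ nb isT (erefl _) Hb.
have S10 : S1 0 = t by rewrite F1.
have [S2 [m2 [E2 o2 F2 l2]]] := @exec_call 2 _ 0 S1 t u n isT S10 H.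
have E3 : exec (CIf (EVar 1) (call 2 p 0) (call 2 q 0)) S1 ((tsize (S1 1)).+1 + m2) S2.
  case: c E2 o1 {Hb H l2} => E2 o1.
    by apply: ExecIfTrue E2; rewrite /= o1.
  by apply: ExecIfFalse E2; rewrite /= o1.
eexists _, _; split.
- apply: ExecSeq E1 (ExecSeq E3 _); exact: ExecAssign.
- by rewrite /update eqxx /= o2.
- have sv := runs_size H; rewrite /= o2 o1.
  have : tsize (encoding c) <= 3 by case: (c).
  by move: l2; case: (c) => l2; lia.
Qed.

Definition cwhile (i b s : cmd) : cmd :=
  CSeq (call 1 i 0) (CSeq (call 2 b 1)
   (CSeq (CWhile (EVar 2) (CSeq (call 3 s 1) (CSeq (CAssign 1 (EVar 3)) (call 2 b 1))))
      (CAssign 0 (EVar 1)))).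

Lemma runs_while T {eT : Enc T} i b s t (x : T) (test : T -> bool) (step : T -> T)
    m ni N :
  runs_within i t (encoding x) ni ->
  (forall j, j < m -> test (iter j step x)) -> test (iter m step x) = false ->
  (forall j, j <= m ->
    [/\ runs_within b (encoding (iter j step x)) (encoding (test (iter j step x))) N,
        runs_within s (encoding (iter j step x)) (encoding (iter j.+1 step x)) N &
        size_of (iter j step x) <= N]) ->
  runs_within (cwhile i b s) t (encoding (iter m step x))
    (ni + tsize t + 2 * cbound i + 20 +
     m.+1 * (10 * N + 2 * cbound b + 2 * cbound s + 20)).
Proof.
move=> Hi tT tF H.
have [S1 [m1 [E1 o1 F1 l1]]] :=
  @exec_call 1 i 0 (init_store t) t _ ni isT (erefl _) Hi.
have [Hb _ sx] := H 0 isT.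
have [S2 [m2 [E2 o2 F2 l2]]] := @exec_call 2 b 1 S1 _ _ N isT o1 Hb.
rewrite /size_of /= in sx.
have S21 : S2 1 = encoding x by rewrite F2.
(* Invariant: variable [1] holds the state after [j] rounds and variable [2] the value of the test
   on it; [k] counts the rounds left. *)
have loop k j St : j + k = m -> St 1 = encoding (iter j step x) ->
    St 2 = encoding (test (iter j step x)) ->
    exists n' St', [/\ exec (CWhile (EVar 2)
        (CSeq (call 3 s 1) (CSeq (CAssign 1 (EVar 3)) (call 2 b 1)))) St n' St',
      St' 1 = encoding (iter m step x) &
      n' <= k * (5 * N + 2 * cbound b + 2 * cbound s + 20) + 4].
  elim: k j St => [|k IH] j St.
    rewrite addn0 => -> St1; rewrite tF => St2.
    exists (ecost (EVar 2) St).+1, St; split=> //; first exact: ExecWhileFalse.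
    by rewrite /= St2.
  move=> jk St1; have jm : j < m by lia.
  rewrite (tT _ jm) => St2; have [_ Hs sj] := H j (ltnW jm).
  have [Hb' _ sj'] := H j.+1 jm; rewrite /size_of in sj sj'.
  have [T1 [k1 [X1 p1 G1 b1]]] := @exec_call 3 s 1 St _ _ N isT St1 Hs.
  pose T2 := update T1 1 (T1 3).
  have T21 : T2 1 = encoding (iter j.+1 step x) by rewrite /T2 /update eqxx p1.
  have [T3 [k3 [X3 p3 G3 b3]]] := @exec_call 2 b 1 T2 _ _ N isT T21 Hb'.
  have T31 : T3 1 = encoding (iter j.+1 step x) by rewrite G3.
  have [n' [St' [X4 q4 b4]]] := IH j.+1 T3 ltac:(lia) T31 p3.
  eexists _, St'; split.
  - apply: ExecWhileTrue X4; first by rewrite /= St2.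
    apply: ExecSeq X1 (ExecSeq _ X3); exact: ExecAssign.
  - exact: q4.
  - rewrite /= St2 p1 /=; move: sj sj' b1 b3 b4 => /= sj sj' b1 b3 b4; rewrite mulSn.
    move: (k * _) b4 (tsize _) sj' b3 (tsize _) sj b1 => X b4 sz sj' b3 sz' sj b1.
    clear -b1 b3 b4 sj sj'; lia.
have [n' [St' [X q bn]]] := loop m 0 S2 (add0n m) S21 o2.
eexists _, _; split.
- apply: ExecSeq E1 (ExecSeq E2 (ExecSeq X _)); exact: ExecAssign.
- by rewrite /update eqxx /= q.
- rewrite /= q; have [_ _] := H m (leqnn m); rewrite /size_of; lia.
Qed.

Fixpoint esize (e : expr) : nat :=
  match e with
  | EVar _ | ENil => 1
  | ECons e1 e2 => (esize e1 + esize e2).+1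
  | EHd e1 | ETl e1 => (esize e1).+1
  end.

Lemma ecost_init e t : ecost e (init_store t) <= esize e * tsize t.
Proof.
have t0 := tsize_gt0 t.
elim: e => /= [x||e1 IH1 e2 IH2|e IH|e IH]; try by rewrite ?mulSn ?mulnDl; lia.
by rewrite /init_store /update mul1n; case: ifP.
Qed.

Lemma ptimeI A B {eA : Enc A} {eB : Enc B} p F (f : A -> B) : poly_bounded F ->
  (forall a, runs_within p (encoding a) (encoding (f a)) (F (size_of a))) ->
  ptime f.
Proof.
by move=> [c Fc] H; exists p, c => a; apply: runs_weaken (H a) (Fc _ _).
Qed.

Section Closure.
Context {A B D : Type} {eA : Enc A} {eB : Enc B} {eD : Enc D}.

Lemma ptime_ext (f g : A -> B) : f =1 g -> ptime f -> ptime g.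
Proof. by move=> fg [p [c H]]; exists p, c => a; rewrite -fg. Qed.

Lemma ptime_size (f : A -> B) : ptime f ->
  exists2 F, poly_bounded F & forall a, size_of (f a) <= F (size_of a).
Proof.
move=> [p [c H]]; exists (fun n => n + c * n ^ c); first by polyb.
by move=> a; apply: runs_size (H a).
Qed.

Lemma ptime_expr e (f : A -> B) :
  (forall a, eval e (init_store (encoding a)) = encoding (f a)) -> ptime f.
Proof.
move=> H; apply: (ptimeI (p := CAssign 0 e) (F := fun n => (esize e * n).+1)).
  by apply: (poly_bounded_add (poly_bounded_const 1)); polyb.
move=> a; eexists _, _; split; first exact: ExecAssign.
  by rewrite /update eqxx H.
by rewrite ltnS ecost_init.
Qed.

Lemma leq_expr k a b : a <= b -> a ^ k <= b ^ k.
Proof. by case: k => // k ab; rewrite leq_exp2r. Qed.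

Lemma ptime_comp (g : B -> D) (f : A -> B) :
  ptime g -> ptime f -> ptime (fun a => g (f a)).
Proof.
move=> [q [cq Hq]] fP; have [F Fp Fs] := ptime_size fP.
case: fP => p [cp Hp].
apply: (ptimeI (p := ccomp p q) (F := fun n => 2 * (cp * n ^ cp + cq * F n ^ cq + n + cbound p + cbound q)
   + 2 * F n + 10)); first by polyb.
move=> a; apply: runs_weaken (runs_comp (Hp a) (Hq (f a))) _.
have sF := Fs a; have := leq_mul (leqnn cq) (leq_expr cq sF).
by rewrite -!/(size_of _); lia.
Qed.

Lemma ptime_pair (f : A -> B) (g : A -> D) :
  ptime f -> ptime g -> ptime (fun a => (f a, g a)).
Proof.
move=> [p [cp Hp]] [q [cq Hq]].
apply: (ptimeI (p := cpair p q) (F := fun n =>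
  2 * (cp * n ^ cp + cq * n ^ cq + cbound p + cbound q) + 4 * n + 12)); first by polyb.
by move=> a; apply: runs_pair.
Qed.

Lemma ptime_if (b : A -> bool) (f g : A -> B) :
  ptime b -> ptime f -> ptime g -> ptime (fun a => if b a then f a else g a).
Proof.
move=> [p [cp Hp]] [q [cq Hq]] [r [cr Hr]].
apply: (ptimeI (p := cif p q r) (F := fun n =>
  2 * (cp * n ^ cp + (cq * n ^ cq + cr * n ^ cr) + cbound p + cbound q + cbound r)
  + 4 * n + 20)); first by polyb.
move=> a; apply: runs_if (Hp a) _; case: (b a).
  by apply: runs_weaken (Hq a) _; rewrite leq_addr.
by apply: runs_weaken (Hr a) _; rewrite leq_addl.
Qed.

(** A polynomial-time step repeated polynomially often can still build exponentially large values;
    hence the separate bound [G] on every intermediate state. *)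
Lemma ptime_while (init : A -> B) (test : B -> bool) (step : B -> B) (m : A -> nat) G :
  ptime init -> ptime test -> ptime step -> poly_bounded G ->
  (forall a, m a <= G (size_of a)) ->
  (forall a j, j < m a -> test (iter j step (init a))) ->
  (forall a, test (iter (m a) step (init a)) = false) ->
  (forall a j, j <= m a -> size_of (iter j step (init a)) <= G (size_of a)) ->
  ptime (fun a => iter (m a) step (init a)).
Proof.
move=> [i [ci Hi]] [b [cb Hb]] [s [cs Hs]] Gp mG tT tF sG.
apply: (ptimeI (p := cwhile i b s) (F := fun n =>
  ci * n ^ ci + n + 2 * cbound i + 20 + (G n + 1) *
    (10 * (cb * G n ^ cb + cs * G n ^ cs + G n) + 2 * cbound b + 2 * cbound s + 20))).
  by polyb.
move=> a; pose g := G (@size_of A eA a); pose N := cb * g ^ cb + cs * g ^ cs + g.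
have := runs_while (N := N) (Hi a) (tT a) (tF a) => H.
refine (runs_weaken (H _ _ _) _).
  move=> j jm; have sj := sG a j jm; split.
  - apply: runs_weaken (Hb _) _; rewrite /N -addnA; apply: leq_trans (leq_addr _ _).
    by rewrite leq_mul // leq_expr.
  - apply: runs_weaken (Hs _) _; rewrite /N addnAC; apply: leq_trans (leq_addl _ _).
    by rewrite leq_mul // leq_expr.
  - by apply: leq_trans sj _; rewrite /N leq_addl.
by rewrite leq_add2l -/N leq_mul // addn1 ltnS.
Qed.
End Closure.

Lemma ptime_bound A B {eA : Enc A} {eB : Enc B} (f : A -> B) : ptime f ->
  exists c, forall a, size_of (f a) <= c * size_of a ^ c.
Proof. by case/ptime_size => F [c Fc] H; exists c => a; apply: leq_trans (H a) (Fc _ _). Qed.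

Section Basics.
Context {A B D : Type} {eA : Enc A} {eB : Enc B} {eD : Enc D}.

Lemma ptime_id : ptime (fun a : A => a).
Proof. exact: (ptime_expr (e := EVar 0)). Qed.

Fixpoint tree_expr (t : tree) : expr :=
  if t is Defs.Cons a b then ECons (tree_expr a) (tree_expr b) else ENil.

Lemma eval_tree_expr t s : eval (tree_expr t) s = t.
Proof. by elim: t => //= a -> b ->. Qed.

Lemma ptime_const (b : B) : ptime (fun _ : A => b).
Proof.
by apply: (ptime_expr (e := tree_expr (encoding b))) => a; rewrite eval_tree_expr.
Qed.

Lemma ptime_fst (f : A -> B * D) : ptime f -> ptime (fun a => (f a).1).
Proof. by apply: ptime_comp; apply: (ptime_expr (e := EHd (EVar 0))) => -[]. Qed.

Lemma ptime_snd (f : A -> B * D) : ptime f -> ptime (fun a => (f a).2).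
Proof. by apply: ptime_comp; apply: (ptime_expr (e := ETl (EVar 0))) => -[]. Qed.

Lemma ptime_cons (f : A -> B) (g : A -> seq B) :
  ptime f -> ptime g -> ptime (fun a => f a :: g a).
Proof.
move=> fP gP; apply: (ptime_comp (g := fun p => p.1 :: p.2) _ (ptime_pair fP gP)).
by apply: (ptime_expr (e := EVar 0)) => -[].
Qed.

Lemma ptime_behead (f : A -> seq B) : ptime f -> ptime (fun a => behead (f a)).
Proof. by apply: ptime_comp; apply: (ptime_expr (e := ETl (EVar 0))) => -[]. Qed.

Lemma ptime_succ (f : A -> nat) : ptime f -> ptime (fun a => (f a).+1).
Proof. by apply: ptime_comp; apply: (ptime_expr (e := ECons ENil (EVar 0))). Qed.

Lemma ptime_pred (f : A -> nat) : ptime f -> ptime (fun a => (f a).-1).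
Proof. by apply: ptime_comp; apply: (ptime_expr (e := ETl (EVar 0))) => -[]. Qed.

(** Covers the tests that hold exactly when the code is [Nil]: emptiness of a list, vanishing of a
    number, falsity of a boolean. *)
Lemma ptime_istrue (f : A -> B) (b : B -> bool) :
  (forall x, b x = if encoding x is Defs.Nil then true else false) ->
  ptime f -> ptime (fun a => b (f a)).
Proof.
move=> bE; apply: ptime_comp.
apply: (ptimeI (p := CIf (EVar 0) (CAssign 0 ENil) (CAssign 0 (ECons ENil ENil)))
  (F := fun n => n + 6)); first by polyb.
move=> a; rewrite /size_of; case Ea: (encoding a) => [|t u].
  eexists _, _; split; first by apply: ExecIfFalse; [|exact: ExecAssign].
    by rewrite /update /= bE Ea.
  by [].
eexists _, _; split.
- by apply: ExecIfTrue; [|exact: ExecAssign].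
- by rewrite /update /= bE Ea.
- by rewrite /init_store /update /=; lia.
Qed.

End Basics.

Section Tests.
Context {A B : Type} {eA : Enc A} {eB : Enc B}.

Lemma ptime_nilp (f : A -> seq B) : ptime f -> ptime (fun a => nilp (f a)).
Proof. by apply: ptime_istrue => -[]. Qed.

Lemma ptime_eq0 (f : A -> nat) : ptime f -> ptime (fun a => f a == 0).
Proof. by apply: (ptime_istrue (b := fun n => n == 0)) => -[]. Qed.

Lemma ptime_head (x0 : B) (f : A -> seq B) : ptime f -> ptime (fun a => head x0 (f a)).
Proof.
(* The head of [Nil] is [Nil], which need not be the code of [x0]; so the default is first put into
   the list. *)
move=> fP; have H : ptime (fun a => if nilp (f a) then [:: x0] else f a).
  exact: (ptime_if (ptime_nilp fP) (ptime_const _) fP).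
apply: (ptime_ext (f := fun a => head x0 (if nilp (f a) then [:: x0] else f a))).
  by move=> a; case: (f a).
case: H => p [c Hp].
apply: (ptimeI (p := CSeq p (CAssign 0 (EHd (EVar 0))))
  (F := fun n => 2 * (c * n ^ c) + n + 3)); first by polyb.
move=> a; have [n [s [E so le]]] := Hp a; eexists _, _; split.
- apply: ExecSeq E _; exact: ExecAssign.
- by rewrite /update eqxx /= so; case: (f a) => [|x l] /=.
- have := exec_tsize 0 E; rewrite /= {1}/init_store /update eqxx -/(size_of a); lia.
Qed.

Lemma ptime_negb (f : A -> bool) : ptime f -> ptime (fun a => ~~ f a).
Proof. by apply: ptime_istrue => -[]. Qed.

Lemma ptime_andb (f g : A -> bool) : ptime f -> ptime g -> ptime (fun a => f a && g a).
Proof. by move=> fP gP; apply: (ptime_if fP gP (ptime_const false)). Qed.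

Lemma ptime_orb (f g : A -> bool) : ptime f -> ptime g -> ptime (fun a => f a || g a).
Proof. by move=> fP gP; apply: (ptime_if fP (ptime_const true) gP). Qed.

Lemma ptime_implyb (f g : A -> bool) : ptime f -> ptime g -> ptime (fun a => f a ==> g a).
Proof. by move=> fP gP; apply: (ptime_if fP gP (ptime_const true)). Qed.
End Tests.

Lemma size_of_cons T {eT : Enc T} x (s : seq T) :
  size_of (x :: s) = (size_of x + size_of s).+1.
Proof. by []. Qed.

Lemma size_of_pair T U {eT : Enc T} {eU : Enc U} (p : T * U) :
  size_of p = (size_of p.1 + size_of p.2).+1.
Proof. by []. Qed.

Section Lists.
Context {T : Type} {eT : Enc T}.
Implicit Type s : seq T.

Lemma size_le_size_of s : size s < size_of s.
Proof. by elim: s => //= x s; rewrite size_of_cons; have : 0 < size_of x by []; lia. Qed.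

Lemma size_of_cat s1 s2 : (size_of (s1 ++ s2)).+1 = size_of s1 + size_of s2.
Proof. by elim: s1 => [|x s1 IH] //=; rewrite !size_of_cons; lia. Qed.

Lemma size_of_rev s : size_of (rev s) = size_of s.
Proof.
elim: s => //= x s IH; rewrite rev_cons -cats1.
by have := size_of_cat (rev s) [:: x]; rewrite !size_of_cons IH [size_of [::]]/size_of /=; lia.
Qed.

Lemma size_of_take i s : size_of (take i s) <= size_of s.
Proof. by have := size_of_cat (take i s) (drop i s); rewrite cat_take_drop; have : 0 < size_of (drop i s) by []; lia. Qed.

Lemma size_of_drop i s : size_of (drop i s) <= size_of s.
Proof. by have := size_of_cat (take i s) (drop i s); rewrite cat_take_drop; have : 0 < size_of (take i s) by []; lia. Qed.

Lemma size_of_filter (p : pred T) s : size_of (filter p s) <= size_of s.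
Proof. by elim: s => //= x s IH; case: ifP => _; rewrite !size_of_cons; lia. Qed.

Lemma size_of_map U {eU : Enc U} (f : U -> T) (l : seq U) K :
  (forall e, size_of e <= size_of l -> size_of (f e) <= K) ->
  size_of (map f l) <= 1 + size l * K.+1.
Proof.
elim: l => // x l IH H; rewrite /= size_of_cons mulSn.
have hx : size_of (f x) <= K by apply: H; rewrite size_of_cons; lia.
have hl : size_of (map f l) <= 1 + size l * K.+1.
  apply: IH => e el; apply: H; apply: leq_trans el _.
  by rewrite size_of_cons; lia.
by lia.
Qed.
End Lists.

(** Loops over a list read the current element with [head], which wants a default. *)
Class Pointed (T : Type) := point : T.
#[export] Instance Pointed_nat : Pointed nat := 0.
#[export] Instance Pointed_bool : Pointed bool := false.
#[export] Instance Pointed_unit : Pointed unit := tt.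
#[export] Instance Pointed_op : Pointed gate_op := GIn.
#[export] Instance Pointed_prod T U (pT : Pointed T) (pU : Pointed U) : Pointed (T * U) :=
  (point, point).
#[export] Instance Pointed_seq T : Pointed (seq T) := [::].

Section Fold.
Context {A E S : Type} {eA : Enc A} {eE : Enc E} {eS : Enc S} {pE : Pointed E}.

Lemma ptime_foldl (l : A -> seq E) (s0 : A -> S) (f : A -> S -> E -> S) G :
  ptime l -> ptime s0 -> ptime (fun p : (A * E) * S => f p.1.1 p.2 p.1.2) ->
  poly_bounded G ->
  (forall a i, i <= size (l a) -> size_of (foldl (f a) (s0 a) (take i (l a))) <= G (size_of a)) ->
  ptime (fun a => foldl (f a) (s0 a) (l a)).
Proof.
move=> lP sP fP Gp GS.
have [e0 _] : exists _ : E, True by exists pE.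
(* The parameter [a] travels in the loop state, because a step sees nothing else. *)
pose init a := ((a, l a), s0 a).
pose test (st : (A * seq E) * S) := ~~ nilp st.1.2.
pose step (st : (A * seq E) * S) :=
  ((st.1.1, behead st.1.2), f st.1.1 st.2 (head e0 st.1.2)).
have iterE a j : j <= size (l a) -> iter j step (init a) =
    ((a, drop j (l a)), foldl (f a) (s0 a) (take j (l a))).
  elim: j => [|j IH] jl; first by rewrite take0 drop0.
  rewrite iterS IH ?(ltnW jl) // /step /= (take_nth e0 jl) -cats1 foldl_cat /=.
  by rewrite (drop_nth e0 jl) /=.
have [cl Hl] := ptime_bound lP.
have H : ptime (fun a => iter (size (l a)) step (init a)).
  apply: (ptime_while (test := test) (G := fun n => 2 + n + (cl * n ^ cl + G n))).
  - by apply: ptime_pair sP; apply: ptime_pair lP; apply: ptime_id.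
  - by apply/ptime_negb/ptime_nilp/ptime_snd/ptime_fst/ptime_id.
  - have p11 : ptime (fun st : (A * seq E) * S => st.1.1) by apply/ptime_fst/ptime_fst/ptime_id.
    have p12 : ptime (fun st : (A * seq E) * S => st.1.2) by apply/ptime_snd/ptime_fst/ptime_id.
    apply: ptime_pair; first by apply: ptime_pair => //; apply: ptime_behead.
    apply: (ptime_comp (g := fun p : (A * E) * S => f p.1.1 p.2 p.1.2) fP
      (f := fun st : (A * seq E) * S => ((st.1.1, head e0 st.1.2), st.2))).
    apply: ptime_pair; last by apply/ptime_snd/ptime_id.
    by apply: ptime_pair => //; apply: ptime_head.
  - by polyb.
  - move=> a; have : size (l a) < size_of (l a) by apply: size_le_size_of.
    by have := Hl a; lia.
  - by move=> a j jl; rewrite iterE 1?ltnW // /test /= /nilp size_drop subn_eq0 -ltnNge.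
  - by move=> a; rewrite iterE // /test /= drop_size.
  - move=> a j jl; rewrite iterE //.
    have := GS a j jl; have := Hl a.
    have : size_of (drop j (l a)) <= size_of (l a) by apply: size_of_drop.
    by rewrite !size_of_pair /=; lia.
apply: (ptime_ext _ (ptime_snd H)) => a.
by rewrite iterE // take_size.
Qed.

End Fold.

Section Quantifiers.
Context {A E : Type} {eA : Enc A} {eE : Enc E} {pE : Pointed E}.

Lemma ptime_foldl_bool (l : A -> seq E) (f : A -> bool -> E -> bool) b :
  ptime l -> ptime (fun p : (A * E) * bool => f p.1.1 p.2 p.1.2) ->
  ptime (fun a => foldl (f a) b (l a)).
Proof.
move=> lP fP; apply: (ptime_foldl (G := fun=> 3)) => //; [exact: ptime_const|by polyb|].
by move=> a i _; case: (foldl _ _ _).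
Qed.

Lemma ptime_has (l : A -> seq E) (f : A -> E -> bool) :
  ptime l -> ptime (fun p : A * E => f p.1 p.2) -> ptime (fun a => has (f a) (l a)).
Proof.
move=> lP fP; apply: (ptime_ext (f := fun a => foldl (fun b e => b || f a e) false (l a))).
  move=> a; rewrite -[RHS]orFb; elim: (l a) false => [|e s IH] b /=; first by rewrite orbF.
  by rewrite IH orbA.
apply: (ptime_foldl_bool (f := fun a b e => b || f a e)) => //.
apply: ptime_orb; first by apply/ptime_snd/ptime_id.
by apply: (ptime_comp (g := fun p : A * E => f p.1 p.2)) => //; apply/ptime_fst/ptime_id.
Qed.

Lemma ptime_all (l : A -> seq E) (f : A -> E -> bool) :
  ptime l -> ptime (fun p : A * E => f p.1 p.2) -> ptime (fun a => all (f a) (l a)).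
Proof.
move=> lP fP; apply: (ptime_ext (f := fun a => ~~ has (fun e => ~~ f a e) (l a))).
  by move=> a; rewrite -all_predC; apply: eq_all => e /=; rewrite negbK.
by apply/ptime_negb/ptime_has => //; apply/ptime_negb.
Qed.
End Quantifiers.

Section Seqs.
Context {A E : Type} {eA : Enc A} {eE : Enc E} {pE : Pointed E}.

Lemma ptime_catrev (l1 l2 : A -> seq E) : ptime l1 -> ptime l2 ->
  ptime (fun a => catrev (l1 a) (l2 a)).
Proof.
move=> P1 P2; have [c1 H1] := ptime_bound P1; have [c2 H2] := ptime_bound P2.
have revE (s t : seq E) : foldl (fun s e => e :: s) t s = catrev s t.
  by elim: s t => //= x s IH t; rewrite IH.
apply: (ptime_ext (f := fun a => foldl (fun s e => e :: s) (l2 a) (l1 a))).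
  by move=> a; rewrite revE.
apply: (ptime_foldl (f := fun _ s e => e :: s)
  (G := fun n => c1 * n ^ c1 + c2 * n ^ c2)) => //.
- by apply: ptime_cons; [apply/ptime_snd/ptime_fst/ptime_id|apply/ptime_snd/ptime_id].
- by polyb.
- move=> a i _; rewrite revE catrevE.
  generalize (size_of_cat (rev (take i (l1 a))) (l2 a)); rewrite size_of_rev.
  by generalize (size_of_take i (l1 a)); have := H1 a; have := H2 a; lia.
Qed.

Lemma ptime_rev (l : A -> seq E) : ptime l -> ptime (fun a => rev (l a)).
Proof. by move=> lP; apply: ptime_catrev lP (ptime_const _). Qed.

Lemma ptime_cat (l1 l2 : A -> seq E) : ptime l1 -> ptime l2 ->
  ptime (fun a => l1 a ++ l2 a).
Proof.
move=> P1 P2; apply: (ptime_ext (f := fun a => catrev (rev (l1 a)) (l2 a))).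
  by move=> a; rewrite catrevE revK.
by apply: ptime_catrev => //; apply: ptime_rev.
Qed.

Lemma ptime_filter (l : A -> seq E) (p : A -> E -> bool) :
  ptime l -> ptime (fun q : A * E => p q.1 q.2) -> ptime (fun a => filter (p a) (l a)).
Proof.
move=> lP pP; have [c Hc] := ptime_bound lP.
have filterE a (s : seq E) :
    foldl (fun s e => if p a e then e :: s else s) [::] s = rev (filter (p a) s).
  rewrite /rev; elim: s [::] => //= x s IH t; rewrite IH.
  by case: (p a x).
apply: (ptime_ext (f := fun a => rev (foldl (fun s e => if p a e then e :: s else s) [::] (l a)))).
  by move=> a; rewrite filterE revK.
apply: ptime_rev.
apply: (ptime_foldl (f := fun a s e => if p a e then e :: s else s)
  (G := fun n => c * n ^ c)) => //.
- exact: ptime_const.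
- apply: ptime_if.
  + by apply: (ptime_comp (g := fun q : A * E => p q.1 q.2) pP); apply/ptime_fst/ptime_id.
  + by apply: ptime_cons; [apply/ptime_snd/ptime_fst/ptime_id|apply/ptime_snd/ptime_id].
  + by apply/ptime_snd/ptime_id.
- by polyb.
- move=> a i _; rewrite filterE size_of_rev.
  by apply: leq_trans (size_of_filter _ _) (leq_trans (size_of_take _ _) (Hc a)).
Qed.
End Seqs.

Section Map.
Context {A E U : Type} {eA : Enc A} {eE : Enc E} {eU : Enc U} {pE : Pointed E} {pU : Pointed U}.

Lemma ptime_map (l : A -> seq E) (f : A -> E -> U) :
  ptime l -> ptime (fun q : A * E => f q.1 q.2) -> ptime (fun a => map (f a) (l a)).
Proof.
move=> lP fP; have [c Hc] := ptime_bound lP; have [k Hk] := ptime_bound fP.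
have mapE a (s : seq E) :
    foldl (fun s e => f a e :: s) [::] s = rev (map (f a) s).
  by rewrite /rev; elim: s [::] => //= x s IH t; rewrite IH.
apply: (ptime_ext (f := fun a => rev (foldl (fun s e => f a e :: s) [::] (l a)))).
  by move=> a; rewrite mapE revK.
apply: ptime_rev.
apply: (ptime_foldl (f := fun a s e => f a e :: s)
  (G := fun n => 1 + (c * n ^ c) * (k * (n + c * n ^ c + 1) ^ k + 1))) => //.
- exact: ptime_const.
- apply: ptime_cons; last by apply/ptime_snd/ptime_id.
  by apply: (ptime_comp (g := fun q : A * E => f q.1 q.2) fP); apply/ptime_fst/ptime_id.
- by polyb.
- move=> a i il; rewrite mapE size_of_rev.
  apply: leq_trans (size_of_map (K := k * (size_of a + c * size_of a ^ c + 1) ^ k) _) _.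
    move=> e el; apply: leq_trans (Hk (a, e)) _; rewrite leq_mul // leq_expr //.
    have := leq_trans el (leq_trans (size_of_take _ _) (Hc a)).
    by rewrite size_of_pair /=; lia.
  rewrite leq_add2l leq_mul // ?addn1 // size_take.
  have : size (l a) < size_of (l a) by apply: size_le_size_of.
  by have := Hc a; case: ifP; lia.
Qed.
End Map.

Section Nat.
Context {A E : Type} {eA : Enc A} {eE : Enc E} {pE : Pointed E}.

Lemma ptime_flatten (l : A -> seq (seq E)) : ptime l -> ptime (fun a => flatten (l a)).
Proof.
move=> lP; have [c Hc] := ptime_bound lP.
have flE (s : seq (seq E)) t : foldl (fun s e => catrev e s) t s = rev (flatten s) ++ t.
  by elim: s t => //= x s IH t; rewrite IH rev_cat catrevE catA.
apply: (ptime_ext (f := fun a => rev (foldl (fun s e => catrev e s) [::] (l a)))).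
  by move=> a; rewrite flE cats0 revK.
apply: ptime_rev.
apply: (ptime_foldl (f := fun a s e => catrev e s) (G := fun n => c * n ^ c)) => //.
- exact: ptime_const.
- by apply: ptime_catrev; [apply/ptime_snd/ptime_fst/ptime_id|apply/ptime_snd/ptime_id].
- by polyb.
- move=> a i _; rewrite flE cats0 size_of_rev.
  apply: leq_trans (leq_trans (size_of_take i _) (Hc a)).
  elim: (take i (l a)) => //= x s IH; rewrite size_of_cons.
  by generalize (size_of_cat x (flatten s)); lia.
Qed.

Lemma ptime_iter S {eS : Enc S} (m : A -> nat) (s0 : A -> S) (f : A -> S -> S) G :
  ptime m -> ptime s0 -> ptime (fun p : A * S => f p.1 p.2) -> poly_bounded G ->
  (forall a i, i <= m a -> size_of (iter i (f a) (s0 a)) <= G (size_of a)) ->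
  ptime (fun a => iter (m a) (f a) (s0 a)).
Proof.
move=> mP sP fP Gp H.
have iterE a i : foldl (fun s _ => f a s) (s0 a) (nseq i tt) = iter i (f a) (s0 a).
  by elim: i (s0 a) => //= i IH s; rewrite IH -iterSr.
apply: (ptime_ext (f := fun a => foldl (fun s _ => f a s) (s0 a) (nseq (m a) tt))).
  by move=> a; rewrite iterE.
apply: (ptime_foldl (f := fun a s _ => f a s) (G := G)) => //.
- apply: (ptime_comp (g := fun p : A * S => f p.1 p.2) (f := fun p : (A * unit) * S => (p.1.1, p.2)) fP).
  by apply: ptime_pair; [apply/ptime_fst/ptime_fst/ptime_id|apply/ptime_snd/ptime_id].
- by move=> a i; rewrite size_nseq => im; rewrite take_nseq // iterE H.
Qed.
End Nat.

Section Arith.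
Context {A : Type} {eA : Enc A}.
Implicit Types f g : A -> nat.

Lemma size_of_nat (n : nat) : size_of n = (2 * n).+1.
Proof.
elim: n => // n IH; have -> : size_of n.+1 = (size_of n).+2 by [].
by rewrite IH mulnS.
Qed.

Lemma ptime_add f g : ptime f -> ptime g -> ptime (fun a => f a + g a).
Proof.
move=> fP gP; have [c Hc] := ptime_bound fP; have [d Hd] := ptime_bound gP.
apply: (ptime_ext (f := fun a => iter (f a) succn (g a))) => [a|].
  by elim: (f a) => //= n ->; rewrite addSn.
apply: (ptime_iter (f := fun _ => succn) (G := fun n => c * n ^ c + d * n ^ d)) => //.
- by apply/ptime_succ/ptime_snd/ptime_id.
- by polyb.
- move=> a i ia; have -> : iter i succn (g a) = i + g a by elim: (i) => //= n ->; rewrite addSn.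
  by have := Hc a; have := Hd a; rewrite !size_of_nat; lia.
Qed.

Lemma ptime_sub f g : ptime f -> ptime g -> ptime (fun a => f a - g a).
Proof.
move=> fP gP; have [c Hc] := ptime_bound fP.
apply: (ptime_ext (f := fun a => iter (g a) predn (f a))) => [a|].
  by rewrite iter_predn.
apply: (ptime_iter (f := fun _ => predn) (G := fun n => c * n ^ c)) => //.
- by apply/ptime_pred/ptime_snd/ptime_id.
- by polyb.
- by move=> a i ia; rewrite iter_predn; have := Hc a; rewrite !size_of_nat; lia.
Qed.

Lemma ptime_leq f g : ptime f -> ptime g -> ptime (fun a => f a <= g a).
Proof. by move=> fP gP; apply/ptime_eq0/ptime_sub. Qed.

Lemma ptime_eqn f g : ptime f -> ptime g -> ptime (fun a => f a == g a).
Proof.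
move=> fP gP; apply: (ptime_ext (f := fun a => (f a <= g a) && (g a <= f a))).
  by move=> a; rewrite -eqn_leq.
by apply: ptime_andb; apply: ptime_leq.
Qed.

End Arith.

Section Products.
Context {A : Type} {eA : Enc A}.
Implicit Types f g : A -> nat.

Lemma ptime_mul f g : ptime f -> ptime g -> ptime (fun a => f a * g a).
Proof.
move=> fP gP; have [c Hc] := ptime_bound fP; have [d Hd] := ptime_bound gP.
have mE a i : iter i (addn (g a)) 0 = i * g a by elim: i => //= n ->; rewrite mulSn.
apply: (ptime_ext (f := fun a => iter (f a) (addn (g a)) 0)) => [a|].
  by rewrite mE.
apply: (ptime_iter (f := fun a => addn (g a)) (G := fun n => (c * n ^ c) * (d * n ^ d) + 1)) => //.
- exact: ptime_const.
- apply: ptime_add; last by apply/ptime_snd/ptime_id.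
  by apply: (ptime_comp (g := g) gP); apply/ptime_fst/ptime_id.
- by polyb.
- move=> a i ia; rewrite mE size_of_nat addn1 ltnS mulnA leq_mul //.
    by apply: leq_trans (Hc a); rewrite size_of_nat; lia.
  by apply: leq_trans (Hd a); rewrite size_of_nat; lia.
Qed.

Lemma ptime_iota f g : ptime f -> ptime g -> ptime (fun a => iota (f a) (g a)).
Proof.
move=> fP gP; have [c Hc] := ptime_bound fP; have [d Hd] := ptime_bound gP.
have iE m i : iter i (fun s : nat * seq nat => (s.1.+1, s.1 :: s.2)) (m, [::])
    = (m + i, rev (iota m i)).
  elim: i => [|i IH]; first by rewrite addn0.
  by rewrite iterS IH -[i.+1]addn1 iotaD rev_cat addn1 addnS.
apply: (ptime_ext (f := fun a => rev (iter (g a)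
    (fun s : nat * seq nat => (s.1.+1, s.1 :: s.2)) (f a, [::])).2)) => [a|].
  by rewrite iE /= revK.
apply/ptime_rev/ptime_snd.
apply: (ptime_iter (f := fun _ (s : nat * seq nat) => (s.1.+1, s.1 :: s.2))
  (G := fun n => 3 + c * n ^ c + d * n ^ d + (d * n ^ d) * (c * n ^ c + d * n ^ d + 2))) => //.
- by apply: ptime_pair => //; apply: ptime_const.
- have p1 : ptime (fun q : A * (nat * seq nat) => q.2.1) by apply/ptime_fst/ptime_snd/ptime_id.
  have p2 : ptime (fun q : A * (nat * seq nat) => q.2.2) by apply/ptime_snd/ptime_snd/ptime_id.
  by apply: ptime_pair; [apply/ptime_succ|apply: ptime_cons].
- by polyb.
- move=> a i ia; rewrite iE size_of_pair /= size_of_rev size_of_nat.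
  have := Hc a; have := Hd a; rewrite !size_of_nat.
  set X := c * _; set Y := d * _ => hd hc.
  have h1 : size_of (iota (f a) i) <= 1 + i * (X + Y + 2).
    have iX : 2 * (f a + i) <= X + Y by lia.
    elim: (i) (f a) iX => // j IH m mX; rewrite /= size_of_cons size_of_nat mulSn.
    by have := IH m.+1; lia.
  have h2 : i * (X + Y + 2) <= Y * (X + Y + 2) by rewrite leq_mul2r; lia.
  move: (i * _) (Y * (_ + _)) h1 h2 => P Q h1 h2.
  by clear -h1 h2 hd hc ia; lia.
Qed.
End Products.

Section Access.
Context {A E : Type} {eA : Enc A} {eE : Enc E} {pE : Pointed E}.
Implicit Types (l : A -> seq E) (n : A -> nat).

Lemma ptime_drop n l : ptime n -> ptime l -> ptime (fun a => drop (n a) (l a)).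
Proof.
move=> nP lP; have [c Hc] := ptime_bound lP.
have dE (s : seq E) i : iter i behead s = drop i s.
  by elim: i s => [|i IH] s; rewrite ?drop0 // iterSr IH; case: s => //=; case: i {IH}.
apply: (ptime_ext (f := fun a => iter (n a) behead (l a))) => [a|]; first by rewrite dE.
apply: (ptime_iter (f := fun _ => behead) (G := fun m => c * m ^ c)) => //.
- by apply/ptime_behead/ptime_snd/ptime_id.
- by polyb.
- by move=> a i _; rewrite dE; apply: leq_trans (size_of_drop _ _) (Hc a).
Qed.

Lemma ptime_nth x0 n l : ptime n -> ptime l -> ptime (fun a => nth x0 (l a) (n a)).
Proof.
move=> nP lP; apply: (ptime_ext (f := fun a => head x0 (drop (n a) (l a)))) => [a|].
  by rewrite -nth0 nth_drop addn0.
by apply/ptime_head/ptime_drop.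
Qed.

(** A list of units has the same code as its length in unary, so once the elements are erased the
    identity program does the conversion. *)
Lemma ptime_size_seq l : ptime l -> ptime (fun a => size (l a)).
Proof.
move=> lP; apply: (ptime_ext (f := fun a => size (map (fun=> tt) (l a)))) => [a|].
  by rewrite size_map.
have H : ptime (fun a => map (fun=> tt) (l a)).
  by apply: (ptime_map (f := fun _ _ => tt)) => //; apply: ptime_const.
apply: (ptime_comp (g := size) _ H); apply: (ptime_expr (e := EVar 0)) => /= u.
by rewrite /init_store /update /= /encoding /Enc_nat /enc_nat; elim: u => //= x u <-.
Qed.

Lemma ptime_take n l : ptime n -> ptime l -> ptime (fun a => take (n a) (l a)).
Proof.
move=> nP lP; apply: (ptime_ext (f := fun a => rev (drop (size (l a) - n a) (rev (l a))))) => [a|].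
  rewrite drop_rev revK; case: (leqP (n a) (size (l a))) => [na|/ltnW na].
    by rewrite subKn.
  by rewrite (eqP na) subn0 take_size take_oversize.
apply/ptime_rev/ptime_drop; last by apply: ptime_rev.
by apply: ptime_sub => //; apply: ptime_size_seq.
Qed.
End Access.

Section Zip.
Context {A E U : Type} {eA : Enc A} {eE : Enc E} {eU : Enc U} {pE : Pointed E} {pU : Pointed U}.

Lemma ptime_zip (l : A -> seq E) (r : A -> seq U) :
  ptime l -> ptime r -> ptime (fun a => zip (l a) (r a)).
Proof.
move=> lP rP.
have [e0 _] : exists _ : E, True by exists pE.
have [u0 _] : exists _ : U, True by exists pU.
apply: (ptime_ext (f := fun a => map (fun i => (nth e0 (l a) i, nth u0 (r a) i))
  (iota 0 (size (l a) - (size (l a) - size (r a)))))) => [a|].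
  have -> : size (l a) - (size (l a) - size (r a)) = size (zip (l a) (r a)).
    by rewrite size_zip; lia.
  rewrite -[RHS](mkseq_nth (e0, u0)); rewrite /mkseq; apply/eq_in_map => i.
  by rewrite mem_iota /= add0n nth_zip_cond => ->.
apply: (ptime_map (f := fun a i => (nth e0 (l a) i, nth u0 (r a) i))).
  have sl : ptime (fun a => size (l a)) by apply: ptime_size_seq.
  have sr : ptime (fun a => size (r a)) by apply: ptime_size_seq.
  by apply: ptime_iota; [apply: ptime_const|apply: ptime_sub => //; apply: ptime_sub].
have pi : ptime (fun q : A * nat => q.2) by apply/ptime_snd/ptime_id.
have p1 : ptime (fun q : A * nat => q.1) by apply/ptime_fst/ptime_id.
by apply: ptime_pair; apply: ptime_nth => //; [apply: (ptime_comp (g := l))|apply: (ptime_comp (g := r))].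
Qed.
End Zip.

(** * The market of a system of cells *)

Lemma mem_filter_enum (T : finType) (p : pred T) k :
  (k \in [seq k <- enum T | p k]) = p k.
Proof. by rewrite mem_filter mem_enum andbT. Qed.

Lemma uniq_map_inj (T U : eqType) (f : T -> U) s :
  uniq (map f s) -> {in s &, injective f}.
Proof.
elim: s => //= x s IH /andP[xs us] a b; rewrite !inE.
case/predU1P => [->|as_] /predU1P[->|bs] // fab; last exact: IH.
  by case/mapP: xs; exists b.
by case/mapP: xs; exists a.
Qed.

(** * Markets whose lists follow the order of the indices *)

Section OrderedMarket.
Variables (n : nat) (a : rel nat) (dw : pred nat).

Definition ordered_men : {ffun 'I_n -> seq 'I_n} := [ffun i : 'I_n => [seq j : 'I_n <- enum 'I_n | a i j]].
Definition ordered_women : {ffun 'I_n -> seq 'I_n} := [ffun j : 'I_n => [seq i : 'I_n <- enum 'I_n | a i j]].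

Lemma ordered_men_uniq : [forall i, uniq (ordered_men i)].
Proof. by apply/forallP => i; rewrite ffunE filter_uniq ?enum_uniq. Qed.

Lemma ordered_women_uniq : [forall i, uniq (ordered_women i)].
Proof. by apply/forallP => i; rewrite ffunE filter_uniq ?enum_uniq. Qed.

Definition ordered_market : smc 'I_n 'I_n :=
  SMC [set j : 'I_n | dw j] set0 ordered_men_uniq ordered_women_uniq.

Lemma ordered_market_acceptable (i j : 'I_n) : acceptable ordered_market i j = a i j.
Proof. by rewrite /acceptable !ffunE !mem_filter_enum andbb. Qed.

Lemma prefers_filter (p : pred 'I_n) (i j : 'I_n) : p i -> p j ->
  prefers [seq k <- enum 'I_n | p k] i j = (i < j).
Proof.
move=> pi pj; set L := filter _ _.
have Ls : sorted (relpre val ltn) L.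
  apply: sorted_filter; first by move=> x y z; apply: ltn_trans.
  by rewrite -sorted_map val_enum_ord iota_ltn_sorted.
have iL k : p k -> k \in L by rewrite mem_filter_enum.
have tr : transitive (relpre val ltn : rel 'I_n) by move=> x y z; apply: ltn_trans.
rewrite /prefers; apply/idP/idP => [ij|].
  exact: (sorted_ltn_index tr Ls _ _ (iL _ pi) (iL _ pj) ij).
apply: contraTT; rewrite -!leqNgt leq_eqVlt => /orP[/eqP/index_inj|] ji.
  by rewrite ji // iL.
by apply/ltnW/(sorted_ltn_index tr Ls _ _ (iL _ pj) (iL _ pi)).
Qed.

Lemma ordered_market_blocking mu (i j : 'I_n) : is_matching ordered_market mu ->
  blocking ordered_market mu i j =
    [&& a i j, [forall k, ((i, k) \in mu) ==> (j < k)] & [forall k, ((k, j) \in mu) ==> (i < k)]].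
Proof.
move=> [acc disj]; rewrite /blocking ordered_market_acceptable; case aij: (a i j) => //=.
congr andb.
- rewrite /wife; case: pickP => [k ik|none].
  + have := acc _ _ ik; rewrite ordered_market_acceptable => aik.
    rewrite ffunE prefers_filter //; apply/idP/forallP => [jk k'|/(_ k)].
      by apply/implyP => ik'; have [->] := disj _ _ ik' ik (or_introl erefl).
    by rewrite ik.
  + by apply/esym/forallP => k; rewrite none.
- rewrite /husband; case: pickP => [k ik|none].
  + have := acc _ _ ik; rewrite ordered_market_acceptable => aik.
    rewrite ffunE prefers_filter //; apply/idP/forallP => [jk k'|/(_ k)].
      by apply/implyP => ik'; have [->] := disj _ _ ik' ik (or_intror erefl).
    by rewrite ik.
  + by apply/esym/forallP => k; rewrite none.
Qed.

Lemma ordered_market_master : master_list_over_men ordered_market /\ master_list_over_women ordered_market.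
Proof.
by split; exists (enum 'I_n); split=> [|i|i]; rewrite ?enum_uniq ?mem_enum // !ffunE;
  apply: eq_filter => k; rewrite mem_filter_enum.
Qed.
End OrderedMarket.

(** * The persons of the market and their acceptable partners *)

Section Cells.
(* There are [C] cells; [y e] means that cell [e] closes a family, and [D e] lists
   the cells that must be selected together with [e]. *)
Variables (C : nat) (y : pred nat) (D : nat -> seq nat).

Definition person : Type := nat * (nat * nat).

(* If [vert u], cell [u] has a lane of its own, [o_u], [Z_(u,0)], [Z_(u,1)], ...;
   the lane of a cell [v] with dependencies crosses these at column [v], in
   increasing order of [u \in D v]. *)
Definition vert u := ~~ y u && nilp (D u).
Definition firstdep u v := (u \in D v) && all (fun c => u <= c) (D v).
Definition nextdep b u v :=
  [&& b \in D v, u \in D v, b < u & all (fun c => (c <= b) || (u <= c)) (D v)].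

(* A person is a tag followed by two indices, the second one being 0 if unused.
   The men are x_u (tag 0), m1* (1), t_(u,v) (2), r_u (3), be_u (4), n_u (5) and
   m2* (6), the women are o_p (0), Z_(p,q) (1), a_p (2), s_p (3), c_p (4) and the
   distinguished w1* (5) and w2* (6). *)
Definition adj (m w : person) : bool :=
  let u := m.2.1 in let v := m.2.2 in
  let p := w.2.1 in let q := w.2.2 in
  [|| [&& m.1 == 0, w.1 == 0, v == 0, q == 0, 0 < u, ~~ y u.-1 & (p == u) || (p.+1 == u)],
      [&& m.1 == 1, u == 0, v == 0, q == 0 &
        ((w.1 == 0) && y p) || ((w.1 == 5) && (p == 0))],
      [&& m.1 == 2, w.1 == 1 & [|| (p == u) && (q == v), (p == u) && (q.+1 == v)
         | (q.+1 == v) && nextdep p u v]],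
      [&& m.1 == 2, w.1 == 0, q == 0 & [|| [&& v == 0, p == u & vert u]
         | (p == v) && firstdep u v]],
      [&& m.1 == 3, v == 0 & [|| [&& w.1 == 1, p == u & q.+1 == C],
         [&& w.1 == 2, q == 0, p.+1 == u & ~~ y p] | [&& w.1 == 2, q == 0 & p == u]]],
      [&& m.1 == 4, v == 0, q == 0 & [|| [&& w.1 == 2, p.+1 == u & ~~ y p],
         (w.1 == 3) && (p.+1 == u) | (w.1 == 3) && (p == u)]],
      [&& m.1 == 5, v == 0, q == 0, y u & [|| (w.1 == 0) && (p == u),
         [&& w.1 == 3, p == u & u.+1 == C] | (w.1 == 4) && (p == u)]] |
      [&& m.1 == 6, u == 0, v == 0, q == 0 &
        ((w.1 == 4) && y p) || ((w.1 == 6) && (p == 0))]].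

Definition decode (x : nat) : person := (x %/ (C * C), (x %/ C %% C, x %% C)).
Definition code (t u v : nat) : nat := (t * C + u) * C + v.

Definition cell_market : smc 'I_(7 * (C * C)) 'I_(7 * (C * C)) :=
  ordered_market (7 * (C * C)) (fun i j => adj (decode i) (decode j))
    (fun j => (4 < (decode j).1) && ((decode j).2 == (0, 0))).

(* [after sel e]: a cell of the family of [e] that precedes [e] is selected. *)
Fixpoint after (sel : pred nat) (e : nat) : bool :=
  if e is e'.+1 then ~~ y e' && (sel e' || after sel e') else false.

(** The first clause, read at closing cells, gives at least one selected cell per family, the second
    at most one, and never the closing cell; the third closes the choice under dependencies. *)
Definition selection (sel : pred nat) : Prop := forall e, e < C ->
  [/\ y e -> after sel e, sel e -> ~~ y e /\ ~~ after sel e &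
      sel e -> forall u, u \in D e -> sel u].

Hypothesis C_gt0 : 0 < C.
Hypothesis y_last : y C.-1.
Hypothesis D0 : D 0 = [::].
Hypothesis D_y : forall e, y e -> D e = [::].
(** The cells below [V] form complete families without dependencies, and only they occur as
    dependencies; thus every dependency has a lane of its own. *)
Variable V : nat.
Hypothesis V_le : V <= C.
Hypothesis y_V : y V.-1.
Hypothesis D_lt_V : forall e, e < V -> D e = [::].
Hypothesis D_sub : forall e u : nat, u \in D e -> u < V /\ ~~ y u.

Lemma codeK t u v : u < C -> v < C -> decode (code t u v) = (t, (u, v)).
Proof.
move=> uC vC; rewrite /decode /code.
have -> : ((t * C + u) * C + v) %/ C = t * C + u.
  by rewrite divnMDl // divn_small // addn0.
rewrite divnMA divnMDl // [v %/ C]divn_small // addn0 divnMDl // divn_small // addn0.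
by rewrite !modnMDl !modn_small.
Qed.

Lemma code_lt t u v : t < 7 -> u < C -> v < C -> code t u v < 7 * (C * C).
Proof. by rewrite /code => t7 uC vC; nia. Qed.

Lemma decodeK x : code (decode x).1 (decode x).2.1 (decode x).2.2 = x.
Proof. by rewrite /code /= divnMA -divn_eq -divn_eq. Qed.

Lemma decode_bound x : x < 7 * (C * C) ->
  [/\ (decode x).1 < 7, (decode x).2.1 < C & (decode x).2.2 < C].
Proof.
move=> xC; rewrite /= !ltn_mod C_gt0; split=> //.
by rewrite ltn_divLR // muln_gt0 C_gt0.
Qed.

Definition plt (p q : person) : bool :=
  (p.1 < q.1) || (p.1 == q.1) && ((p.2.1 < q.2.1) || (p.2.1 == q.2.1) && (p.2.2 < q.2.2)).

Lemma code_ltP t u v t' u' v' : u < C -> v < C -> u' < C -> v' < C ->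
  (code t u v < code t' u' v') = plt (t, (u, v)) (t', (u', v')).
Proof.
rewrite /code /plt /= => uC vC u'C v'C.
have H a b c d : b < C -> d < C -> (a * C + b < c * C + d) = (a < c) || (a == c) && (b < d).
  move=> bC dC; case: (ltngtP a c) => [ac|ca|->] /=; last by rewrite ltn_add2l.
    by apply/idP; nia.
  by apply/negbTE; rewrite -leqNgt; nia.
have H' a b c d : b < C -> d < C -> (a * C + b == c * C + d) = (a == c) && (b == d).
  move=> bC dC; case: (ltngtP a c) => [ac|ca|->] /=; last by rewrite eqn_add2l.
    by apply/negbTE/eqP; nia.
  by apply/negbTE/eqP; nia.
by rewrite H // H // H' // andb_orr orbA andbA.
Qed.

Ltac split_hyps := repeat match goal with
  | H : is_true (_ || _) |- _ => move/orP: H => [H|H]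
  | H : is_true (_ && _) |- _ => let H' := fresh "H" in move/andP: H => [H' H]
  | H : is_true (?a == ?b) |- _ => move/eqP: H => H
  | H : _ \/ _ |- _ => case: H => H
  end.

Lemma adj_x u v w : adj (0, (u, v)) w ->
  [/\ v = 0, 0 < u, ~~ y u.-1 & w = (0, (u, 0)) \/ w = (0, (u.-1, 0))].
Proof.
case: w => [t [p q]]; rewrite /adj /= orbF => H; split_hyps; subst => //.
  by split=> //; left.
by split=> //; right.
Qed.

Lemma adj_o m p q : adj m (0, (p, q)) -> q = 0 /\
  [\/ m = (0, (p, 0)), m = (0, (p.+1, 0)) /\ ~~ y p,
      m = (1, (0, 0)) /\ y p |
      [\/ m = (5, (p, 0)) /\ y p, m = (2, (p, 0)) /\ vert p |
         exists u, m = (2, (u, p)) /\ firstdep u p]].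
Proof.
case: m => [t [u v]]; rewrite /adj /= ?andbF ?orbF => H; split_hyps; subst => //; split=> //.
- by constructor 1.
- by constructor 2.
- by constructor 3.
- by constructor 4; constructor 2.
- by constructor 4; constructor 3; exists u.
- by constructor 4; constructor 1.
Qed.

Lemma adj_Z m p q : adj m (1, (p, q)) ->
  [\/ m = (2, (p, q)), m = (2, (p, q.+1)), m = (3, (p, 0)) /\ q.+1 = C |
      exists u, m = (2, (u, q.+1)) /\ nextdep p u q.+1].
Proof.
case: m => [t [u v]]; rewrite /adj /= ?andbF ?orbF => H; split_hyps; subst => //.
- by constructor 1.
- by constructor 2.
- by constructor 4; exists u.
- by constructor 3.
Qed.

Lemma adj_a m p q : adj m (2, (p, q)) ->
  q = 0 /\ [\/ m = (3, (p, 0)), m = (3, (p.+1, 0)) | m = (4, (p.+1, 0))].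
Proof.
case: m => [t [u v]]; rewrite /adj /= ?andbF ?orbF => H; split_hyps; subst => //; split=> //.
- by constructor 2.
- by constructor 1.
- by constructor 3.
Qed.

Lemma adj_s m p q : adj m (3, (p, q)) ->
  q = 0 /\ [\/ m = (4, (p, 0)), m = (4, (p.+1, 0)) | m = (5, (p, 0)) /\ p.+1 = C].
Proof.
case: m => [t [u v]]; rewrite /adj /= ?andbF ?orbF => H; split_hyps; subst => //; split=> //.
- by constructor 2.
- by constructor 1.
- by constructor 3.
Qed.

Lemma adj_c m p q : adj m (4, (p, q)) ->
  q = 0 /\ (m = (5, (p, 0)) \/ m = (6, (0, 0))).
Proof.
case: m => [t [u v]]; rewrite /adj /= ?andbF ?orbF => H; split_hyps; subst => //; split=> //.
- by left.
- by right.
Qed.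

Lemma adj_w1 m : adj m (5, (0, 0)) -> m = (1, (0, 0)).
Proof.
by case: m => [t [u v]]; rewrite /adj /= ?andbF ?orbF => H; split_hyps; subst.
Qed.

Lemma adj_w2 m : adj m (6, (0, 0)) -> m = (6, (0, 0)).
Proof.
by case: m => [t [u v]]; rewrite /adj /= ?andbF ?orbF => H; split_hyps; subst.
Qed.

Lemma adj_m1 u v w : adj (1, (u, v)) w ->
  [/\ u = 0, v = 0 & (exists p, w = (0, (p, 0)) /\ y p) \/ w = (5, (0, 0))].
Proof.
case: w => [t [p q]]; rewrite /adj /= ?orbF => H; split_hyps; subst => //; split=> //.
  by left; exists p.
by right.
Qed.

Lemma adj_t u v w : adj (2, (u, v)) w ->
  [\/ w = (1, (u, v)), exists2 v', v = v'.+1 & w = (1, (u, v')),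
      [/\ v = 0, w = (0, (u, 0)) & vert u] |
      (w = (0, (v, 0)) /\ firstdep u v) \/ (exists b, w = (1, (b, v.-1)) /\ nextdep b u v)].
Proof.
case: w => [t [p q]]; rewrite /adj /= ?orbF => H; split_hyps; subst => //.
- by constructor 1.
- by constructor 2; exists q.
- by constructor 4; right; exists p.
- by constructor 3.
- by constructor 4; left.
Qed.

Lemma adj_r u v w : adj (3, (u, v)) w ->
  v = 0 /\ [\/ w = (1, (u, C.-1)), exists2 p, u = p.+1 & w = (2, (p, 0)) /\ ~~ y p |
      w = (2, (u, 0))].
Proof.
case: w => [t [p q]]; rewrite /adj /= ?orbF => H; split_hyps; subst => //; split=> //.
- by constructor 1.
- by constructor 2; exists p.
- by constructor 3.
Qed.

Lemma adj_b u v w : adj (4, (u, v)) w ->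
  v = 0 /\ [\/ exists2 p, u = p.+1 & w = (2, (p, 0)) /\ ~~ y p,
      exists2 p, u = p.+1 & w = (3, (p, 0)) | w = (3, (u, 0))].
Proof.
case: w => [t [p q]]; rewrite /adj /= ?orbF => H; split_hyps; subst => //; split=> //.
- by constructor 1; exists p.
- by constructor 2; exists p.
- by constructor 3.
Qed.

Lemma adj_n u v w : adj (5, (u, v)) w ->
  [/\ v = 0, y u & [\/ w = (0, (u, 0)), w = (3, (u, 0)) | w = (4, (u, 0))]].
Proof.
case: w => [t [p q]]; rewrite /adj /= ?orbF => H; split_hyps; subst => //; split=> //.
- by constructor 1.
- by constructor 2.
- by constructor 3.
Qed.

Lemma adj_m2 u v w : adj (6, (u, v)) w ->
  [/\ u = 0, v = 0 & (exists p, w = (4, (p, 0)) /\ y p) \/ w = (6, (0, 0))].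
Proof.
case: w => [t [p q]]; rewrite /adj /= ?orbF => H; split_hyps; subst => //; split=> //.
  by left; exists p.
by right.
Qed.

Lemma afterP (sel : pred nat) e : reflect (exists a, [/\ a < e, sel a & forall i, a <= i < e -> ~~ y i])
  (after sel e).
Proof.
apply: (iffP idP) => [|[a [ae sa H]]].
  elim: e => // e IH /= /andP[ye /orP[se|/IH[a [ae sa H]]]].
    by exists e; split=> // i; rewrite ltnS -eqn_leq => /eqP<-.
  exists a; split=> // [|i]; first exact: ltnW.
  by rewrite ltnS => /andP[ai]; rewrite leq_eqVlt => /orP[/eqP->//|ie]; apply: H; rewrite ai.
elim: e ae H => // e IH ae H /=; rewrite H ?leqnn ?andbT //=.
move: ae; rewrite ltnS leq_eqVlt => /orP[/eqP<-|ae]; first by rewrite sa.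
by rewrite IH ?orbT // => i /andP[ai ie]; apply: H; rewrite ai ltnW.
Qed.

(** The closing cell serves as the name of the family of [i]. *)
Definition nexty i := find (fun e => (i <= e) && y e) (iota 0 C).

Lemma nextyE i e : e < C -> i <= e -> y e -> (forall j, i <= j < e -> ~~ y j) ->
  nexty i = e.
Proof.
move=> eC ie ye H; rewrite /nexty -(subnKC eC) -addn1 -addnA iotaD find_cat size_iota.
rewrite ifF; first by rewrite /= add0n ie ye addn0.
apply/negbTE/hasPn => j; rewrite mem_iota /= => je; apply/negP => /andP[ij].
by apply/negP/H; rewrite ij.
Qed.

Lemma nextyP i : i < C ->
  [/\ i <= nexty i, nexty i < C, y (nexty i) & forall j, i <= j < nexty i -> ~~ y j].
Proof.
move=> iC.
have [e] : exists e, (i <= e) && y e by exists C.-1; rewrite y_last andbT; lia.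
move=> ex; case: (ex_minnP (ex_intro (fun e => (i <= e) && y e) e ex)) => m /andP[im ym] mmin.
have mC : m < C by have := mmin C.-1; rewrite y_last andbT => /(_ ltac:(lia)); lia.
have H j : i <= j < m -> ~~ y j.
  by move=> /andP[ij jm]; apply/negP => yj; have := mmin j; rewrite ij yj => /(_ isT); lia.
by rewrite (nextyE mC im ym H).
Qed.

Lemma dep_cases u v : u \in D v ->
  firstdep u v \/ exists b, nextdep b u v.
Proof.
move=> uv; case: (boolP (has (fun c => c < u) (D v))) => [/hasP[c cv cu]|/hasPn H]; last first.
  by left; rewrite /firstdep uv; apply/allP => c /H; rewrite -leqNgt.
right; have ub i : (i \in D v) && (i < u) -> i <= u by move=> /andP[_ /ltnW].
have ex : exists i, (i \in D v) && (i < u) by exists c; rewrite cv cu.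
case: (ex_maxnP ex ub) => b /andP[bv bu] bmax.
exists b; rewrite /nextdep bv uv bu; apply/allP => d dv.
by case: (leqP u d); rewrite ?orbT // orbF => du; apply: bmax; rewrite dv.
Qed.

Lemma firstdep_uniq u u' v : firstdep u v -> firstdep u' v -> u = u'.
Proof.
move=> /andP[uv /allP H] /andP[uv' /allP H']; apply/eqP.
by rewrite eqn_leq H // H'.
Qed.

Lemma nextdep_uniq b u u' v : nextdep b u v -> nextdep b u' v -> u = u'.
Proof.
move=> /and4P[_ uv bu /allP H] /and4P[_ uv' bu' /allP H'].
by have := H _ uv'; have := H' _ uv; lia.
Qed.

Notation n := (7 * (C * C)).

(** * From a cheap feasible matching to a selection *)

Section Lower.
Variable mu : {set 'I_n * 'I_n}.
Hypothesis muM : is_matching cell_market mu.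

Definition mt (m w : person) : bool :=
  [exists p : 'I_n * 'I_n, [&& p \in mu, decode p.1 == m & decode p.2 == w]].

Definition bl (m w : person) : bool :=
  [exists p : 'I_n * 'I_n,
    [&& p \in blocking_pairs cell_market mu, decode p.1 == m & decode p.2 == w]].

Definition in_range (m : person) := [&& m.1 < 7, m.2.1 < C & m.2.2 < C].

Lemma decode_inj : injective decode.
Proof. by move=> a b ab; rewrite -[a]decodeK -[b]decodeK ab. Qed.

Lemma in_rangeP m : in_range m -> exists i : 'I_n, decode i = m.
Proof.
case: m => t [u v] /and3P[/= t7 uC vC].
by exists (Ordinal (code_lt t7 uC vC)); rewrite /= codeK.
Qed.

Lemma decode_in_range (i : 'I_n) : in_range (decode i).
Proof. by have [h1 h2 h3] := decode_bound (ltn_ord i); rewrite /in_range h1 h2 h3. Qed.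

Lemma decode_lt (i j : 'I_n) : (i < j) = plt (decode i) (decode j).
Proof.
have [h1 h2 h3] := decode_bound (ltn_ord i).
have [h4 h5 h6] := decode_bound (ltn_ord j).
by rewrite -[in LHS](decodeK i) -[in LHS](decodeK j) code_ltP.
Qed.

Lemma plt_total p q : [|| p == q, plt p q | plt q p].
Proof. by case: p => a [b c]; case: q => d [e f]; rewrite /plt -pair_eqE /pair_eq /= -pair_eqE /pair_eq /=; lia. Qed.

Lemma plt_irr p : plt p p = false.
Proof. by case: p => a [b c]; rewrite /plt /=; lia. Qed.

Lemma plt_asym p q : plt p q -> plt q p -> False.
Proof. by case: p => a [b c]; case: q => d [e f]; rewrite /plt /=; lia. Qed.

Lemma mtP m w : mt m w -> [/\ adj m w, in_range m & in_range w].
Proof.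
case/existsP => -[i j] /and3P[ij /eqP<- /eqP<-]; rewrite !decode_in_range; split=> //.
by have := muM.1 i j ij; rewrite ordered_market_acceptable.
Qed.

Lemma mt_fun m w w' : mt m w -> mt m w' -> w = w'.
Proof.
case/existsP => -[i j] /and3P[ij /eqP<- /eqP<-] /existsP[[i' j'] /and3P[ij' /eqP/decode_inj/val_inj /= ii /eqP<-]].
by have [_ ->] := muM.2 _ _ ij ij' (or_introl (esym ii)).
Qed.

Lemma blP m w : bl m w -> adj m w /\ forall m', mt m' w -> plt m m'.
Proof.
case/existsP => -[i j] /and3P[]; rewrite inE ordered_market_blocking //=.
move=> /and3P[aij _ /forallP H] /eqP<- /eqP<-; split=> // m'.
case/existsP => -[i' j'] /and3P[ij' /eqP<- /eqP/decode_inj/val_inj /= jj]; subst j'.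
by rewrite -decode_lt; have := H i'; rewrite ij'.
Qed.

(* A man left with a woman he likes less than the acceptable [w] either blocks
   with [w] or lost her to a better man. *)
Lemma push m w w1 : adj m w -> in_range w -> mt m w1 -> plt w w1 ->
  bl m w \/ exists m', mt m' w /\ plt m' m.
Proof.
move=> aw rw mw1 ww1; case: (boolP (bl m w)) => [|nb]; [by left|right].
have [i im] : exists i : 'I_n, decode i = m by apply: in_rangeP; case: (mtP mw1).
have [j jw] := in_rangeP rw.
move/existsPn: nb => /(_ (i, j)); rewrite /= inE ordered_market_blocking //= im jw !eqxx !andbT aw /=.
rewrite negb_and => /orP[] /forallPn[k]; rewrite negb_imply => /andP[kmu].
  rewrite decode_lt jw => nlt.
  have mk : mt m (decode k) by apply/existsP; exists (i, k); rewrite kmu im !eqxx.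
  by move: nlt; rewrite (mt_fun mk mw1) ww1.
rewrite decode_lt im => nlt.
have mk : mt (decode k) w by apply/existsP; exists (k, j); rewrite kmu jw !eqxx.
exists (decode k); split=> //.
have := plt_total (decode k) m; rewrite (negbTE nlt) orbF => /orP[/eqP km|//].
by rewrite km in mk; rewrite (mt_fun mk mw1) plt_irr in ww1.
Qed.

Hypothesis muF : feasible cell_market mu.
Hypothesis mu_le : #|blocking_pairs cell_market mu| <= count y (iota 0 C).

Lemma rangeE t u v : in_range (t, (u, v)) = [&& t < 7, u < C & v < C].
Proof. by []. Qed.

Lemma dist_mt t : 4 < t < 7 -> exists m, mt m (t, (0, 0)).
Proof.
move=> /andP[t4 t7]; have [j jw] : exists j : 'I_n, decode j = (t, (0, 0)).
  by apply: in_rangeP; rewrite rangeE t7 C_gt0.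
have jd : j \in dist_women cell_market by rewrite inE jw /= t4.
have := muF.1 j jd; rewrite /husband; case: pickP => // i ij _.
by exists (decode i); apply/existsP; exists (i, j); rewrite ij jw !eqxx.
Qed.

Lemma mt_m1 : mt (1, (0, 0)) (5, (0, 0)).
Proof. by have [m mw] := dist_mt (t := 5) isT; have [/adj_w1 me _ _] := mtP mw; rewrite -{1}me. Qed.

Lemma mt_m2 : mt (6, (0, 0)) (6, (0, 0)).
Proof. by have [m mw] := dist_mt (t := 6) isT; have [/adj_w2 me _ _] := mtP mw; rewrite -{1}me. Qed.

(** [x_e] prefers [o_(e-1)], whom only [x_(e-1)] can keep from him, and so on downwards. The descent
    must end in a blocking pair inside the segment, because the first cell of a family has no man
    [x]. *)
Lemma descend e : mt (0, (e, 0)) (0, (e, 0)) ->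
  exists i, [/\ i < e, bl (0, (i.+1, 0)) (0, (i, 0)) & forall j, i <= j < e -> ~~ y j].
Proof.
elim: e => [|e IH] ee; have [ad rm rw] := mtP ee; have [_ // _ /= ye _] := adj_x ad.
have ad' : adj (0, (e.+1, 0)) (0, (e, 0)) by rewrite /adj /= ye eqxx orbT.
have rw' : in_range (0, (e, 0)) by move: rw; rewrite !rangeE /= C_gt0 !andbT => /ltnW.
have lt' : plt (0, (e, 0)) (0, (e.+1, 0)) by rewrite /plt /= ltnSn.
case: (push ad' rw' ee lt') => [b|[m' [mm pm]]].
  by exists e; split=> // j; rewrite ltnS -eqn_leq => /eqP<-.
have [/adj_o[_ H] _ _] := mtP mm.
have {H}me : m' = (0, (e, 0)).
  case: H pm => [->//|[->]|[->]|[[->]|[->]|[u [->]]]] //.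
  by rewrite plt_irr.
rewrite me in mm; have [i [ie b H]] := IH mm; exists i; split=> [|//|j /andP[ij]]; first exact: ltnW.
by rewrite ltnS leq_eqVlt => /orP[/eqP->//|je]; apply: H; rewrite ij.
Qed.

(** [m1*] is bound to [w1*] and prefers [o_e]: either he blocks with her, or she is with [x_e], the
    only better man on her list, and the descent starts. *)
Lemma seg_block e : e < C -> y e ->
  exists m i, [/\ i <= e, bl m (0, (i, 0)) & forall j, i <= j < e -> ~~ y j].
Proof.
move=> eC ye.
have ad : adj (1, (0, 0)) (0, (e, 0)) by rewrite /adj /= ye.
have rw : in_range (0, (e, 0)) by rewrite rangeE eC C_gt0.
case: (push ad rw mt_m1 isT) => [b|[m' [mm pm]]].
  by exists (1, (0, 0)), e; split=> // j /andP[ej]; rewrite ltnNge ej.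
have [/adj_o[_ H] _ _] := mtP mm.
have {H}me : m' = (0, (e, 0)).
  case: H pm => [->//|[->]|[->]|[[->]|[->]|[u [->]]]] //.
  by rewrite ye.
rewrite me in mm; have [i [ie b H]] := descend mm.
by exists (0, (i.+1, 0)), i; split=> //; apply: ltnW.
Qed.

(** The value [C], which is no closing cell below [C], marks pairs whose woman is not some [o]. *)
Definition seg (p : 'I_n * 'I_n) : nat :=
  if (decode p.2).1 == 0 then nexty (decode p.2).2.1 else C.

(** Each closing cell is the [seg] of some blocking pair, and there are at most as many blocking
    pairs as closing cells. So [seg] is a bijection onto these cells, and the value [C] does not
    occur. *)
Lemma seg_inj : {in blocking_pairs cell_market mu &, injective seg} /\
  forall p, p \in blocking_pairs cell_market mu -> (decode p.2).1 = 0.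
Proof.
set B := blocking_pairs _ _.
have sub : {subset [seq e <- iota 0 C | y e] <= [seq seg p | p <- enum B]}.
  move=> e; rewrite mem_filter mem_iota => /and3P[ye _ eC].
  have [m [i [ie /existsP[p /and3P[pB /eqP pm /eqP pw]] H]]] := seg_block eC ye.
  apply/mapP; exists p; first by rewrite mem_enum.
  by rewrite /seg pw /= (nextyE eC ie ye H).
have un : uniq [seq e <- iota 0 C | y e] by rewrite filter_uniq ?iota_uniq.
have sz : size [seq seg p | p <- enum B] <= size [seq e <- iota 0 C | y e].
  by rewrite size_map -cardE size_filter.
have [_ eqi] := uniq_min_size un sub sz.
have un' := leq_size_uniq un sub sz.
split=> [p q pB qB|p pB].
  by apply: (uniq_map_inj un'); rewrite mem_enum.
have : seg p \in [seq seg p | p <- enum B] by apply: map_f; rewrite mem_enum.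
by rewrite -eqi mem_filter mem_iota /seg; case: eqP => // _; rewrite add0n ltnn !andbF.
Qed.

Lemma bl_tag m w : bl m w -> w.1 = 0.
Proof.
by case/existsP => p /and3P[pB _ /eqP<-]; apply: seg_inj.2.
Qed.

Lemma bl_uniq m m' i i' : bl m (0, (i, 0)) -> bl m' (0, (i', 0)) -> nexty i = nexty i' ->
  m = m' /\ i = i'.
Proof.
case/existsP => p /and3P[pB /eqP<- /eqP pw] /existsP[p' /and3P[pB' /eqP<- /eqP pw']] ii.
have pp : p = p' by apply: seg_inj.1 => //; rewrite /seg pw pw'.
by move: pw pw'; rewrite pp => -> [].
Qed.

(** [m2*] is bound to [w2*] and cannot block with [c_e], since all blocking pairs involve some [o];
    so [c_e] must have the only better man on her list. *)
Lemma mt_c e : e < C -> y e -> mt (5, (e, 0)) (4, (e, 0)).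
Proof.
move=> eC ye.
have ad : adj (6, (0, 0)) (4, (e, 0)) by rewrite /adj /= ye.
have rw : in_range (4, (e, 0)) by rewrite rangeE eC C_gt0.
case: (push ad rw mt_m2 isT) => [/bl_tag//|[m' [mm pm]]].
by have [/adj_c[_ [<-//|m6]] _ _] := mtP mm; rewrite m6 plt_irr in pm.
Qed.

(** Suppose [m1*] blocks with [o_e]. Then she is single or with someone worse than [m1*], which on
    her list leaves only [n_e]. But he is with [c_e] and prefers [o_e], so he gives a second
    blocking pair in the same family. *)
Lemma mt_x e : e < C -> y e -> mt (0, (e, 0)) (0, (e, 0)).
Proof.
move=> eC ye.
have rw : in_range (0, (e, 0)) by rewrite rangeE eC C_gt0.
have ad1 : adj (1, (0, 0)) (0, (e, 0)) by rewrite /adj /= ye.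
have [b1|[m' [mm pm]]] := push ad1 rw mt_m1 isT; last first.
  have [/adj_o[_ H] _ _] := mtP mm.
  suff me : m' = (0, (e, 0)) by rewrite -{1}me.
  case: H pm => [->//|[->]|[->]|[[->]|[->]|[u [->]]]] //.
  by rewrite ye.
exfalso.
have ad : adj (5, (e, 0)) (0, (e, 0)) by rewrite /adj /= ye eqxx.
case: (push ad rw (mt_c eC ye) isT) => [b5|[m' [mm pm]]].
  by have [] := bl_uniq b1 b5 erefl.
have [_ /(_ _ mm) p1] := blP b1.
have [/adj_o[_ H] _ _] := mtP mm.
case: H pm p1 => [->//|[->]|[->]|[[->]|[->]|[u [->]]]] //.
- by rewrite plt_irr.
- by rewrite /vert ye.
- by rewrite /firstdep (D_y ye).
Qed.

(** By [mt_x] and [descend], the unique blocking pair of each family has this form. *)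
Definition sel (e : nat) : bool := bl (0, (e.+1, 0)) (0, (e, 0)).

Lemma sel_adj e : sel e -> ~~ y e /\ e < C.
Proof.
move=> se; have [ad _] := blP se; have [_ _ ye _] := adj_x ad; split=> //.
by case/existsP: se => p /and3P[_ _ /eqP pw]; have := decode_in_range p.2; rewrite pw => /and3P[].
Qed.

Lemma nexty_same a e : e < C -> a <= e -> (forall i, a <= i < e -> ~~ y i) ->
  nexty a = nexty e.
Proof.
move=> eC ae H; have [h1 h2 h3 h4] := nextyP eC.
apply: nextyE => //; first exact: leq_trans h1.
move=> j /andP[aj je]; case: (ltnP j e) => [lt|le]; first by apply: H; rewrite aj.
by apply: h4; rewrite le.
Qed.

Lemma sel_after e : e < C -> y e -> after sel e.
Proof.
move=> eC ye; have [i [ie b H]] := descend (mt_x eC ye).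
by apply/afterP; exists i.
Qed.

Lemma sel_not_after e : sel e -> ~~ after sel e.
Proof.
move=> se; have [_ eC] := sel_adj se; apply/afterP => -[a [ae sa H]].
have [_ ea] := bl_uniq sa se (nexty_same eC (ltnW ae) H).
by rewrite ea ltnn in ae.
Qed.

Lemma sel_free e m : sel e -> mt m (0, (e, 0)) ->
  m = (2, (e, 0)) /\ vert e \/ exists u, m = (2, (u, e)) /\ firstdep u e.
Proof.
move=> se mm; have [ye _] := sel_adj se; have [_ /(_ _ mm) pm] := blP se.
have [/adj_o[_ H] _ _] := mtP mm.
case: H pm => [->|[->]|[_]|[[_]|[-> h]|[u [-> h]]]].
- by rewrite /plt /=; lia.
- by rewrite plt_irr.
- by rewrite (negbTE ye).
- by rewrite (negbTE ye).
- by left.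
- by right; exists u.
Qed.

Lemma sel_nobl e t uv : sel e -> ~ bl (t.+1, uv) (0, (e, 0)).
Proof. by move=> se b; have [] := bl_uniq se b erefl. Qed.

Lemma worse_contra m w w1 : adj m w -> in_range w -> ~ bl m w -> mt m w1 ->
  plt w w1 -> (forall m', mt m' w -> ~~ plt m' m) -> False.
Proof.
move=> ad rw nb mw1 ww1 H.
by case: (push ad rw mw1 ww1) => // -[m' [/H/negbTE->]].
Qed.

Lemma no_worse m w w1 : adj m w -> in_range w -> ~ bl m w ->
  (forall m', mt m' w -> ~~ plt m' m) -> mt m w1 -> plt w w1 = false.
Proof.
move=> ad rw nb H mw1; apply/negP => ww1.
exact: worse_contra ad rw nb mw1 ww1 H.
Qed.

Notation t_ u v := (2, (u, v)).
Notation Z u v := (1, (u, v)).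
Notation r_ u := (3, (u, 0)).
Notation a_ u := (2, (u, 0)).
Notation be u := (4, (u, 0)).
Notation s_ u := (3, (u, 0)).

(** A token at [(u, v)] is the absence of [t_(u,v)] from [Z_(u,v)]. He is the only man whom
    [Z_(u,v)] prefers to [t_(u,v+1)]; so in his absence [t_(u,v+1)] cannot be left with the worse
    [Z_(u,v+1)]. *)
Lemma lane_step u v : u < C -> v.+1 < C -> ~~ mt (t_ u v) (Z u v) ->
  ~~ mt (t_ u v.+1) (Z u v.+1).
Proof.
move=> uC vC h; apply/negP => h1.
have ad : adj (t_ u v.+1) (Z u v) by rewrite /adj /= ?eqxx ?orbT.
have rw : in_range (Z u v) by rewrite rangeE uC (ltnW vC).
have nb : ~ bl (t_ u v.+1) (Z u v) by move/bl_tag.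
apply: (worse_contra ad rw nb h1); first by rewrite /plt /= eqxx ltnSn !orbT.
move=> m' mm.
have [/adj_Z[h'|h'|[h' _]|[u' [h' /and4P[_ _ uu _]]]] _ _] := mtP mm; rewrite {}h' in mm *.
- by move: mm; rewrite (negbTE h).
- by rewrite plt_irr.
- by rewrite /plt.
- by rewrite /plt /= ltnNge (ltnW uu) gtn_eqF.
Qed.

Lemma lane_end u v : u < C -> v < C -> ~~ mt (t_ u v) (Z u v) ->
  ~~ mt (t_ u C.-1) (Z u C.-1).
Proof.
move=> uC vC h; suff H k : v + k < C -> ~~ mt (t_ u (v + k)) (Z u (v + k)).
  by have := H (C.-1 - v); rewrite subnKC; [apply; lia|lia].
by elim: k => [|k IH]; rewrite ?addn0 // addnS => lt; apply/lane_step/IH/ltnW.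
Qed.

Lemma lane_sel u v : sel u -> vert u -> v < C -> ~~ mt (t_ u v) (Z u v).
Proof.
move=> su vu; have [_ uC] := sel_adj su.
elim: v => [|v IH] vC; last by apply/lane_step/IH/ltnW.
apply/negP => h1.
have ad : adj (t_ u 0) (0, (u, 0)) by rewrite /adj /= ?eqxx vu ?orbT.
have rw : in_range (0, (u, 0)) by rewrite rangeE uC C_gt0.
apply: (worse_contra ad rw (@sel_nobl _ _ _ su) h1) => // m' mm.
have [[-> _]|[u' [_]]] := sel_free su mm; first by rewrite plt_irr.
by move: vu => /andP[_ /nilP]; rewrite /firstdep => ->.
Qed.

(** The freed [o_v] puts a token on the row of [v]. At a selected dependency the comparator takes
    the token of the row, leaving that of the lane for the next dependency. So a token reaches [u]
    and enters his lane even if [u] is not selected. The second conclusion is what the induction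
    needs: [t_(u,v)] leaves the token of lane [u], if there is one, on the row. *)
Lemma dep_pass v u : sel v -> v < C -> u \in D v ->
  (forall b, b \in D v -> b < u -> sel b) ->
  ~~ mt (t_ u v) (Z u v) /\ ~~ mt (t_ u v) (Z u v.-1).
Proof.
move=> sv vC; have v0 : u \in D v -> 0 < v by case: (v) => //; rewrite D0.
elim/ltn_ind: u v0 => u IH v0 uv Hb; have {}v0 := v0 uv.
have [uV yu] := D_sub uv; have uC : u < C by apply: leq_trans V_le.
have [fu|[b nb]] := dep_cases uv.
  have ad : adj (t_ u v) (0, (v, 0)) by rewrite /adj /= ?eqxx fu ?orbT.
  have rw : in_range (0, (v, 0)) by rewrite rangeE vC C_gt0.
  have H w1 : mt (t_ u v) w1 -> plt (0, (v, 0)) w1 = false.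
    apply: no_worse => //; first exact: sel_nobl.
    move=> m' mm; have [[_ /andP[_ /nilP vD]]|[u' [-> fu']]] := sel_free sv mm.
      by move: uv; rewrite vD.
    by rewrite (firstdep_uniq fu fu') plt_irr.
  by split; apply/negP => /H; rewrite /plt.
have /and4P[bv _ bu _] := nb; have [bV yb] := D_sub bv.
have sb : sel b by apply: Hb.
have vb : vert b by rewrite /vert yb D_lt_V.
have v1C : v.-1 < C by rewrite prednK // ltnW.
have vE : v.-1.+1 = v by rewrite prednK.
have ad : adj (t_ u v) (Z b v.-1) by rewrite /adj /= vE nb ?eqxx ?orbT.
have rw : in_range (Z b v.-1) by rewrite rangeE v1C (leq_trans bV V_le).
have H w1 : mt (t_ u v) w1 -> plt (Z b v.-1) w1 = false.
  apply: no_worse => //; first by move/bl_tag.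
  move=> m' mm; have [/adj_Z[h|h|[h Ev]|[u' [h nb']]] _ _] := mtP mm; rewrite {}h in mm *.
  - by move: mm; rewrite (negbTE (lane_sel sb vb v1C)).
  - have [||_] := IH b bu _ bv; first by [].
      by move=> c cv cb; apply: Hb => //; apply: ltn_trans bu.
    by rewrite -{2}vE vE => /negbTE mF; move: mm; rewrite vE mF.
  - by move: Ev vC; rewrite vE => ->; rewrite ltnn.
  - by move: nb'; rewrite vE => nb'; rewrite (nextdep_uniq nb nb') plt_irr.
by split; apply/negP => /H; rewrite /plt /= bu.
Qed.

(** The token of lane [u] draws [r_u] away from [a_u], and then every [r_i] up to [w - 1] is drawn
    away from [a_i]. Since [r_w] is drawn to the end of his own lane, nobody better keeps [a_(w-1)]
    from [be_w], so he leaves [s_w]. This shift of the men [be] crosses family borders and ends at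
    [s_(C-1)], with whom [n_(C-1)] would block; but blocking pairs only involve women [o]. *)
Lemma lanes_clash u w : u < w -> w < C ->
  (forall i, u <= i < w -> ~~ y i) ->
  ~~ mt (t_ u C.-1) (Z u C.-1) -> ~~ mt (t_ w C.-1) (Z w C.-1) -> False.
Proof.
move=> uw wC yF Fu Fw; have CE : C.-1.+1 = C by rewrite prednK.
have uC : u < C by apply: ltn_trans wC.
have top i w1 : i < C -> ~~ mt (t_ i C.-1) (Z i C.-1) -> mt (r_ i) w1 ->
    plt (Z i C.-1) w1 = false.
  move=> iC Fi; have ad : adj (r_ i) (Z i C.-1) by rewrite /adj /= CE ?eqxx.
  apply: no_worse => //; [by rewrite rangeE iC /=; lia|by move/bl_tag|].
  move=> m' mm; have [/adj_Z[h|h|[h _]|[u' [h _]]] rm _] := mtP mm; rewrite {}h in mm rm *.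
  - by move: mm; rewrite (negbTE Fi).
  - by move: rm; rewrite rangeE CE ltnn !andbF.
  - by rewrite plt_irr.
  - by move: rm; rewrite rangeE CE ltnn !andbF.
have aF i : u <= i < w -> ~~ mt (r_ i) (a_ i).
  elim: i => [|i IH] /andP[ui iw].
    have u0 : u = 0 by apply/eqP; rewrite -leqn0.
    by move: Fu; rewrite u0 => F0; apply/negP => /(top _ _ C_gt0 F0); rewrite /plt.
  have iC : i.+1 < C by apply: ltn_trans wC.
  move: ui; rewrite leq_eqVlt => /orP[/eqP ui|ui].
    by move: Fu; rewrite ui => F0; apply/negP => /(top _ _ iC F0); rewrite /plt.
  have yi : ~~ y i by apply: yF; rewrite -ltnS ui ltnW.
  apply/negP => h1.
  have ad : adj (r_ i.+1) (a_ i) by rewrite /adj /= ?eqxx yi ?orbT.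
  apply: (worse_contra ad _ _ h1); [| |by rewrite /plt /= ltnSn|].
  - by rewrite rangeE C_gt0 (ltnW iC).
  - by move/bl_tag.
  move=> m' mm; have [/adj_a[_ [h|h|h]] rm _] := mtP mm; rewrite {}h in mm *.
  - by move: mm; rewrite (negbTE (IH _)) // -ltnS ui ltnW.
  - by rewrite plt_irr.
  - by rewrite /plt.
have wE : w.-1.+1 = w by rewrite prednK //; lia.
have sw : ~~ mt (be w) (s_ w).
  apply/negP => h1.
  have yw : ~~ y w.-1 by apply: yF; rewrite -ltnS wE uw leqnn.
  have ad : adj (be w) (a_ w.-1) by rewrite /adj /= wE ?eqxx yw.
  apply: (worse_contra ad _ _ h1); [| |by []|].
  - by rewrite rangeE C_gt0 /=; lia.
  - by move/bl_tag.
  move=> m' mm; have [/adj_a[_ [h|h|h]] rm _] := mtP mm; rewrite {}h in mm *.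
  - by move: mm; rewrite (negbTE (aF _ _)) // -ltnS wE uw leqnn.
  - by move: mm; rewrite wE => /(top _ _ wC Fw); rewrite /plt.
  - by rewrite wE plt_irr.
have sF k : w + k < C -> ~~ mt (be (w + k)) (s_ (w + k)).
  elim: k => [|k IH]; rewrite ?addn0 // addnS => kC; apply/negP => h1.
  have ad : adj (be (w + k).+1) (s_ (w + k)) by rewrite /adj /= ?eqxx ?orbT.
  apply: (worse_contra ad _ _ h1); [| |by rewrite /plt /= ltnSn|].
  - by rewrite rangeE C_gt0 (ltnW kC).
  - by move/bl_tag.
  move=> m' mm; have [/adj_s[_ [h|h|[h _]]] rm _] := mtP mm; rewrite {}h in mm *.
  - by move: mm; rewrite (negbTE (IH _)) // ltnW.
  - by rewrite plt_irr.
  - by rewrite /plt.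
have sC : ~~ mt (be C.-1) (s_ C.-1).
  by have := sF (C.-1 - w); rewrite subnKC; [apply; lia|lia].
have C1 : C.-1 < C by lia.
have ad : adj (5, (C.-1, 0)) (s_ C.-1) by rewrite /adj /= CE y_last ?eqxx ?orbT.
apply: (worse_contra ad _ _ (mt_c C1 y_last)); [| |by []|].
- by rewrite rangeE C1 C_gt0.
- by move/bl_tag.
move=> m' mm; have [/adj_s[_ [h|h|[h _]]] rm _] := mtP mm; rewrite {}h in mm rm *.
- by move: mm; rewrite (negbTE sC).
- by move: rm; rewrite rangeE CE ltnn !andbF.
- by rewrite plt_irr.
Qed.

Lemma lower_selection : selection sel.
Proof.
move=> e eC; split; first exact: sel_after.
  by move=> se; split; [case: (sel_adj se)|exact: sel_not_after].
move=> se u0 u0D; apply: contraT => nu0.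
(* For the least missing dependency all earlier ones are selected, as [dep_pass] requires; the token
   then enters the lane of an unselected cell. *)
have ex : exists u, (u \in D e) && ~~ sel u by exists u0; rewrite u0D.
case: (ex_minnP ex) => u /andP[uD nu] umin.
have [uV yu] := D_sub uD; have uC : u < C by apply: leq_trans V_le.
have below b : b \in D e -> b < u -> sel b.
  by move=> bD; apply: contraTT => nb; rewrite -leqNgt umin // bD nb.
have [h _] := dep_pass se eC uD below.
have Fu := lane_end uC eC h.
have [h1 h2 h3 h4] := nextyP uC.
have [a [ae sa Ha]] := afterP _ _ (sel_after h2 h3).
(* No family straddles [V], because the cell just before [V] closes one; so the selected cell [a] of
   the family of [u] has a lane as well. *)
have aV : a < V.
  rewrite ltnNge; apply/negP => Va.
  have V1 : V.-1 < nexty u := leq_ltn_trans (leq_trans (leq_pred V) Va) ae.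
  have := h4 V.-1; rewrite y_V V1 andbT -ltnS prednK; last exact: leq_ltn_trans uV.
  by rewrite uV => /(_ isT).
have [ya aC] := sel_adj sa.
have va : vert a by rewrite /vert ya D_lt_V.
have Fa : ~~ mt (t_ a C.-1) (Z a C.-1) by apply: lane_sel => //; rewrite prednK.
case: (ltngtP a u) => [au|ua|au]; last by rewrite -au sa in nu.
  by exfalso; apply: (lanes_clash au uC _ Fa Fu) => i /andP[ai iu]; apply: Ha; rewrite ai (leq_trans iu h1).
by exfalso; apply: (lanes_clash ua aC _ Fu Fa) => i /andP[ui ia]; apply: h4; rewrite ui (ltn_trans ia ae).
Qed.

End Lower.

(** * From a selection to a cheap feasible matching *)

Section Upper.
Variable sel : pred nat.
Hypothesis selP : selection sel.

Definition vsel u := sel u && vert u.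
Definition prevdep u v := \max_(c <- D v | c < u) c.

(** The two better places of the comparator man [t_(u,v)]: [wire_a] comes in along his lane,
    [wire_b] along the row of [v]. *)
Definition wire_a u v : person := if v == 0 then (0, (u, 0)) else (1, (u, v.-1)).
Definition wire_b u v : person :=
  if firstdep u v then (0, (v, 0)) else (1, (prevdep u v, v.-1)).

(** With all dependencies satisfied, the lanes that carry a token are exactly those of selected
    cells, at most one per family. Where such a lane meets the row of a selected [v] depending on
    it, the two tokens are exchanged: the one of the row continues in the lane and the one of the
    lane along the row. *)
Definition wife_of (m : person) : option person :=
  let: (t, (u, v)) := m in
  match t with
  | 0 => if [&& v == 0, 0 < u & ~~ y u.-1] then
           Some (0, (if after sel u then u else u.-1, 0)) else None
  | 1 => if (u == 0) && (v == 0) then Some (5, (0, 0)) else None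
  | 2 => Some (if ~~ vsel u then (1, (u, v)) else
           if (u \in D v) && sel v then wire_b u v else wire_a u v)
  | 3 => if v == 0 then
           Some (if vsel u then (1, (u, C.-1)) else
             if after vsel u then (2, (u.-1, 0)) else (2, (u, 0))) else None
  | 4 => if v == 0 then Some (3, (u, 0)) else None
  | 5 => if (v == 0) && y u then Some (4, (u, 0)) else None
  | _ => if (u == 0) && (v == 0) then Some (6, (0, 0)) else None
  end.

Lemma prevdepE b u v : nextdep b u v -> prevdep u v = b.
Proof.
move=> /and4P[bv uv bu /allP H]; apply/eqP; rewrite eqn_leq; apply/andP; split.
  apply/bigmax_leqP_seq => c cv cu; have := H c cv.
  by rewrite [u <= c]leqNgt cu orbF.
exact: (@leq_bigmax_seq _ _ _ (fun c => c) b bv bu).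
Qed.

Lemma vsel_dep u v : v < C -> u \in D v -> sel v -> vsel u.
Proof.
move=> vC uv sv; have [uV yu] := D_sub uv.
have [_ _ /(_ sv u uv) su] := selP vC.
by rewrite /vsel su /vert yu D_lt_V.
Qed.

Lemma after_vsel u : after vsel u -> after sel u.
Proof.
case/afterP => a [au /andP[sa _] H]; apply/afterP; by exists a.
Qed.

Lemma after_range e : after sel e -> 0 < e /\ ~~ y e.-1.
Proof. by case: e => //= e /andP[ye _]. Qed.

Lemma wire_b_cases u v : u \in D v ->
  firstdep u v /\ wire_b u v = (0, (v, 0)) \/
  exists b, nextdep b u v /\ wire_b u v = (1, (b, v.-1)).
Proof.
rewrite /wire_b; case: ifP => [fu _|nf uv]; first by left.
case: (dep_cases uv); first by rewrite nf.
by move=> [b nb]; right; exists b; split; rewrite // (prevdepE nb).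
Qed.

Lemma dep_pos u v : u \in D v -> v.-1.+1 = v.
Proof. by case: v => //; rewrite D0. Qed.

Lemma wife_adj m w : in_range m -> wife_of m = Some w -> adj m w /\ in_range w.
Proof.
case: m => t [u v] /and3P[/= t7 uC vC].
case: t t7 => [|[|[|[|[|[|[|//]]]]]]] _.
- case: ifP => // /and3P[/eqP-> u0 yu] [<-]; rewrite rangeE C_gt0 /adj /= yu u0.
  case: ifP => au; rewrite ?uC ?eqxx ?orbT //.
  by rewrite prednK // eqxx orbT (ltnW uC).
- by case: ifP => // /andP[/eqP-> /eqP->] [<-]; rewrite rangeE C_gt0.
- case=> <-; case: ifP => [_|/negbFE sv].
    by rewrite rangeE uC vC /adj /= !eqxx.
  case: ifP => [/andP[uv sv']|_].
    have vE := dep_pos uv.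
    case: (wire_b_cases uv) => [[fu ->]|[b [nb ->]]].
      by rewrite rangeE vC C_gt0 /adj /= fu ?eqxx ?orbT.
    have /and4P[_ _ bu _] := nb.
    by rewrite rangeE (ltn_trans bu uC) vE (ltnW vC) /adj /= vE nb ?eqxx ?orbT.
  rewrite /wire_a; case: eqP vC => [->|/eqP v0] vC.
    by move/andP: sv => [_ vu]; rewrite rangeE uC C_gt0 /adj /= vu ?eqxx ?orbT.
  rewrite -lt0n in v0.
  by rewrite rangeE uC prednK // (ltnW vC) /adj /= prednK // ?eqxx ?orbT.
- case: ifP => // /eqP-> [<-]; case: ifP => _.
    by rewrite rangeE uC prednK // leqnn /adj /= prednK // ?eqxx ?orbT.
  case: ifP => [/after_vsel/after_range[u0 yu]|_].
    by rewrite rangeE C_gt0 (leq_ltn_trans (leq_pred u) uC) /adj /= prednK // yu ?eqxx ?orbT.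
  by rewrite rangeE C_gt0 uC /adj /= ?eqxx ?orbT.
- by case: ifP => // /eqP-> [<-]; rewrite rangeE C_gt0 uC /adj /= ?eqxx ?orbT.
- by case: ifP => // /andP[/eqP-> yu] [<-]; rewrite rangeE C_gt0 uC /adj /= yu ?eqxx ?orbT.
- by case: ifP => // /andP[/eqP-> /eqP->] [<-]; rewrite rangeE C_gt0 /adj /=.
Qed.

Lemma wife_o m e : in_range m -> wife_of m = Some (0, (e, 0)) ->
  [\/ m = (0, (e, 0)) /\ after sel e,
      m = (0, (e.+1, 0)) /\ (~~ sel e && ~~ after sel e),
      [/\ m = (2, (e, 0)), sel e & vert e] |
      exists u, [/\ m = (2, (u, e)), sel e & firstdep u e]].
Proof.
move=> rm mw; have [/adj_o[_ ad] _] := wife_adj rm mw.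
case: ad rm mw => [->|[-> ye]|[-> ye]|[[-> ye]|[-> ve]|[u [-> fu]]]] rm //=.
- case: ifP => // /andP[e0 ye] []; case: ifP => [ae _|_ ee]; first by constructor 1.
  by case: (e) e0 ee => //= k _ /eqP; rewrite ltn_eqF.
- rewrite ye => -[]; case: ifP => [_ /eqP|]; first by rewrite gtn_eqF.
  by move=> /negbT; rewrite negb_or => ae _; constructor 2.
- by case: ifP.
- by rewrite D0 /=; case: ifP => // /negbFE/andP[se _] _; constructor 3.
- case: ifP => // _; case: ifP => [/andP[_ se] _|_]; first by constructor 4; exists u.
  case/andP: (fu) => uD _; rewrite /wire_a.
  by move: uD; case: e {fu rm} => [|e]; rewrite ?D0.
Qed.

Lemma wife_Z m p q : in_range m -> wife_of m = Some (1, (p, q)) ->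
  [\/ m = (2, (p, q)) /\ ~~ vsel p,
      [/\ m = (2, (p, q.+1)), vsel p & ~~ ((p \in D q.+1) && sel q.+1)],
      [/\ m = (3, (p, 0)), vsel p & q.+1 = C] |
      exists u, [/\ m = (2, (u, q.+1)), vsel p, sel q.+1 & nextdep p u q.+1]].
Proof.
move=> rm mw; have [/adj_Z ad _] := wife_adj rm mw.
case: ad rm mw => [->|->|[-> qC]|[u [-> nu]]] rm /=.
- case: ifP => [vp _|_]; first by constructor 1.
  case: ifP => [/andP[pq _]|_].
    case: (wire_b_cases pq) => [[_ ->//]|[b [_ ->]]] [_] /eqP.
    by rewrite -{2}(dep_pos pq) ltn_eqF.
  by rewrite /wire_a; case: eqP => [_ //|/eqP]; case: (q) => //= k _ [/eqP]; rewrite ltn_eqF.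
- case: ifP => [_ [/eqP]|/negbFE vp]; first by rewrite gtn_eqF.
  case: ifP => [/andP[pq _]|/negbT h _]; last by constructor 2.
  case: (wire_b_cases pq) => [[_ ->//]|[b [nb ->]]] [bp].
  by move: nb => /and4P[_ _]; rewrite bp ltnn.
- case: ifP => [vp _|]; first by constructor 3.
  by case: ifP.
- have /and4P[pD uD pu _] := nu.
  have uq : q.+1 < C by move: rm => /and3P[].
  case: ifP => [_ [_ /eqP]|/negbFE vu]; first by rewrite gtn_eqF.
  case: ifP => [/andP[_ sq] _|_].
    by constructor 4; exists u; split=> //; apply: vsel_dep pD sq.
  by rewrite /wire_a /= => -[up]; move: pu; rewrite up ltnn.
Qed.

Lemma wife_a m p : in_range m -> wife_of m = Some (2, (p, 0)) ->
  m = (3, (p, 0)) /\ ~~ (vsel p || after vsel p) \/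
  m = (3, (p.+1, 0)) /\ (vsel p || after vsel p).
Proof.
move=> rm mw; have [/adj_a[_ ad] _] := wife_adj rm mw.
case: ad rm mw => [->|->|->] rm //=.
- case: ifP => // vp; case: ifP => [av|ap _]; last by left.
  have [p0 _] := after_range (after_vsel av).
  by case: (p) p0 => //= k _ [/eqP]; rewrite ltn_eqF.
- case: ifP => // _; case: ifP => [/andP[_ h] _|_ [/eqP]]; first by right.
  by rewrite gtn_eqF.
Qed.

Lemma wife_inj m m' w : in_range m -> in_range m' ->
  wife_of m = Some w -> wife_of m' = Some w -> m = m'.
Proof.
case: w => [t [p q]] rm rm' mw mw'.
have [ad rw] := wife_adj rm mw; have [ad' _] := wife_adj rm' mw'.
have pC : p < C by case/and3P: rw.
case: t ad ad' rw mw mw' => [|[|[|[|[|[|[|t]]]]]]] ad ad' rw mw mw'.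
- have [q0 _] := adj_o ad; subst q; have [_ _ _] := selP pC.
  have [_ sa _] := selP pC.
  case: (wife_o rm mw) => [[h a]|[h a]|[h se ve]|[u [h se fu]]];
  case: (wife_o rm' mw') => [[h' a']|[h' a']|[h' se' ve']|[u' [h' se' fu']]];
  rewrite h h' //; try (by case: (sa se) => _; rewrite ?a ?a');
    try (by case: (sa se') => _; rewrite ?a ?a');
    try (by move: a; rewrite ?a' ?se' ?andbF);
    try (by move: a'; rewrite ?a ?se ?andbF).
  + by move: ve fu' => /andP[_ /nilP]; rewrite /firstdep => ->.
  + by move: ve' fu => /andP[_ /nilP]; rewrite /firstdep => ->.
  + by rewrite (firstdep_uniq fu fu').
- case: (wife_Z rm mw) => [[h a]|[h a b]|[h a b]|[u [h a b c]]];
  case: (wife_Z rm' mw') => [[h' a']|[h' a' b']|[h' a' b']|[u' [h' a' b' c']]];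
  rewrite ?h ?h' //; try (by move: a; rewrite (negbTE a')); try (by move: a'; rewrite (negbTE a)).
  + by move: rm; rewrite h /in_range /= b' ltnn andbF.
  + by move: b; have /and4P[-> _ _ _] := c'; rewrite b'.
  + by move: rm'; rewrite h' /in_range /= b ltnn andbF.
  + by move: rm'; rewrite h' /in_range /= b ltnn andbF.
  + by move: b'; have /and4P[-> _ _ _] := c; rewrite b.
  + by move: rm; rewrite h /in_range /= b' ltnn andbF.
  + by rewrite (nextdep_uniq c c').
- have [q0 _] := adj_a ad; subst q.
  by case: (wife_a rm mw) => -[h a]; case: (wife_a rm' mw') => -[h' a'];
    rewrite h h' //; [move: a; rewrite a'|move: a'; rewrite a].
- have [q0 H] := adj_s ad; have [_ H'] := adj_s ad'; subst q.
  case: H mw => [->|->|[-> _]] /=; last by case: ifP.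
    case: H' mw' => [->|->|[-> _]] //=; last by case: ifP.
    by move=> [/eqP]; rewrite gtn_eqF.
  by move=> [/eqP]; rewrite gtn_eqF.
- have [q0 H] := adj_c ad; have [_ H'] := adj_c ad'; subst q.
  by case: H mw => -> //=; case: H' mw' => ->.
- move: ad ad' mw mw'; case: m rm => [tm [um vm]] _; case: m' rm' => [tm' [um' vm']] _.
  by rewrite /adj /= ?andbF ?orbF => H H'; split_hyps; subst.
- move: ad ad' mw mw'; case: m rm => [tm [um vm]] _; case: m' rm' => [tm' [um' vm']] _.
  by rewrite /adj /= ?andbF ?orbF => H H'; split_hyps; subst.
- by case/and3P: rw.
Qed.

Definition sel_matching : {set 'I_n * 'I_n} :=
  [set p : 'I_n * 'I_n | wife_of (decode p.1) == Some (decode p.2)].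

Lemma sel_matching_ok : is_matching cell_market sel_matching.
Proof.
split=> [i j|[i j] [i' j']]; rewrite !inE /=.
  move=> /eqP ij; rewrite ordered_market_acceptable.
  by case: (wife_adj (decode_in_range i) ij).
move=> /eqP ij /eqP ij' [ii|jj].
  by subst i'; move: ij'; rewrite ij => /Some_inj/decode_inj/val_inj->.
by subst j'; have /decode_inj/val_inj-> := wife_inj (decode_in_range i) (decode_in_range i') ij ij'.
Qed.

Lemma has_wife m w : in_range m -> wife_of m = Some w ->
  exists i j : 'I_n, [/\ decode i = m, decode j = w & (i, j) \in sel_matching].
Proof.
move=> rm mw; have [ad rw] := wife_adj rm mw.
have [i im] := in_rangeP rm; have [j jw] := in_rangeP rw.
by exists i, j; split=> //; rewrite inE im jw mw.
Qed.

Lemma sel_matching_feasible : feasible cell_market sel_matching.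
Proof.
split=> [w|m]; last by rewrite inE.
rewrite inE => /andP[t4 /eqP w0].
have H t : t \in [:: 1; 6] -> decode w = (if t == 1 then 5 else 6, (0, 0)) ->
    husband sel_matching w <> None.
  move=> t16 wE; have rt : in_range (t, (0, 0)).
    by rewrite rangeE C_gt0; move: t16; rewrite !inE => /orP[] /eqP->.
  have [|i [j [_ jw ij]]] := has_wife rt (w := decode w).
    by rewrite wE; move: t16; rewrite !inE => /orP[] /eqP->.
  have {}jw : j = w by apply/val_inj/decode_inj.
  rewrite /husband; case: pickP => // /(_ i); by rewrite -jw ij.
have [t7 _ _] := and3P (decode_in_range w).
move: t4 t7 w0 H; case: (decode w) => [t uv] /= t4 t7 -> H.
move: t4 t7; rewrite leq_eqVlt => /orP[/eqP t5|t5] t7.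
  by apply: (H 1); rewrite // -t5.
by apply: (H 6) => //; congr pair; apply/eqP; rewrite eqn_leq t5 -ltnS t7.
Qed.

Lemma sel_taken e : e < C -> ~~ y e -> ~~ sel e ->
  exists u, in_range (0, (u, 0)) /\ wife_of (0, (u, 0)) = Some (0, (e, 0)).
Proof.
move=> eC ye se; case: (boolP (after sel e)) => [ae|nae].
  have [e0 ye'] := after_range ae.
  by exists e; rewrite rangeE eC C_gt0 /= e0 ye' ae.
have eC' : e.+1 < C.
  by rewrite ltn_neqAle eC andbT; apply: contra ye => /eqP EC; have := y_last; rewrite -EC.
by exists e.+1; rewrite rangeE eC' C_gt0 /= ye (negbTE se) (negbTE nae).
Qed.

(** A reason why [(m, w)] does not block. The inequalities are weak, so that matched pairs are
    covered. *)
Definition happy m w :=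
  (exists w', wife_of m = Some w' /\ ~~ plt w w') \/
  (exists m', [/\ in_range m', wife_of m' = Some w & ~~ plt m m']).

Lemma happy_eq m w : wife_of m = Some w -> happy m w.
Proof. by move=> mw; left; exists w; rewrite plt_irr. Qed.

Lemma happy_wife m w w' : wife_of m = Some w' -> plt w' w -> happy m w.
Proof. by move=> mw ww; left; exists w'; split=> //; apply/negP => /(plt_asym ww). Qed.

Lemma happy_husband m m' w : in_range m' -> wife_of m' = Some w -> plt m' m -> happy m w.
Proof. by move=> rm mw mm; right; exists m'; split=> //; apply/negP => /(plt_asym mm). Qed.

(** After the selected cell the men [x_u] stay at [o_u], and [o_(u-1)] is held by [x_(u-1)], except
    directly behind the selected cell, whose woman was freed: this is the one blocking pair of the
    family. *)
Lemma happy_x u w : u < C -> adj (0, (u, 0)) w ->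
  (exists e, [/\ e < C, sel e, u = e.+1 & w = (0, (e, 0))]) \/ happy (0, (u, 0)) w.
Proof.
move=> uC ad; have [_ u0 yu ww] := adj_x ad.
case: (boolP (after sel u)) => au; last first.
  right; case: ww => ->; last by apply: happy_eq; rewrite /= u0 yu (negbTE au).
  apply: (happy_wife (w' := (0, (u.-1, 0)))); rewrite /= ?u0 ?yu ?(negbTE au) //.
  by rewrite /plt /= prednK // leqnn.
case: ww => ->; first by right; apply: happy_eq; rewrite /= u0 yu au.
case: u u0 yu au uC {ad} => //= u _ yu /andP[_ au] uC.
case: (boolP (sel u)) au => [su _|_ /= au]; first by left; exists u; split=> //; apply: ltnW.
have [e0 ye] := after_range au; right.
apply: (happy_husband (m' := (0, (u, 0)))); rewrite ?rangeE ?C_gt0 ?(ltnW uC) //=.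
  by rewrite e0 ye au.
by rewrite /plt /= ltnSn.
Qed.

Lemma happy_y m e : e < C -> y e -> 0 < m.1 -> happy m (0, (e, 0)).
Proof.
move=> eC ye m0; have [/(_ ye) ae _ _] := selP eC; have [e0 ye'] := after_range ae.
apply: (happy_husband (m' := (0, (e, 0)))); rewrite ?rangeE ?eC ?C_gt0 //=.
  by rewrite e0 ye' ae.
by rewrite /plt m0.
Qed.

Lemma happy_taken m e : e < C -> ~~ y e -> ~~ sel e -> 0 < m.1 -> happy m (0, (e, 0)).
Proof.
move=> eC ye se m0; have [u [ru uw]] := sel_taken eC ye se.
by apply: (happy_husband ru uw); rewrite /plt m0.
Qed.

Lemma happy_t u v w : u < C -> v < C -> adj (2, (u, v)) w -> happy (2, (u, v)) w.
Proof.
move=> uC vC; case/adj_t => [->|[v' vE ->]|[v0 -> vu]|[[-> fu]|[b [-> nb]]]].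
- case: (boolP (vsel u)) => vu; last by apply: happy_eq; rewrite /= vu.
  case: (boolP ((u \in D v) && sel v)) => uv.
    case/andP: (uv) => uD _; case: (wire_b_cases uD) => [[_ wE]|[b [nb wE]]].
      by apply: (happy_wife (w' := (0, (v, 0)))); rewrite /= ?vu ?uv ?wE.
    apply: (happy_wife (w' := (1, (b, v.-1)))); rewrite /= ?vu ?uv ?wE //.
    by case/and4P: nb => _ _ bu _; rewrite /plt /= bu.
  rewrite /happy /= vu (negbTE uv) /wire_a /=.
  case: eqP => [->|/eqP v0]; left.
    by exists (0, (u, 0)).
  exists (1, (u, v.-1)); split=> //.
  by rewrite /plt /= eqxx ltnn /= -leqNgt leq_pred.
- subst v; case: (boolP (vsel u)) => vu; last first.
    apply: (happy_husband (m' := (2, (u, v')))); rewrite ?rangeE ?uC ?(ltnW vC) //=.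
      by rewrite vu.
    by rewrite /plt /= eqxx ltnSn ltnn.
  case: (boolP ((u \in D v'.+1) && sel v'.+1)) => uv; last first.
    by apply: happy_eq; rewrite /= vu (negbTE uv).
  case/andP: (uv) => uD _; case: (wire_b_cases uD) => [[_ wE]|[b [nb wE]]].
    by apply: (happy_wife (w' := (0, (v'.+1, 0)))); rewrite /= ?vu ?uv ?wE.
  apply: (happy_wife (w' := (1, (b, v')))); rewrite /= ?vu ?uv ?wE //.
  by case/and4P: nb => _ _ bu _; rewrite /plt /= bu.
- subst v; have yu : ~~ y u by case/andP: vu.
  case: (boolP (sel u)) => su; last exact: happy_taken.
  by apply: happy_eq; rewrite /= /vsel su vu D0.
- have uD : u \in D v by case/andP: fu.
  have yv : ~~ y v by apply/negP => /D_y Dv; rewrite Dv in uD.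
  case: (boolP (sel v)) => sv; last exact: happy_taken.
  by apply: happy_eq; rewrite /= (vsel_dep vC uD sv) uD sv /wire_b fu.
- have /and4P[bD uD bu _] := nb; have vE := dep_pos uD.
  have bC : b < C := ltn_trans bu uC.
  have v1C : v.-1 < C by rewrite vE ltnW.
  case: (boolP (sel v)) => sv.
    apply: happy_eq; rewrite /= (vsel_dep vC uD sv) uD sv /= /wire_b (prevdepE nb) ifF //.
    by apply/negP => /andP[_ /allP/(_ _ bD)]; rewrite leqNgt bu.
  case: (boolP (vsel b)) => vb; last first.
    apply: (happy_husband (m' := (2, (b, v.-1)))); rewrite ?rangeE ?bC ?v1C //=.
      by rewrite vb.
    by rewrite /plt /= bu.
  apply: (happy_husband (m' := (2, (b, v)))); rewrite ?rangeE ?bC ?vC //=.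
    by rewrite vb (negbTE sv) andbF /wire_a -vE.
  by rewrite /plt /= bu.
Qed.

Lemma vsel_after u : u < C -> vsel u -> after vsel u = false.
Proof.
move=> uC /andP[su _]; apply/negP => /after_vsel au.
by have [_ /(_ su)[_]] := selP uC; rewrite au.
Qed.

Lemma happy_r u w : u < C -> adj (3, (u, 0)) w -> happy (3, (u, 0)) w.
Proof.
move=> uC /adj_r[_ [->|[p uE [-> yp]]|->]].
- case: (boolP (vsel u)) => vu; first by apply: happy_eq; rewrite /= vu.
  apply: (happy_husband (m' := (2, (u, C.-1)))) => //=; last by rewrite vu.
  by rewrite rangeE uC prednK /=.
- subst u; case: (boolP (vsel p.+1)) => vp.
    by apply: (happy_wife (w' := (1, (p.+1, C.-1)))); rewrite //= vp.
  case: (boolP (after vsel p.+1)) => ap; first by apply: happy_eq; move: ap; rewrite /= (negbTE vp) => ->.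
  apply: (happy_husband (m' := (3, (p, 0)))); rewrite ?rangeE ?C_gt0 ?(ltnW uC) //=.
    by move: ap; rewrite /= yp negb_or => /andP[/negbTE-> /negbTE->].
  by rewrite /plt /= ltnSn.
- rewrite /happy /=; left; case: ifP => _; first by exists (1, (u, C.-1)).
  case: ifP => [_|_]; last by exists (2, (u, 0)); rewrite plt_irr.
  by exists (2, (u.-1, 0)); split=> //; rewrite /plt /= ltnn andbF orbF -leqNgt leq_pred.
Qed.

(** A family has at most one token here, so [a_p] is always held by [r_p] or [r_(p+1)] when [p] does
    not close a family, and no man [be] has a reason to move. *)
Lemma happy_b u w : u < C -> adj (4, (u, 0)) w -> happy (4, (u, 0)) w.
Proof.
move=> uC /adj_b[_ [[p uE [-> yp]]|[p uE ->]|->]]; last exact: happy_eq; subst u.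
  have pC := ltnW uC; case: (boolP (vsel p || after vsel p)) => ap.
    apply: (happy_husband (m' := (3, (p.+1, 0)))); rewrite ?rangeE ?C_gt0 ?uC //=.
    case: (boolP (vsel p.+1)) => vp; last by rewrite yp ap.
    by have := vsel_after uC vp; rewrite /= yp ap.
  apply: (happy_husband (m' := (3, (p, 0)))); rewrite ?rangeE ?C_gt0 ?pC //=.
  by move: ap; rewrite negb_or => /andP[/negbTE-> /negbTE->].
apply: (happy_husband (m' := (4, (p, 0)))); rewrite ?rangeE ?C_gt0 ?(ltnW uC) //=.
by rewrite /plt /= ltnSn.
Qed.

Lemma settled m w : in_range m -> in_range w -> adj m w ->
  (exists e, [/\ e < C, sel e, m = (0, (e.+1, 0)) & w = (0, (e, 0))]) \/ happy m w.
Proof.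
case: m => [t [u v]] /and3P[/= t7 uC vC] rw.
case: t t7 => [|[|[|[|[|[|[|//]]]]]]] _ ad.
- have [v0 _ _ _] := adj_x ad; subst v.
  by case: (happy_x uC ad) => [[e [eC se -> ->]]|]; [left; exists e|right].
- have [u0 v0 H] := adj_m1 ad; subst u v; right.
  case: H rw => [[p [-> yp]]|->] rw; last exact: happy_eq.
  by apply: happy_y => //; case/and3P: rw.
- by right; apply: happy_t.
- by have [v0 _] := adj_r ad; subst v; right; apply: happy_r.
- by have [v0 _] := adj_b ad; subst v; right; apply: happy_b.
- have [v0 yu H] := adj_n ad; subst v; right.
  case: H => ->; first exact: happy_y.
    by apply: (happy_husband (m' := (4, (u, 0)))); rewrite ?rangeE ?C_gt0 ?uC.
  by apply: happy_eq; rewrite /= yu.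
- have [u0 v0 H] := adj_m2 ad; subst u v; right.
  case: H rw => [[p [-> yp]]|->] rw; last exact: happy_eq.
  apply: (happy_husband (m' := (5, (p, 0)))) => //=; rewrite ?yp //.
Qed.

(** Scanning the cells, each selected cell is matched by the end of its family; [after] accounts for
    a family whose end is still ahead. *)
Lemma count_sel e : e <= C -> count y (iota 0 e) + after sel e = count sel (iota 0 e).
Proof.
elim: e => // e IH eC; rewrite -addn1 iotaD !count_cat /= !addn0 add0n -(IH (ltnW eC)) addn1 /=.
have [ya sa _] := selP eC.
case ye: (y e) => /=; first by rewrite (ya ye); case: (boolP (sel e)) sa => // _ /(_ isT) []; rewrite ye.
case: (boolP (sel e)) sa => [_ /(_ isT)[_ /negbTE->]|_ _] /=; lia.
Qed.

Lemma sel_matching_blocking :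
  #|blocking_pairs cell_market sel_matching| <= count y (iota 0 C).
Proof.
have blE p : p \in blocking_pairs cell_market sel_matching ->
    exists e, [/\ e < C, sel e, decode p.1 = (0, (e.+1, 0)) & decode p.2 = (0, (e, 0))].
  case: p => i j; rewrite inE ordered_market_blocking; last exact: sel_matching_ok.
  move=> /and3P[/= ad /forallP hi /forallP hj].
  case: (settled (decode_in_range i) (decode_in_range j) ad) => // -[[w' [iw /negP[]]]|[m' [rm mj /negP[]]]].
    have [i' [j' [ii jw ij]]] := has_wife (decode_in_range i) iw.
    have {}ii : i' = i by apply/val_inj/decode_inj.
    by have := hi j'; rewrite -ii ij decode_lt jw.
  have [i' [j' [ii jw ij]]] := has_wife rm mj.
  have {}jw : j' = j by apply/val_inj/decode_inj.
  by have := hj i'; rewrite -jw ij decode_lt ii.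
(* The last cell closes a family, so the correction term of [count_sel] vanishes at [C]. *)
have -> : count y (iota 0 C) = size [seq e <- iota 0 C | sel e].
  rewrite size_filter -count_sel // -{3}(prednK C_gt0) /= y_last /=.
  by rewrite addn0.
rewrite cardE -(size_map (fun p : 'I_n * 'I_n => (decode p.2).2.1)).
apply: uniq_leq_size.
  rewrite map_inj_in_uniq ?enum_uniq // => p q; rewrite !mem_enum.
  move=> /blE[e [_ _ p1 p2]] /blE[e' [_ _ q1 q2]]; rewrite p2 q2 /= => ee; subst e'.
  rewrite [p]surjective_pairing [q]surjective_pairing.
  by congr pair; apply/val_inj/decode_inj; rewrite ?p1 ?p2.
move=> e /mapP[p]; rewrite mem_enum => /blE[e' [eC se _ pe]] ->.
by rewrite pe mem_filter mem_iota se.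
Qed.
End Upper.

Theorem cell_market_correct :
  (exists mu, [/\ is_matching cell_market mu, feasible cell_market mu &
     #|blocking_pairs cell_market mu| <= count y (iota 0 C)]) <->
  (exists sel, selection sel).
Proof.
split=> [[mu [h1 h2 h3]]|[sel selP]].
  by exists (sel mu); apply: lower_selection.
exists (sel_matching sel); split.
- exact: sel_matching_ok.
- exact: sel_matching_feasible.
- exact: sel_matching_blocking.
Qed.

(** * Lengths of the preference lists and the distinguished women *)

Lemma woman_size (j : 'I_n) (L : seq person) :
  (forall m, in_range m -> adj m (decode j) -> m \in L) ->
  size (woman_list cell_market j) <= size L.
Proof.
move=> H; rewrite ffunE -(size_map (fun i : 'I_n => decode i)); apply: uniq_leq_size.
  rewrite map_inj_uniq => [|a b /decode_inj/val_inj//].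
  exact/filter_uniq/enum_uniq.
move=> m /mapP[i]; rewrite mem_filter => /andP[ad _] ->.
by apply: H ad; apply: decode_in_range.
Qed.

Lemma man_size (i : 'I_n) (L : seq person) :
  (forall w, in_range w -> adj (decode i) w -> w \in L) ->
  size (man_list cell_market i) <= size L.
Proof.
move=> H; rewrite ffunE -(size_map (fun i : 'I_n => decode i)); apply: uniq_leq_size.
  rewrite map_inj_uniq => [|a b /decode_inj/val_inj//].
  exact/filter_uniq/enum_uniq.
move=> m /mapP[j]; rewrite mem_filter => /andP[ad _] ->.
by apply: H ad; apply: decode_in_range.
Qed.

Lemma women_degree : max_woman_list cell_market <= 3.
Proof.
apply/bigmax_leqP => j _; have := decode_in_range j; case wE: (decode j) => [t [p q]] rw.
have H L : (forall m, in_range m -> adj m (t, (p, q)) -> m \in L) ->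
    size L <= 3 -> size (woman_list cell_market j) <= 3.
  by move=> HL; apply: leq_trans; apply: woman_size; rewrite wE.
have /and3P[/= t7 pC qC] := rw.
case: t t7 {wE rw} H => [|[|[|[|[|[|[|//]]]]]]] _ H.
- case ye: (y p).
    apply: (H [:: (0, (p, 0)); (1, (0, 0)); (5, (p, 0))]) => // m rm /adj_o[_].
    case=> [->|[->]|[-> _]|[[->]|[->]|[u [->]]]]; rewrite ?inE ?eqxx ?orbT ?ye //.
      by rewrite /vert ye.
    by rewrite /firstdep (D_y ye).
  (* Besides the two men [x], a cell that does not close a family has one comparator man: that of
     its own lane, or that of its unique first dependency [u0]. *)
  have [u0 Hu] : exists u0, forall u, firstdep u p -> u = u0.
    case: (boolP (has (fun u => firstdep u p) (D p))) => [/hasP[u0 _ f0]|/hasPn nf].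
      by exists u0 => u fu; apply: firstdep_uniq fu f0.
    by exists 0 => u fu; move: (nf u); rewrite fu => /(_ _) h; case/andP: (fu) => /h.
  apply: (H [:: (0, (p, 0)); (0, (p.+1, 0)); if vert p then (2, (p, 0)) else (2, (u0, p))]) => // m rm /adj_o[_].
  case=> [->|[->]|[_]|[[_]|[-> vp]|[u [-> fu]]]]; rewrite ?inE ?eqxx ?orbT ?ye ?vp ?eqxx ?orbT //.
  rewrite (Hu _ fu); case: ifP => [/andP[_ /nilP Dp]|_]; last by rewrite eqxx !orbT.
  by move: fu; rewrite /firstdep Dp.
- case: (eqVneq q.+1 C) => [qE|qN].
    apply: (H [:: (2, (p, q)); (3, (p, 0))]) => // m rm /adj_Z[h|h|[h _]|[u [h _]]];
      rewrite {}h in rm *; rewrite ?inE ?eqxx ?orbT //.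
      by move: rm; rewrite rangeE qE ltnn !andbF.
    by move: rm; rewrite rangeE qE ltnn !andbF.
  have [u0 Hu] : exists u0, forall u, nextdep p u q.+1 -> u = u0.
    case: (boolP (has (fun u => nextdep p u q.+1) (D q.+1))) => [/hasP[u0 _ f0]|/hasPn nf].
      by exists u0 => u fu; apply: nextdep_uniq fu f0.
    by exists 0 => u fu; move: (nf u); rewrite fu => /(_ _) h; case/and4P: (fu) => _ /h.
  apply: (H [:: (2, (p, q)); (2, (p, q.+1)); (2, (u0, q.+1))]) => // m rm.
  case/adj_Z => [->|->|[_ qE]|[u [-> /Hu ->]]]; rewrite ?inE ?eqxx ?orbT //.
  by rewrite qE eqxx in qN.
- apply: (H [:: (3, (p, 0)); (3, (p.+1, 0)); (4, (p.+1, 0))]) => // m rm /adj_a[_].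
  by case=> ->; rewrite ?inE ?eqxx ?orbT.
- apply: (H [:: (4, (p, 0)); (4, (p.+1, 0)); (5, (p, 0))]) => // m rm /adj_s[_].
  by case=> [->|->|[-> _]]; rewrite ?inE ?eqxx ?orbT.
- apply: (H [:: (5, (p, 0)); (6, (0, 0))]) => // m rm /adj_c[_].
  by case=> ->; rewrite ?inE ?eqxx ?orbT.
- apply: (H [:: (1, (0, 0))]) => // -[tm [um vm]] rm.
  by rewrite /adj /= ?andbF ?orbF => ad; split_hyps; subst.
- apply: (H [:: (6, (0, 0))]) => // -[tm [um vm]] rm.
  by rewrite /adj /= ?andbF ?orbF => ad; split_hyps; subst.
Qed.

Lemma men_degree : max_man_list cell_market <= count y (iota 0 C) + 5.
Proof.
apply/bigmax_leqP => i _; have := decode_in_range i; case mE: (decode i) => [t [u v]] rm.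
set F := count _ _.
have H L : (forall w, in_range w -> adj (t, (u, v)) w -> w \in L) ->
    size L <= F + 5 -> size (man_list cell_market i) <= F + 5.
  by move=> HL; apply: leq_trans; apply: man_size; rewrite mE.
have size_y t' x : size (x :: [seq (t', (e, 0)) | e <- iota 0 C & y e] : seq person) <= F + 5.
  by rewrite /= size_map size_filter -/F addnS ltnS leq_addr.
have in_y t' x e : e < C -> y e -> (t', (e, 0)) \in x :: [seq (t', (e, 0)) | e <- iota 0 C & y e].
  move=> eC ye; rewrite inE; apply/orP; right; apply/mapP; exists e => //.
  by rewrite mem_filter ye mem_iota.
have /and3P[/= t7 _ _] := rm.
case: t t7 {mE rm} H => [|[|[|[|[|[|[|//]]]]]]] _ H.
- apply: (H [:: (0, (u, 0)); (0, (u.-1, 0))]); last by rewrite /= !addnS.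
  by move=> w rw /adj_x[_ _ _ []] ->; rewrite ?inE ?eqxx ?orbT.
- apply: (H ((5, (0, 0)) :: [seq (0, (e, 0)) | e <- iota 0 C & y e])) => // w rw.
  case/adj_m1 => _ _ [[p [wE yp]]|->]; last by rewrite inE eqxx.
  by rewrite wE in rw *; apply: in_y => //; case/and3P: rw.
(* The five possible places of a comparator man are the origin of the constant in the bound. *)
- apply: (H [:: (1, (u, v)); (1, (u, v.-1)); (0, (u, 0)); (0, (v, 0)); (1, (prevdep u v, v.-1))]);
    last by rewrite leq_addl.
  move=> w rw; case/adj_t => [->|[v' -> ->]|[_ -> _]|[[-> _]|[b [-> /prevdepE->]]]];
  by rewrite ?inE ?eqxx ?orbT.
- apply: (H [:: (1, (u, C.-1)); (2, (u.-1, 0)); (2, (u, 0))]); last by rewrite /= !addnS.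
  move=> w rw /adj_r[_ [->|[p -> [-> _]]|->]]; by rewrite ?inE ?eqxx ?orbT.
- apply: (H [:: (2, (u.-1, 0)); (3, (u.-1, 0)); (3, (u, 0))]); last by rewrite /= !addnS.
  move=> w rw /adj_b[_ [[p -> [-> _]]|[p -> ->]|->]]; by rewrite ?inE ?eqxx ?orbT.
- apply: (H [:: (0, (u, 0)); (3, (u, 0)); (4, (u, 0))]); last by rewrite /= !addnS.
  move=> w rw /adj_n[_ _ [->|->|->]]; by rewrite ?inE ?eqxx ?orbT.
- apply: (H ((6, (0, 0)) :: [seq (4, (e, 0)) | e <- iota 0 C & y e])) => // w rw.
  case/adj_m2 => _ _ [[p [wE yp]]|->]; last by rewrite inE eqxx.
  by rewrite wE in rw *; apply: in_y => //; case/and3P: rw.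
Qed.

Lemma dist_women_cases (j : 'I_n) : j \in dist_women cell_market ->
  decode j = (5, (0, 0)) \/ decode j = (6, (0, 0)).
Proof.
rewrite inE => /andP[t4 /eqP j0]; have [t7 _ _] := and3P (decode_in_range j).
case: (decode j) t4 t7 j0 => [t uv] /= t4 t7 ->.
by case: t t4 t7 => [|[|[|[|[|[|[|]]]]]]] //; [left|right].
Qed.

Lemma card_dist_women : #|dist_women cell_market| = 2.
Proof.
have [j5 E5] : exists j : 'I_n, decode j = (5, (0, 0)) by apply: in_rangeP; rewrite rangeE C_gt0.
have [j6 E6] : exists j : 'I_n, decode j = (6, (0, 0)) by apply: in_rangeP; rewrite rangeE C_gt0.
have -> : dist_women cell_market = [set j5; j6].
  apply/setP => j; rewrite !inE; apply/idP/idP.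
    have := @dist_women_cases j; rewrite inE => H /H[] jE; apply/orP; [left|right];
      by apply/eqP/val_inj/decode_inj; rewrite jE.
  by case/orP => /eqP->; rewrite ?E5 ?E6.
by rewrite cards2; case: eqP => // jj; move: E6; rewrite -jj E5.
Qed.

Lemma size_dist_woman (j : 'I_n) : j \in dist_women cell_market ->
  size (woman_list cell_market j) = 1.
Proof.
move=> jd; suff [m mj] : exists m, forall i : 'I_n, adj (decode i) (decode j) = (i == m).
  rewrite ffunE (eq_filter mj) size_filter.
  by rewrite (count_uniq_mem m (enum_uniq 'I_n)) mem_enum.
have [t mE] : exists t, in_range (t, (0, 0)) /\ forall m, adj m (decode j) = (m == (t, (0, 0))).
  case: (dist_women_cases jd) => ->; [exists 1|exists 6]; rewrite rangeE C_gt0; split=> // m.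
    by apply/idP/eqP => [/adj_w1|->].
  by apply/idP/eqP => [/adj_w2|->].
have [m mt] := in_rangeP mE.1; exists m => i; rewrite mE.2 -mt.
by apply/eqP/eqP => [/decode_inj/val_inj|->].
Qed.
End Cells.

(** * Certificates in circuits of weft 1 *)

Lemma node_attributes_rcons T (F : seq T -> gate -> T) gs g :
  node_attributes F (rcons gs g) =
  rcons (node_attributes F gs) (F (node_attributes F gs) g).
Proof. by rewrite /node_attributes -cats1 foldl_cat. Qed.

Lemma size_node_attributes T (F : seq T -> gate -> T) gs :
  size (node_attributes F gs) = size gs.
Proof.
by elim/last_ind: gs => // gs g IH; rewrite node_attributes_rcons !size_rcons IH.
Qed.

Lemma nth_node_attributes T (F : seq T -> gate -> T) gs x0 g0 i : i < size gs ->
  nth x0 (node_attributes F gs) i = F (take i (node_attributes F gs)) (nth g0 gs i).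
Proof.
elim/last_ind: gs => // gs g IH; rewrite size_rcons ltnS node_attributes_rcons => le.
rewrite !nth_rcons size_node_attributes -cats1 takel_cat ?size_node_attributes //.
case: (ltngtP i (size gs)) le => // [lt _|-> _]; first exact: IH.
by rewrite take_oversize // size_node_attributes.
Qed.

(* Each node gets two flags, [known to be true] and [known to be false], from the
   claims [cl]. *)
Definition kstep (cl : seq (nat * bool)) (vs : seq (bool * bool)) (g : gate) : bool * bool :=
  let kn j := nth (false, false) vs j in
  let b := match g.1 with
    | GIn => (false, false)
    | GNot => ((kn (head 0 g.2)).2, (kn (head 0 g.2)).1)
    | GAnd => (all (fun j => (kn j).1) g.2, has (fun j => (kn j).2) g.2)
    | GOr => (has (fun j => (kn j).1) g.2, all (fun j => (kn j).2) g.2)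
    end in
  (b.1 || ((size vs, true) \in cl), b.2 || ((size vs, false) \in cl)).

Definition known cl gs := node_attributes (kstep cl) gs.

Section Circuit.
Variable c : circuit.
Hypothesis wf : wf_circuit c.
Notation n := (size (gates c)).
Notation op i := (node c i).1.
Notation args i := (node c i).2.

Definition kn cl i := nth (false, false) (known cl (gates c)) i.
Definition value S i := nth false (node_attributes (gate_value S) (gates c)) i.
Definition wt i := nth 0 (node_attributes gate_weft (gates c)) i.
Definition dp i := nth 0 (node_attributes gate_depth (gates c)) i.

Lemma args_lt (i j : nat) : i < n -> j \in args i -> j < i.
Proof. by move=> /(wf.2 _)[_ _ /allP] H /H. Qed.

Lemma argsP i : i < n -> match op i with
  | GIn => args i = [::]
  | GNot => exists j, args i = [:: j]
  | _ => 2 <= size (args i)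
  end.
Proof.
move=> /(wf.2 _)[]; rewrite /arity_ok; case: (node c i) => [[] [|j [|j' s]]] //= _ _ _.
by exists j.
Qed.

Lemma nth_take_arg T (vs : seq T) x0 (i j : nat) : i < n -> j \in args i ->
  nth x0 (take i vs) j = nth x0 vs j.
Proof. by move=> ilt /(args_lt ilt) ji; rewrite nth_take. Qed.

Lemma valueE S i : i < n -> value S i = match op i with
  | GIn => i \in S
  | GNot => ~~ value S (head 0 (args i))
  | GAnd => all (value S) (args i)
  | GOr => has (value S) (args i)
  end.
Proof.
move=> ilt; rewrite /value (nth_node_attributes _ _ (GIn, [::])) // -/(node c i) /gate_value.
have := argsP ilt; have := @nth_take_arg _ (node_attributes (gate_value S) (gates c)) false _ _ ilt.
case: (node c i) => [[]] /= s H.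
- by move=> _; rewrite size_takel // size_node_attributes ltnW.
- by move=> [j sj]; rewrite sj H // sj mem_head.
- by move=> _; apply: eq_in_all => j /H.
- by move=> _; apply: eq_in_has => j /H.
Qed.

Lemma wtE i : i < n -> wt i = (2 < size (args i)) + \max_(j <- args i) wt j.
Proof.
move=> ilt; rewrite /wt (nth_node_attributes _ _ (GIn, [::])) // -/(node c i) /gate_weft.
by congr addn; apply: eq_big_seq => j /(nth_take_arg _ _ ilt).
Qed.

Lemma wt_arg (i j : nat) : i < n -> j \in args i -> (2 < size (args i)) + wt j <= wt i.
Proof. by move=> ilt ji; rewrite (wtE ilt) leq_add2l; apply: (@leq_bigmax_seq _ (args i) xpredT (fun j => wt j)). Qed.

Lemma dp_arg (i j : nat) : i < n -> j \in args i -> dp j < dp i.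
Proof.
move=> ilt ji; rewrite {2}/dp (nth_node_attributes _ _ (GIn, [::])) // -/(node c i) /gate_depth.
rewrite /dp -(nth_take_arg (node_attributes gate_depth (gates c)) 0 ilt ji).
move: ji; case: (args i) => // x s ji; rewrite ltnS.
exact: (@leq_bigmax_seq _ _ xpredT (fun j => nth 0 (take i _) j)).
Qed.

Lemma knE cl i : i < n -> kn cl i =
  let b := match op i with
    | GIn => (false, false)
    | GNot => ((kn cl (head 0 (args i))).2, (kn cl (head 0 (args i))).1)
    | GAnd => (all (fun j => (kn cl j).1) (args i), has (fun j => (kn cl j).2) (args i))
    | GOr => (has (fun j => (kn cl j).1) (args i), all (fun j => (kn cl j).2) (args i))
    end in
  (b.1 || ((i, true) \in cl), b.2 || ((i, false) \in cl)).
Proof.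
move=> ilt; rewrite /kn {1}/known (nth_node_attributes _ _ (GIn, [::])) // -/(node c i) /kstep.
rewrite size_takel ?size_node_attributes ?(ltnW ilt) //.
have := argsP ilt; have := @nth_take_arg _ (known cl (gates c)) (false, false) _ _ ilt.
case: (node c i) => [[]] /= s H //.
- by move=> [j sj]; rewrite sj /= H // sj mem_head.
- move=> _; congr (_ || _, _ || _); first by apply: eq_in_all => j /H ->.
  by apply: eq_in_has => j /H ->.
- move=> _; congr (_ || _, _ || _); first by apply: eq_in_has => j /H ->.
  by apply: eq_in_all => j /H ->.
Qed.

Lemma kn_mono cl cl' i : {subset cl <= cl'} -> i < n ->
  ((kn cl i).1 -> (kn cl' i).1) /\ ((kn cl i).2 -> (kn cl' i).2).
Proof.
move=> sub; elim/ltn_ind: i => i IH ilt; rewrite (knE cl ilt) (knE cl' ilt) /=.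
have {}IH j : j \in args i -> ((kn cl j).1 -> (kn cl' j).1) /\ ((kn cl j).2 -> (kn cl' j).2).
  by move=> ji; have ji' := args_lt ilt ji; apply: IH => //; apply: ltn_trans ilt.
have sT : (i, true) \in cl -> (i, true) \in cl' by apply: sub.
have sF : (i, false) \in cl -> (i, false) \in cl' by apply: sub.
have orT (a a' : bool) : (a -> a') -> a || ((i, true) \in cl) -> a' || ((i, true) \in cl').
  by move=> aa /orP[/aa->|/sT->]; rewrite ?orbT.
have orF (a a' : bool) : (a -> a') -> a || ((i, false) \in cl) -> a' || ((i, false) \in cl').
  by move=> aa /orP[/aa->|/sF->]; rewrite ?orbT.
have := argsP ilt; case: (node c i) IH => [[]] /= s IH.
- by move=> _; split=> [/sT|/sF].
- case=> j sj; move: IH; rewrite sj => /(_ j (mem_head _ _))[h1 h2].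
  by split; [apply: orT|apply: orF].
- move=> _; split; [apply: orT|apply: orF].
    by move=> h; apply/allP => j js; apply: (IH j js).1 (allP h j js).
  by case/hasP => j js K; apply/hasP; exists j => //; apply: (IH j js).2.
- move=> _; split; [apply: orT|apply: orF].
    by case/hasP => j js K; apply/hasP; exists j => //; apply: (IH j js).1.
  by move=> h; apply/allP => j js; apply: (IH j js).2 (allP h j js).
Qed.

(** Claims have to be correct only on a set closed under in-neighbours. This will be the set of
    nodes of weft at most 1 and depth at most [d], as false claims can be refuted only there. *)
Lemma kn_sound S cl (P : pred nat) :
  (forall i j, i < n -> P i -> j \in args i -> P j) ->
  (forall g v, (g, v) \in cl -> g < n -> P g -> value S g = v) ->
  forall i, i < n -> P i ->
    ((kn cl i).1 -> value S i) /\ ((kn cl i).2 -> ~~ value S i).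
Proof.
move=> Pa clP; elim/ltn_ind => i IH ilt Pi.
have {}IH j : j \in args i -> ((kn cl j).1 -> value S j) /\ ((kn cl j).2 -> ~~ value S j).
  move=> ji; have ji' := args_lt ilt ji; apply: IH => //; first exact: ltn_trans ilt.
  exact: Pa Pi ji.
have cT : (i, true) \in cl -> value S i by move=> h; rewrite (clP _ _ h ilt Pi).
have cF : (i, false) \in cl -> ~~ value S i by move=> h; rewrite (clP _ _ h ilt Pi).
rewrite (knE cl ilt) /=; have := argsP ilt; have := valueE S ilt.
case: (node c i) IH => [[]] /= s IH vE H.
- by split=> [/cT|/cF].
- case: H IH vE => j -> IH vE; have [h1 h2] := IH j (mem_head _ _).
  split=> /orP[|h]; [|exact: cT| |exact: cF]; rewrite vE /=; first exact: h2.
  by move/h1 => ->.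
- split=> /orP[|h]; [|exact: cT| |exact: cF]; rewrite vE.
    by move/allP => K; apply/allP => j js; apply: (IH j js).1 (K j js).
  by move/hasP => [j js K]; apply/allPn; exists j => //; apply: (IH j js).2.
- split=> /orP[|h]; [|exact: cT| |exact: cF]; rewrite vE.
    by move/hasP => [j js K]; apply/hasP; exists j => //; apply: (IH j js).1.
  by move/allP => K; apply/hasPn => j js; apply: (IH j js).2 (K j js).
Qed.

(** These claims can be refuted by one input or one in-neighbour. The opposite values of large gates
    need no claim, since one in-neighbour already establishes them. *)
Definition allowed (gv : nat * bool) : bool :=
  match op gv.1 with
  | GIn => true
  | GNot => false
  | GAnd => gv.2 && (2 < size (args gv.1))
  | GOr => ~~ gv.2 && (2 < size (args gv.1))
  end.

Definition supports cl i (v : bool) := if v then (kn cl i).1 else (kn cl i).2.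

Lemma supports_mono cl cl' i v : {subset cl <= cl'} -> i < n ->
  supports cl i v -> supports cl' i v.
Proof. by move=> sub ilt; have [h1 h2] := kn_mono sub ilt; case: v. Qed.

Lemma supports_claim cl i v : i < n -> (i, v) \in cl -> supports cl i v.
Proof. by move=> ilt h; rewrite /supports (knE cl ilt); case: v h => /= ->; rewrite orbT. Qed.

(** Two certificates have to be joined only at a gate with two in-neighbours both of which matter,
    so the size at most doubles with each level of depth. A large gate is either decided by one
    in-neighbour or is claimed itself; the latter does not happen in weft 0, where only inputs are
    claimed. *)
Lemma certificate S i : i < n -> wt i <= 1 ->
  exists cl, [/\ size cl <= 2 ^ dp i,
    forall g v, (g, v) \in cl -> [/\ g < n, value S g = v, allowed (g, v) & wt i = 0 -> op g = GIn] &
    supports cl i (value S i)].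
Proof.
elim/ltn_ind: i => i IH ilt wi.
have {}IH j : j \in args i -> exists cl, [/\ (size cl).*2 <= 2 ^ dp i,
    forall g v, (g, v) \in cl -> [/\ g < n, value S g = v, allowed (g, v) & wt i = 0 -> op g = GIn] &
    supports cl j (value S j)].
  move=> ji; have jlt := args_lt ilt ji; have wji := wt_arg ilt ji.
  have wij : wt j <= wt i by apply: leq_trans wji; apply: leq_addl.
  have [cl [sz H sp]] := IH j jlt (ltn_trans jlt ilt) (leq_trans wij wi).
  exists cl; split=> // [|g v /H[h1 h2 h3 h4]].
    apply: leq_trans (_ : (2 ^ dp j).*2 <= _); first by rewrite leq_double.
    by rewrite -mul2n -expnS leq_pexp2l // dp_arg.
  by split=> // wi0; apply: h4; move: wij; rewrite wi0 leqn0 => /eqP.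
have IH1 j w : j \in args i ->
    (forall cl, supports cl j (value S j) -> supports cl i w) ->
    exists cl, [/\ size cl <= 2 ^ dp i,
    forall g v, (g, v) \in cl -> [/\ g < n, value S g = v, allowed (g, v) & wt i = 0 -> op g = GIn] &
    supports cl i w].
  move=> ji sup; have [cl [sz H sp]] := IH j ji; exists cl; split=> //; last exact: sup.
  by apply: leq_trans sz; rewrite -addnn leq_addr.
have IH2 j j' w : j \in args i -> j' \in args i ->
    (forall cl, supports cl j (value S j) -> supports cl j' (value S j') -> supports cl i w) ->
    exists cl, [/\ size cl <= 2 ^ dp i,
    forall g v, (g, v) \in cl -> [/\ g < n, value S g = v, allowed (g, v) & wt i = 0 -> op g = GIn] &
    supports cl i w].
  move=> ji ji' sup; have [cl [sz H sp]] := IH j ji; have [cl' [sz' H' sp']] := IH j' ji'.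
  exists (cl ++ cl'); split=> [|g v|].
  - rewrite size_cat -leq_double doubleD -[X in _ <= X]addnn; exact: leq_add.
  - by rewrite mem_cat => /orP[/H|/H'].
  - apply: sup; [apply: supports_mono sp|apply: supports_mono sp'].
    + by move=> x xc; rewrite mem_cat xc.
    + exact: ltn_trans (args_lt ilt ji) ilt.
    + by move=> x xc; rewrite mem_cat xc orbT.
    + exact: ltn_trans (args_lt ilt ji') ilt.
have self w : value S i = w -> allowed (i, w) -> (wt i = 0 -> op i = GIn) ->
    exists cl, [/\ size cl <= 2 ^ dp i,
    forall g v, (g, v) \in cl -> [/\ g < n, value S g = v, allowed (g, v) & wt i = 0 -> op g = GIn] &
    supports cl i w].
  move=> vw al w0; exists [:: (i, w)]; split=> [|g v|].
  - by rewrite expn_gt0.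
  - by rewrite inE => /eqP[-> ->]; split.
  - by apply: supports_claim; rewrite ?mem_head.
have big : 2 < size (args i) -> wt i = 0 -> op i = GIn.
  by move=> big; rewrite (wtE ilt) big.
have := argsP ilt; have vE := valueE S ilt; have kE cl := knE cl ilt.
case Eop: (op i) vE kE => vE kE.
- by move=> _; apply: self; rewrite ?Eop // /allowed /= Eop.
- move=> [j aj]; apply: (IH1 j); first by rewrite aj mem_head.
  move=> cl; rewrite vE aj /= /supports kE aj /=.
  by case: (value S j) => /= ->.
- move=> ge2; case vi: (value S i); last first.
    move: vi; rewrite vE => /negbT/allPn[j ji nj]; apply: (IH1 j) => // cl.
    rewrite /supports (negbTE nj) kE /= => h.
    by apply/orP; left; apply/hasP; exists j.
  case: (ltnP 2 (size (args i))) => [lt|le2].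
    apply: self; rewrite // ?Eop; first by rewrite /allowed /= Eop lt.
    by move/(big lt); rewrite Eop.
  have [j [j' aE]] : exists j j', args i = [:: j; j'].
    by case: (args i) le2 ge2 => [|j [|j' [|]]] // _ _; exists j, j'.
  apply: (IH2 j j'); rewrite ?aE ?inE ?eqxx ?orbT // => cl.
  move: vi; rewrite vE aE /= => /and3P[-> -> _].
  by rewrite /supports kE aE /= => -> ->.
- move=> ge2; case vi: (value S i).
    move: vi; rewrite vE => /hasP[j ji nj]; apply: (IH1 j) => // cl.
    rewrite /supports nj kE /= => h.
    by apply/orP; left; apply/hasP; exists j.
  case: (ltnP 2 (size (args i))) => [lt|le2].
    apply: self; rewrite // ?Eop; first by rewrite /allowed /= Eop lt.
    by move/(big lt); rewrite Eop.
  have [j [j' aE]] : exists j j', args i = [:: j; j'].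
    by case: (args i) le2 ge2 => [|j [|j' [|]]] // _ _; exists j, j'.
  apply: (IH2 j j'); rewrite ?aE ?inE ?eqxx ?orbT // => cl.
  move: vi; rewrite vE aE /= orbF => /negbT; rewrite negb_or => /andP[/negbTE-> /negbTE->].
  by rewrite /supports kE aE /= => -> ->.
Qed.
End Circuit.

(* [x = 2n] is a dummy claim, about a node that does not exist. *)
Definition claim_of (n x : nat) : nat * bool :=
  if x < n then (x, true) else (x - n, false).

Definition allowed_claim (c : circuit) (gv : nat * bool) : bool :=
  (size (gates c) <= gv.1) || allowed c gv.

(* A pair [(i, p)] says that the [i]-th true input is the node [p.-1]; positions 0
   and [n.+1] are sentinels. *)
Definition pos_ok (c : circuit) (k : nat) (a : nat * nat) : bool :=
  [&& (a.1 == 0) ==> (a.2 == 0),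
      (a.1 == k.+1) ==> (a.2 == (size (gates c)).+1) &
      (0 < a.1) && (a.1 <= k) ==>
        [&& 0 < a.2, a.2 <= size (gates c) & is_input (node c a.2.-1)]].

Definition pos_incr (ps : seq (nat * nat)) : bool :=
  all (fun a => all (fun b => (b.1 == a.1.+1) ==> (a.2 < b.2)) ps) ps.

(** What the given positions show: their own nodes are true, and the inputs strictly between two
    consecutive ones are false. Node [v] has position [v + 1], hence the asymmetric bounds. *)
Definition pos_claims (c : circuit) (k : nat) (ps : seq (nat * nat)) : seq (nat * bool) :=
  [seq (a.2.-1, true) | a <- ps & (0 < a.1) && (a.1 <= k)] ++
  flatten [seq flatten [seq [seq (v, false) | v <- iota 0 (size (gates c)) &
      [&& is_input (node c v), a.2 <= v & v.+1 < b.2]]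
    | b <- ps & b.1 == a.1.+1] | a <- ps].

(** A few positions cannot establish that a claim about a large gate is true, so the last condition
    only asks that they do not establish its negation. *)
Definition check (c : circuit) (k : nat) (xs : seq nat) (ps : seq (nat * nat)) : bool :=
  let cs := [seq claim_of (size (gates c)) x | x <- xs] in
  [&& (kn c cs (output c)).1, all (allowed_claim c) cs, all (pos_ok c k) ps, pos_incr ps &
      all (fun gv => ~~ supports c (pos_claims c k ps) gv.1 (~~ gv.2)) cs].

(** One range serves all values: claims are coded by numbers up to [2n], and positions reach
    [n + 1], which is at most [2n] in a nonempty circuit. *)
Definition consistent (c : circuit) (k L R : nat) (a : nat -> nat) : Prop :=
  (forall i, i < L + k.+2 -> a i < (size (gates c) + size (gates c)).+1) /\
  (forall tau, size tau = R -> all (fun t => t < k.+2) tau ->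
     check c k [seq a i | i <- iota 0 L] [seq (t, a (L + t)) | t <- tau]).

Lemma kn_oversize c cl i : size (gates c) <= i -> kn c cl i = (false, false).
Proof. by move=> le; rewrite /kn nth_default // size_node_attributes. Qed.

Lemma pos_claimsP c k ps g v : (g, v) \in pos_claims c k ps ->
  if v then exists2 i, 0 < i <= k & (i, g.+1) \in ps \/ (i, 0) \in ps /\ g = 0
  else [/\ g < size (gates c), is_input (node c g) &
     exists i p q, [/\ (i, p) \in ps, (i.+1, q) \in ps & p < g.+1 < q]].
Proof.
rewrite mem_cat => /orP[/mapP[[i p]]|/flatten_mapP[[i p] ips]].
  rewrite mem_filter => /andP[/= ik ips] [-> ->]; exists i => //.
  by case: p ips => [|p] ips; [right|left].
move=> /flatten_mapP[[i' q]]; rewrite mem_filter => /andP[/= /eqP-> iqs].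
move=> /mapP[w]; rewrite mem_filter mem_iota => /andP[/and3P[wi pw wq] /= wn] [-> ->].
by split=> //; exists i, p, q; rewrite ltnS pw.
Qed.

Lemma pos_claims_true c k (ps : seq (nat * nat)) i g : 0 < i <= k -> (i, g.+1) \in ps ->
  (g, true) \in pos_claims c k ps.
Proof.
move=> ik ips; rewrite mem_cat; apply/orP; left; apply/mapP; exists (i, g.+1) => //.
by rewrite mem_filter ik.
Qed.

Lemma pos_claims_false c k (ps : seq (nat * nat)) i p q g : (i, p) \in ps -> (i.+1, q) \in ps ->
  p < g.+1 < q -> g < size (gates c) -> is_input (node c g) ->
  (g, false) \in pos_claims c k ps.
Proof.
move=> ips iqs /andP[pg gq] gn gi; rewrite mem_cat; apply/orP; right.
apply/flatten_mapP; exists (i, p) => //; apply/flatten_mapP; exists (i.+1, q).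
  by rewrite mem_filter eqxx.
by apply/mapP; exists g => //; rewrite mem_filter mem_iota gi gq gn -ltnS pg.
Qed.

Section Consistent.
Variables (c : circuit) (k d : nat).
Hypothesis wf : wf_circuit c.
Hypothesis wft : weft c <= 1.
Hypothesis dpt : depth c <= d.
Notation n := (size (gates c)).
Notation L := (2 ^ d).
Notation R := (2 * 2 ^ d).

Lemma n_gt0 : 0 < n.
Proof. by case: wf => /(leq_ltn_trans (leq0n _)). Qed.

Lemma increasing_lt (p : nat -> nat) m : (forall i, i < m -> p i < p i.+1) ->
  forall i j, i < j <= m -> p i < p j.
Proof.
move=> H i; elim=> // j IH /andP[]; rewrite ltnS leq_eqVlt => /orP[/eqP-> jm|ij jm]; first exact: H.
by apply: ltn_trans (H j jm); apply: IH; rewrite ij ltnW.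
Qed.

Lemma all_pairs_pos (p : nat -> nat) (tau : seq nat) :
  (forall i, i.+1 \in tau -> p i < p i.+1) -> pos_incr [seq (t, p t) | t <- tau].
Proof.
move=> H; apply/allP => _ /mapP[i _ ->]; apply/allP => _ /mapP[j jt ->] /=.
by apply/implyP => /eqP ji; subst j; apply: H.
Qed.

Lemma sat_consistent : has_weight_sat c k -> exists a, consistent c k L R a.
Proof.
case=> S [uS Sin Sk cS].
pose s := sort leq S.
have ss : sorted ltn s by rewrite ltn_sorted_uniq_leq sort_uniq uS sort_sorted //; exact: leq_total.
have szs : size s = k by rewrite size_sort.
have sS x : (x \in s) = (x \in S) by rewrite mem_sort.
pose pos i := if i == 0 then 0 else if i <= k then (nth 0 s i.-1).+1 else n.+1.
have posS i : 0 < i <= k -> exists2 x, x \in S & pos i = x.+1.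
  move=> /andP[i0 ik]; exists (nth 0 s i.-1); last by rewrite /pos gtn_eqF // ik.
  by rewrite -sS mem_nth // szs prednK.
have posk : pos k.+1 = n.+1 by rewrite /pos /= ltnn.
have pos_step i : i < k.+1 -> pos i < pos i.+1.
  move=> ik; rewrite /pos /=; case: i ik => [|i] /= ik; first by case: ifP.
  rewrite ltnS in ik; rewrite ik; case: ifP => ik'.
    by rewrite ltnS (sorted_ltn_nth ltn_trans) // inE szs // ltnW.
  by rewrite ltnS; have [] := Sin (nth 0 s i); rewrite -?sS ?mem_nth ?szs.
have pos_lt := increasing_lt pos_step.
have [cl [szcl clP sup]] := certificate wf S (proj1 wf) wft.
have vO : value c S (output c) by [].
have szL : size cl <= L by apply: leq_trans szcl _; rewrite leq_pexp2l.
pose unclaim (gv : nat * bool) := if gv.2 then gv.1 else n + gv.1.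
(* Places beyond the end of the certificate get the dummy claim [2n], about the absent node [n], of
   which nothing is ever known. *)
pose a i := if i < L then nth (n + n) [seq unclaim gv | gv <- cl] i else pos (i - L).
have claimE gv : gv.1 < n -> claim_of n (unclaim gv) = gv.
  case: gv => g [] /= gn; rewrite /claim_of /unclaim /= ?gn //.
  by rewrite ltnNge leq_addr /= addKn.
pose cs := [seq claim_of n x | x <- [seq a i | i <- iota 0 L]].
have csP g v : (g, v) \in cs -> (g, v) \in cl \/ g = n.
  case/mapP => x /mapP[i]; rewrite mem_iota /= add0n => iL ->; rewrite /a iL => E.
  case: (ltnP i (size cl)) => isz; last first.
    rewrite nth_default ?size_map // in E; right.
    by move: E; rewrite /claim_of ltnNge leq_addr /= addKn => -[].
  have gvin : nth (0, false) cl i \in cl by apply: mem_nth.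
  rewrite (nth_map (0, false)) // claimE in E; first by left; rewrite E.
  by case: (nth _ _ _) gvin => g' v' /clP[].
have clcs : {subset cl <= cs}.
  move=> gv gvin; have gn : gv.1 < n by case: gv gvin => g v /clP[].
  rewrite -(claimE gv) //; apply: map_f; apply/mapP.
  exists (index gv cl); first by rewrite mem_iota /= add0n (leq_trans _ szL) // index_mem.
  rewrite /a (leq_trans _ szL) ?index_mem //.
  by rewrite (nth_map gv) ?index_mem // nth_index.
exists a; split=> [i iL|tau _ tault].
  have n0 := n_gt0; rewrite /a; case: ifP => iL'.
    case: (ltnP i (size cl)) => isz; last by rewrite nth_default ?size_map.
    have : nth (0, false) cl i \in cl by apply: mem_nth.
    rewrite (nth_map (0, false)) // /unclaim ltnS; case: (nth _ _ _) => g [] /= /clP[gn _ _ _].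
      by apply: leq_trans (ltnW gn) _; rewrite leq_addr.
    by rewrite leq_add2l ltnW.
  apply: (@leq_ltn_trans n.+1); last by rewrite ltnS -addn1 leq_add2l.
  rewrite /pos; case: eqP => // _; case: ifP => // ik.
  case i0 : (i - L) => [|j]; first by rewrite ltnS; case: (s) (Sin) sS => //= x s' Sin' sS';
    apply: ltnW; have [] := Sin' x; rewrite // -sS' mem_head.
  rewrite i0 in ik; rewrite /= ltnW // ltnS.
  by have [] := Sin (nth 0 s j); rewrite // -sS mem_nth // szs.
have aP t : a (L + t) = pos t by rewrite /a ltnNge leq_addr /= addKn.
have psE : [seq (t, a (L + t)) | t <- tau] = [seq (t, pos t) | t <- tau].
  by apply: eq_map => t; rewrite aP.
rewrite psE /check -/cs; apply/and5P; split.
- have := supports_mono wf clcs (proj1 wf) sup; by rewrite /supports vO.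
- apply/allP => -[g v] /csP[/clP[_ _ al _]|->]; rewrite /allowed_claim /=; last by rewrite leqnn.
  by rewrite al orbT.
- apply/allP => _ /mapP[t tt ->]; rewrite /pos_ok /=; apply/and3P; split.
  + by apply/implyP => /eqP->.
  + by apply/implyP => /eqP->; rewrite posk.
  + apply/implyP => tk; have [x xS ->] := posS _ tk; rewrite /=.
    by have [xn xi] := Sin x xS; rewrite xn.
- apply: all_pairs_pos => i it; apply: pos_step.
  by have := allP tault _ it; rewrite ltnS.
- apply/allP => -[g v] /csP gv /=; apply/negP => sp.
  (* All that the positions show holds under [S]; by soundness they cannot refute a claim that is
     true under [S]. *)
  have trueS g' v' : (g', v') \in pos_claims c k [seq (t, pos t) | t <- tau] ->
      g' < n -> predT g' -> value c S g' = v'.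
    move=> /pos_claimsP; case: v' => [[i ik H] g'n _|[_ gi [i [p [q [ip iq pq]]]]] g'n _].
      have pi : pos i = g'.+1.
        case: H => [/mapP[t _ [-> ->]] //|[/mapP[t _ [it p0]] _]].
        by have [x _] := posS i ik; rewrite it -p0.
      have [x xS] := posS i ik; rewrite pi => -[gx].
      rewrite valueE // gx; have [_] := Sin x xS; rewrite /is_input.
      by case: (node c x).1.
    rewrite valueE //; move: gi; rewrite /is_input; case: (node c g').1 => // _.
    apply/negbTE; rewrite -sS; apply/negP => gs.
    have jk : index g' s < k by rewrite -szs index_mem.
    have pj : pos (index g' s).+1 = g'.+1 by rewrite /pos /= jk nth_index.
    case/mapP: ip iq pq => t _ [-> ->] /mapP[t' t't [tE ->]].
    rewrite -pj -tE => /andP[lo hi].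
    have tk : t < k.+1 by have := allP tault _ t't; rewrite ltnS -tE.
    case: (ltngtP (index g' s).+1 t) => jt; last by rewrite jt ltnn in lo.
      by have := pos_lt (index g' s).+1 t; rewrite jt (ltnW tk) => /(_ isT); rewrite ltnNge ltnW.
    move: jt; rewrite leq_eqVlt => /orP[/eqP jt|jt]; first by rewrite jt ltnn in hi.
    by have := pos_lt t.+1 (index g' s).+1; rewrite jt (leq_trans jk (leqnSn k)) => /(_ isT); rewrite ltnNge ltnW.
  have [gn|gn] := ltnP g n; last by move: sp; rewrite /supports kn_oversize //; case: v gv.
  have [h1 h2] := kn_sound (cl := pos_claims c k [seq (t, pos t) | t <- tau]) wf (S := S) (P := predT)
     (fun _ _ _ _ _ => isT) trueS gn isT.
  case: gv => [/clP[_ vv _ _]|gE]; last by rewrite gE ltnn in gn.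
  by move: sp; rewrite /supports; case: v vv => vv /=; [move/h2; rewrite vv|move/h1; rewrite vv].
Qed.

Lemma consistent_sat a : consistent c k L R a -> has_weight_sat c k.
Proof.
case=> aM chk.
pose pos t := a (L + t).
have R2 : 2 <= R by rewrite leq_pmulr // expn_gt0.
(* Shorter tuples are padded with the lower sentinel. *)
have chk' tau : size tau <= R -> all (fun t => t < k.+2) tau ->
    exists tau', [/\ {subset tau <= tau'}, all (fun t => t < k.+2) tau' &
      check c k [seq a i | i <- iota 0 L] [seq (t, pos t) | t <- tau']].
  move=> sz tk; exists (tau ++ nseq (R - size tau) 0); split.
  - by move=> t; rewrite mem_cat => ->.
  - by rewrite all_cat tk all_nseq orbT.
  - by apply: chk; rewrite ?size_cat ?size_nseq ?subnKC // all_cat tk all_nseq orbT.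
have in_pos t tau : t \in tau -> (t, pos t) \in [seq (t, pos t) | t <- tau].
  by move=> tt; apply/mapP; exists t.
pose cs := [seq claim_of n x | x <- [seq a i | i <- iota 0 L]].
have pok t : t < k.+2 -> pos_ok c k (t, pos t).
  move=> tk; have [||tau [sub _ /and5P[_ _ /allP H _ _]]] := chk' [:: t].
  - by apply: leq_trans R2.
  - by rewrite /= tk.
  - by apply/H/in_pos/sub; rewrite mem_head.
have pos_step i : i < k.+1 -> pos i < pos i.+1.
  move=> ik; have [||tau [sub _ /and5P[_ _ _ /allP H _]]] := chk' [:: i; i.+1].
  - exact: R2.
  - by rewrite /= ltnS (ltnW ik) ltnS ik.
  - have /allP /(_ (i.+1, pos i.+1)) := H (i, pos i) (in_pos _ _ (sub i (mem_head _ _))).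
    rewrite /= eqxx; apply; apply/in_pos/sub; by rewrite !inE eqxx orbT.
have pos0 : pos 0 = 0 by have /and3P[/= /eqP] := pok 0 isT.
have posk : pos k.+1 = n.+1.
  by have /and3P[_ /= +_] := pok k.+1 (ltnSn _); rewrite eqxx => /eqP.
have pos_in i : 0 < i <= k -> exists x, [/\ pos i = x.+1, x < n & is_input (node c x)].
  move=> ik; have /and3P[_ _] := pok i ltac:(by case/andP: ik => _; rewrite ltnS => /leqW).
  rewrite /= ik /= => /and3P[p0 pn pi].
  by exists (pos i).-1; rewrite prednK.
have pos_lt := increasing_lt pos_step.
have pos_inj i j : i <= k.+1 -> j <= k.+1 -> pos i = pos j -> i = j.
  move=> ik jk pij; case: (ltngtP i j) => // ij.
    by have := pos_lt i j; rewrite ij jk pij ltnn => /(_ isT).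
  by have := pos_lt j i; rewrite ij ik pij ltnn => /(_ isT).
pose S := [seq (pos i).-1 | i <- iota 1 k].
have SP x : reflect (exists2 i, 0 < i <= k & pos i = x.+1) (x \in S).
  apply: (iffP mapP) => [[i]|[i ik px]].
    rewrite mem_iota add1n ltnS => ik ->; exists i => //.
    by have [y [-> _ _]] := pos_in i ik.
  by exists i; rewrite ?mem_iota ?add1n ?ltnS // px.
have uS : uniq S.
  rewrite map_inj_in_uniq ?iota_uniq // => i j; rewrite !mem_iota add1n !ltnS => ik jk.
  have [x [px _ _]] := pos_in i ik; have [y [py _ _]] := pos_in j jk.
  rewrite px py /= => xy; apply: pos_inj; rewrite ?px ?py ?xy //.
    by case/andP: ik => _ /leqW.
  by case/andP: jk => _ /leqW.
exists S; split=> //.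
- by move=> x /SP[i ik px]; have [y [py yn yi]] := pos_in i ik; move: py; rewrite px => -[->].
- by rewrite size_map size_iota.
(* A node outside [S] lies between the last position before it and the next one; the sentinels
   guarantee that both exist. *)
have gap g : g < n -> g \notin S -> exists2 i, i <= k & pos i < g.+1 < pos i.+1.
  move=> gn gS; have ex : exists i, (i <= k.+1) && (pos i < g.+1) by exists 0; rewrite pos0.
  have ub i : (i <= k.+1) && (pos i < g.+1) -> i <= k.+1 by case/andP.
  case: (ex_maxnP ex ub) => i /andP[ik1 pg] imax.
  have ik : i <= k.
    rewrite -ltnS ltn_neqAle ik1 andbT; apply: contraTN pg => /eqP->.
    by rewrite posk ltnS -leqNgt ltnW.
  exists i => //; rewrite pg /= ltn_neqAle; apply/andP; split.
    apply: contra gS => /eqP gp; apply/SP; exists i.+1 => //=.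
    rewrite ltn_neqAle ik andbT; apply/eqP => iE.
    by move: gp gn; rewrite iE posk => -[->]; rewrite ltnn.
  rewrite leqNgt; apply/negP => h; have := imax i.+1.
  by rewrite ltnS ik h ltnn => /(_ isT).
(* Every bounded set of true claims about inputs is decided by a bounded tuple
   of positions. *)
have cover (cl : seq (nat * bool)) : 2 * size cl <= R ->
    (forall g v, (g, v) \in cl -> [/\ g < n, value c S g = v & (node c g).1 = GIn]) ->
    exists2 tau, size tau <= 2 * size cl /\ all (fun t => t < k.+2) tau &
      forall tau' : seq nat, {subset tau <= tau'} ->
      {subset cl <= pos_claims c k [seq (t, pos t) | t <- tau']}.
  elim: cl => [|[g v] cl IH] sz H; first by exists [::].
  have [|g' v' h|tau [st tk] sub] := IH; first by move: sz => /=; lia.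
    by apply: H; rewrite inE h orbT.
  have [gn vE gin] := H g v (mem_head _ _).
  have gI : is_input (node c g) by rewrite /is_input gin.
  rewrite valueE // gin in vE; case: v vE {H sz} => [gS|/negbT gS].
    have [i ik pi] := SP _ gS; exists (i :: tau).
      split; first by move: st => /=; lia.
      by rewrite /= tk andbT ltnS; case/andP: ik => _ /leqW.
    move=> tau' sub' x; rewrite inE => /orP[/eqP->|xc].
      refine (@pos_claims_true c k _ i g ik _); rewrite -pi; apply/in_pos/sub'/mem_head.
    by apply: sub x xc => t tt; apply: sub'; rewrite inE tt orbT.
  have [i ik pi] := gap g gn gS; exists (i :: i.+1 :: tau).
    split; first by move: st => /=; lia.
    by rewrite /= tk andbT !ltnS ik (leqW ik).
  move=> tau' sub' x; rewrite inE => /orP[/eqP->|xc].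
    refine (@pos_claims_false c k _ i _ _ g _ _ pi gn gI); apply/in_pos/sub'; by rewrite !inE eqxx ?orbT.
  by apply: sub x xc => t tt; apply: sub'; rewrite !inE tt !orbT.
(* A node [j] of weft 0 has a certificate consisting of inputs. If its value contradicts the claim
   at [g], a tuple of positions showing these inputs makes the check fail. *)
have refuted g v j (u := value c S j) : g < n -> (g, v) \in cs -> j < n -> wt c j = 0 ->
    dp c j <= d -> (forall cl, supports c cl j u -> supports c cl g (~~ v)) -> False.
  move=> gn gcs jn wj dj sup; have [|cl [sz H sp]] := certificate wf S jn; first by rewrite wj.
  have szR : 2 * size cl <= R.
    by rewrite leq_mul2l (leq_trans sz) // leq_pexp2l.
  have [|tau [szt tk] sub] := cover cl szR.
    by move=> g' v' /H[h1 h2 _ /(_ wj)].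
  have [||tau' [st _ /and5P[_ _ _ _ /allP/(_ _ gcs)]]] := chk' tau.
  - exact: leq_trans szt szR.
  - exact: tk.
  - by rewrite /= (sup _ (supports_mono wf (sub _ st) jn sp)).
(* A false claim about an input refutes itself. A false claim about a large gate has an in-neighbour
   of the wrong value, which has weft 0 because the gate uses up the weft of 1. *)
have csP g v : (g, v) \in cs -> g < n -> (wt c g <= 1) && (dp c g <= d) -> value c S g = v.
  move=> gcs gn /andP[wg dg]; apply/eqP/negPn/negP => gv.
  have al : allowed c (g, v).
    have [||tau [_ _ /and5P[_ /allP/(_ _ gcs) + _ _ _]]] := chk' [::] => //.
    by rewrite /allowed_claim /= leqNgt gn.
  have vE := valueE wf S gn; have kE cl := knE wf cl gn.
  move: al; rewrite /allowed /=; case Eop: (node c g).1 vE kE => vE kE // h.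
  - apply: (refuted g v g gn gcs gn _ dg).
      by rewrite (wtE wf gn); have := argsP wf gn; rewrite Eop => ->; rewrite big_nil.
    by move=> cl; move: gv; rewrite /supports; case: (value c S g) (v) => [] [].
  - case/andP: h => vT big; rewrite vT in gv gcs; move: gv; rewrite vE eqb_id => /allPn[j ji nj].
    have wj := wt_arg wf gn ji; have jg := args_lt wf gn ji; have dj := dp_arg wf gn ji.
    apply: (refuted g true j gn gcs (ltn_trans jg gn)).
    + by move: (leq_trans wj wg); rewrite big; case: (wt c j).
    + exact: ltnW (leq_trans dj dg).
    + move=> cl; rewrite /supports (negbTE nj) kE /= => sj.
      by apply/orP; left; apply/hasP; exists j.
  - case/andP: h => /negbTE vF big; subst v; move: gv; rewrite vE eqbF_neg negbK => /hasP[j ji nj].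
    have wj := wt_arg wf gn ji; have jg := args_lt wf gn ji; have dj := dp_arg wf gn ji.
    apply: (refuted g false j gn gcs (ltn_trans jg gn)).
    + by move: (leq_trans wj wg); rewrite big; case: (wt c j).
    + exact: ltnW (leq_trans dj dg).
    + move=> cl; rewrite /supports nj kE /= => sj.
      by apply/orP; left; apply/hasP; exists j.
have [||tau [_ _ /and5P[out _ _ _ _]]] := chk' [::] => //.
pose P g := (wt c g <= 1) && (dp c g <= d).
have PO : P (output c) by apply/andP; split; [exact: wft|exact: dpt].
have Pa i j : i < n -> P i -> j \in (node c i).2 -> P j.
  move=> ilt /andP[wi di] ji; have wj := wt_arg wf ilt ji; have dj := dp_arg wf ilt ji.
  apply/andP; split; last exact: leq_trans (ltnW dj) di.
  by apply: leq_trans wi; apply: leq_trans wj; apply: leq_addl.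
have [h _] := kn_sound (cl := cs) (S := S) wf Pa csP (proj1 wf) PO.
exact: h out.
Qed.
End Consistent.

(** * The cells of a circuit *)

Fixpoint allseqs (T : Type) (r : nat) (l : seq T) : seq (seq T) :=
  if r is r'.+1 then flatten [seq [seq x :: s | s <- allseqs r' l] | x <- l] else [:: [::]].

Lemma mem_allseqs (T : eqType) r (l s : seq T) :
  (s \in allseqs r l) = (size s == r) && all (mem l) s.
Proof.
elim: r s => [|r IH] s /=; first by rewrite inE; case: s.
apply/flatten_mapP/idP => [[x xl /mapP[s']]|].
  by rewrite IH => /andP[/eqP sz sl] -> /=; rewrite sz eqxx xl.
case: s => //= x s; rewrite eqSS => /and3P[sz xl sl]; exists x => //.
by apply/mapP; exists s => //; rewrite IH sz.
Qed.

Lemma size_allseqs T r (l : seq T) : size (allseqs r l) = size l ^ r.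
Proof.
elim: r => //= r IH; rewrite expnS -IH.
suff H (m : seq T) : size (flatten [seq [seq x :: s | s <- allseqs r l] | x <- m]) =
    size m * size (allseqs r l) by exact: H.
by elim: m => //= x m IHm; rewrite size_cat size_map IHm mulSn.
Qed.

Lemma flatten_pairs T (f : nat -> nat -> T) (a b : nat) : 0 < b ->
  flatten [seq [seq f i j | j <- iota 0 b] | i <- iota 0 a] =
  [seq f (x %/ b) (x %% b) | x <- iota 0 (a * b)].
Proof.
move=> b0; elim: a => // a IH.
rewrite -addn1 iotaD map_cat flatten_cat IH /= cats0 mulnDl mul1n iotaD map_cat.
congr cat; rewrite !add0n -[in RHS](addn0 (a * b)) iotaDl -map_comp.
apply/eq_in_map => j; rewrite mem_iota /= add0n => jb.
by rewrite divnMDl // divn_small // addn0 modnMDl modn_small.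
Qed.

Lemma mem_zip_both (S T : eqType) (s : seq S) (t : seq T) x y :
  (x, y) \in zip s t -> x \in s /\ y \in t.
Proof.
elim: s t => [|a s IH] [|b t] //=; rewrite !inE => /orP[/eqP[-> ->]|/IH[xs yt]].
  by rewrite !eqxx.
by rewrite xs yt !orbT.
Qed.

Section Reduction.
Variable d : nat.
Notation L := (2 ^ d).
Notation R := (2 * 2 ^ d).

(** The outcomes of one test: [L] claims and [R] positions. The exponent [L + R] depends on [d]
    only, so there are polynomially many. *)
Definition values (c : circuit) : seq (seq nat) :=
  allseqs (L + R) (iota 0 (size (gates c) + size (gates c)).+1).
Definition nval (c : circuit) : nat := size (values c).
Definition tuples (k : nat) : seq (seq nat) := allseqs R (iota 0 k.+2).
(** One family for each claim and each position, and one for each test; the circuit does not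
    enter. *)
Definition nfam (k : nat) : nat := (L + k.+2) + size (tuples k).

(* A cell is a pair [(f, j)] of a family and a position in it; the last position
   closes the family. *)
Definition cells (c : circuit) (k : nat) : seq (nat * nat) :=
  flatten [seq [seq (f, j) | j <- iota 0 (nval c).+1] | f <- iota 0 (nfam k)].

(* The dependencies [:: 0; 1] make a cell unselectable, as cells 0 and 1 belong
   to the same family. *)
Definition dep (c : circuit) (k : nat) (p : nat * nat) : seq nat :=
  if (p.1 < L + k.+2) || (p.2 == nval c) then [::] else
  let vals := nth [::] (values c) p.2 in
  let ps := zip (nth [::] (tuples k) (p.1 - (L + k.+2))) (drop L vals) in
  if check c k (take L vals) ps then
    [seq l.1 * (nval c).+1 + l.2 |
      l <- zip (iota 0 L) (take L vals) ++ [seq (L + q.1, q.2) | q <- ps]]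
  else [:: 0; 1].

Definition ncells c k := size (cells c k).
Definition closes c k : pred nat := nth false [seq p.2 == nval c | p <- cells c k].
Definition deps c k : nat -> seq nat := nth [::] [seq dep c k p | p <- cells c k].

Section CircuitCells.
Variables (c : circuit) (k : nat).
Hypothesis wf : wf_circuit c.
Notation n := (size (gates c)).
Notation M := (n + n).+1.
Notation N := (nval c).
Notation F := (nfam k).
Notation Lk := (L + k.+2).

Lemma cellsE : cells c k = [seq (x %/ N.+1, x %% N.+1) | x <- iota 0 (F * N.+1)].
Proof. exact: flatten_pairs. Qed.

Lemma ncellsE : ncells c k = F * N.+1.
Proof. by rewrite /ncells cellsE size_map size_iota. Qed.

Lemma closesE e : closes c k e = (e < F * N.+1) && (e %% N.+1 == N).
Proof.
rewrite /closes cellsE -map_comp; case: ltnP => eC /=.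
  by rewrite (nth_map 0) ?size_iota //= nth_iota.
by rewrite nth_default // size_map size_iota.
Qed.

Lemma depsE e : deps c k e = if e < F * N.+1 then dep c k (e %/ N.+1, e %% N.+1) else [::].
Proof.
rewrite /deps cellsE -map_comp; case: ltnP => eC.
  by rewrite (nth_map 0) ?size_iota //= nth_iota.
by rewrite nth_default // size_map size_iota.
Qed.

Lemma L_gt0 : 0 < L. Proof. by rewrite expn_gt0. Qed.

Lemma M_le_N : M <= N.
Proof.
rewrite /nval size_allseqs size_iota -{1}(expn1 M) leq_pexp2l //.
by apply: leq_trans L_gt0 _; apply: leq_addr.
Qed.

Lemma N_gt1 : 1 < N.
Proof. by apply: leq_trans M_le_N; rewrite ltnS addn_gt0 n_gt0. Qed.

Lemma tuplesP tau : (tau \in tuples k) = (size tau == R) && all (fun t => t < k.+2) tau.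
Proof. by rewrite mem_allseqs; congr andb; apply: eq_all => t; exact: mem_iota. Qed.

Lemma valuesP v : (v \in values c) = (size v == L + R) && all (fun t => t < M) v.
Proof. by rewrite mem_allseqs; congr andb; apply: eq_all => t; exact: mem_iota. Qed.

Lemma div_cell f j : j <= N -> (f * N.+1 + j) %/ N.+1 = f.
Proof. by move=> jN; rewrite divnMDl // divn_small // addn0. Qed.

Lemma mod_cell f j : j <= N -> (f * N.+1 + j) %% N.+1 = j.
Proof. by move=> jN; rewrite modnMDl modn_small. Qed.

Lemma lt_cell f j : j <= N -> (f * N.+1 + j < F * N.+1) = (f < F).
Proof.
move=> jN; apply/idP/idP => [|fF]; last first.
  apply: leq_trans (_ : f.+1 * N.+1 <= _); last by rewrite leq_mul2r fF orbT.
  by rewrite mulSn addnC ltn_add2r ltnS.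
by apply: contraTT; rewrite -!leqNgt => Ff; apply: leq_trans (leq_addr _ _); rewrite leq_mul2r Ff orbT.
Qed.

Lemma F_gt : Lk < F.
Proof. by rewrite -[X in X < _]addn0 ltn_add2l size_allseqs size_iota expn_gt0. Qed.

Lemma ncells_gt0 : 0 < ncells c k.
Proof. by rewrite ncellsE muln_gt0 (leq_ltn_trans (leq0n Lk) F_gt). Qed.

Lemma closes_cell f j : f < F -> j <= N -> closes c k (f * N.+1 + j) = (j == N).
Proof. by move=> fF jN; rewrite closesE lt_cell // fF mod_cell. Qed.

Lemma closes_last : closes c k (ncells c k).-1.
Proof.
rewrite ncellsE; case: F F_gt closes_cell => // F' _ H.
by rewrite mulSn addSn /= addnC H.
Qed.

Lemma deps_cell f j : f < F -> j <= N -> deps c k (f * N.+1 + j) = dep c k (f, j).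
Proof. by move=> fF jN; rewrite depsE lt_cell // fF div_cell // mod_cell. Qed.

Lemma deps_closes e : closes c k e -> deps c k e = [::].
Proof. by rewrite closesE depsE => /andP[-> eN]; rewrite /dep /= eN orbT. Qed.

Lemma deps_small e : e < Lk * N.+1 -> deps c k e = [::].
Proof. by rewrite depsE; case: ifP => // _ eL; rewrite /dep /= ltn_divLR // eL. Qed.

Lemma dep_labels i p : i < Lk -> p < M -> i * N.+1 + p < Lk * N.+1 /\ ~~ closes c k (i * N.+1 + p).
Proof.
move=> iL pM; have pN : p < N by apply: leq_trans M_le_N.
rewrite closesE mod_cell ?(ltnW pN) // ltn_eqF // andbF; split=> //.
apply: leq_trans (_ : i.+1 * N.+1 <= _); last by rewrite leq_mul2r iL orbT.
by rewrite mulSn addnC ltn_add2r ltnS ltnW.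
Qed.

Lemma deps_sub e u : u \in deps c k e -> u < Lk * N.+1 /\ ~~ closes c k u.
Proof.
rewrite depsE; case: ifP => // eF; rewrite /dep /=; case: ifP => // /negbT.
rewrite negb_or -leqNgt => /andP[fL jN].
have jN' : e %% N.+1 < N by rewrite ltn_neqAle jN -ltnS ltn_mod.
have fF : e %/ N.+1 < F by rewrite ltn_divLR.
have vV := mem_nth [::] jN'; rewrite valuesP in vV.
have tT : e %/ N.+1 - Lk < size (tuples k) by rewrite ltn_subLR.
have {}tT := mem_nth [::] tT; rewrite tuplesP in tT.
move: vV tT; set v := nth [::] _ _; set tau := nth [::] _ _ => /andP[_ /allP vM] /andP[_ /allP tk].
case: ifP => _; last first.
  rewrite !inE => /orP[] /eqP->.
    by have := @dep_labels 0 0; rewrite mul0n; apply; rewrite // ltn_addr // L_gt0.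
  have := @dep_labels 0 1; rewrite mul0n; apply; first by rewrite ltn_addr // L_gt0.
  by rewrite ltnS addn_gt0 n_gt0.
case/mapP => -[i p] ip -> /=.
have [iL pv] : i < Lk /\ p \in v.
  move: ip; rewrite mem_cat => /orP[/mem_zip_both[]|/mapP[[t q] /mem_zip_both[tt qv] [-> ->]]].
    rewrite mem_iota /= add0n => iL /mem_take pv; split=> //; exact: ltn_addr.
  by rewrite ltn_add2l; split; [apply: tk|apply: mem_drop qv].
by apply: dep_labels => //; apply: vM.
Qed.

Lemma cell_eq e : e = (e %/ N.+1) * N.+1 + e %% N.+1.
Proof. exact: divn_eq. Qed.

Lemma consistent_selection a : consistent c k L R a ->
  exists sel, selection (ncells c k) (closes c k) (deps c k) sel.
Proof.
case=> aM chk.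
pose tau f := nth [::] (tuples k) (f - Lk).
(* In a test family the selected cell is the outcome that [a] itself produces; in a value family it
   is the value. *)
pose vals f := [seq a i | i <- iota 0 L] ++ [seq a (L + t) | t <- tau f].
pose v f := if f < Lk then a f else index (vals f) (values c).
have tauP f : Lk <= f -> f < F -> size (tau f) = R /\ all (fun t => t < k.+2) (tau f).
  move=> Lf fF; have : tau f \in tuples k by apply: mem_nth; rewrite ltn_subLR.
  by rewrite tuplesP => /andP[/eqP].
have valsV f : Lk <= f -> f < F -> vals f \in values c.
  move=> Lf fF; have [sz /allP tk] := tauP f Lf fF.
  rewrite valuesP size_cat !size_map size_iota sz eqxx all_cat /=; apply/andP; split.
    apply/allP => x /mapP[i]; rewrite mem_iota /= add0n => iL ->.
    by apply: aM; apply: ltn_addr.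
  by apply/allP => _ /mapP[t tt ->]; apply: aM; rewrite ltn_add2l tk.
have vN f : f < F -> v f < N.
  move=> fF; rewrite /v; case: (ltnP f Lk) => fL; first exact: leq_trans (aM f fL) M_le_N.
  by rewrite index_mem valsV.
pose sel e := v (e %/ N.+1) == e %% N.+1.
have sel_cell f j : j <= N -> sel (f * N.+1 + j) = (v f == j).
  by move=> jN; rewrite /sel div_cell // mod_cell.
have afterE e : e <= F * N.+1 -> after (closes c k) sel e = (v (e %/ N.+1) < e %% N.+1).
  elim: e => [|e IH] eC; first by rewrite mod0n.
  rewrite /= (IH (ltnW eC)) /sel.
  have mN : e %% N.+1 <= N by rewrite -ltnS ltn_mod.
  have fF : e %/ N.+1 < F by rewrite ltn_divLR.
  rewrite {1}[e]cell_eq closes_cell //; move: mN; rewrite leq_eqVlt => /orP[/eqP jN|jN].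
    have -> : e.+1 = (e %/ N.+1).+1 * N.+1 + 0 by rewrite {1}[e]cell_eq jN addn0 mulSn -addnS addnC.
    by rewrite jN eqxx mod_cell.
  have -> : e.+1 = e %/ N.+1 * N.+1 + (e %% N.+1).+1 by rewrite addnS -cell_eq.
  by rewrite div_cell // mod_cell // ltn_eqF //= [RHS]ltnS [RHS]leq_eqVlt.
exists sel => e; rewrite ncellsE => eC; have fF : e %/ N.+1 < F by rewrite ltn_divLR.
rewrite afterE ?(ltnW eC) // closesE eC /=; split.
- by move=> /eqP->; apply: vN.
- by rewrite /sel => /eqP<-; rewrite ltnn ltn_eqF ?vN.
- move=> /eqP se u; rewrite depsE eC /dep /= -se ltn_eqF ?vN // orbF.
  case: (ltnP (e %/ N.+1) Lk) => // fL; rewrite /v ltnNge fL /= nth_index ?valsV //.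
  have [sz tk] := tauP _ fL fF.
  have t1 : take L (vals (e %/ N.+1)) = [seq a i | i <- iota 0 L].
    by rewrite /vals take_size_cat // size_map size_iota.
  have t2 : zip (tau (e %/ N.+1)) (drop L (vals (e %/ N.+1))) =
      [seq (t, a (L + t)) | t <- tau (e %/ N.+1)].
    rewrite /vals drop_size_cat ?size_map ?size_iota // -{1}[tau _]map_id zip_map.
    by [].
  rewrite t1 -/(tau _) t2 chk // => /mapP[[i p] ip ->] /=.
  suff [iL ->] : i < Lk /\ p = a i.
    have aiN : a i < N := leq_trans (aM i iL) M_le_N.
    by rewrite (sel_cell _ _ (ltnW aiN)) /v iL.
  move: ip; rewrite mem_cat => /orP[|/mapP[_ /mapP[t tt ->] [-> ->]]]; last first.
    by rewrite ltn_add2l; split=> //; apply: (allP tk).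
  rewrite -{1}[iota 0 L]map_id zip_map => /mapP[j]; rewrite mem_iota /= add0n => jL [-> ->].
  by split=> //; apply: ltn_addr.
Qed.

Lemma selection_consistent sel : selection (ncells c k) (closes c k) (deps c k) sel ->
  exists a, consistent c k L R a.
Proof.
rewrite ncellsE => selP.
have cellF f j : f < F -> j <= N -> f * N.+1 + j < F * N.+1 by move=> fF jN; rewrite lt_cell.
have afterE f j : f < F -> j <= N ->
    after (closes c k) sel (f * N.+1 + j) = has (fun j' => sel (f * N.+1 + j')) (iota 0 j).
  move=> fF; elim: j => [_|j IH jN].
    case: f fF => [|f] fF //; rewrite addn0 mulSn addSn /= addnC closes_cell // ?eqxx //.
    exact: ltnW.
  have -> : iota 0 j.+1 = rcons (iota 0 j) j by rewrite -addn1 iotaD cats1.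
  by rewrite has_rcons -(IH (ltnW jN)) addnS /= closes_cell ?(ltnW jN) // ltn_eqF.
pose a f := find (fun j => sel (f * N.+1 + j)) (iota 0 N).
have aP f : f < F -> a f < N /\ sel (f * N.+1 + a f).
  move=> fF; have [/(_ _) h _ _] := selP _ (cellF f N fF (leqnn N)).
  have {}h : has (fun j => sel (f * N.+1 + j)) (iota 0 N).
    by rewrite -afterE //; apply: h; rewrite closes_cell.
  have aN : a f < N by move: (h); rewrite has_find size_iota.
  by split=> //; have := nth_find 0 h; rewrite -/(a f) nth_iota.
have uniq_sel f j j' : f < F -> j < N -> j' < N -> sel (f * N.+1 + j) -> sel (f * N.+1 + j') -> j = j'.
  have wl i i' : f < F -> i < i' -> i' < N -> sel (f * N.+1 + i) -> sel (f * N.+1 + i') -> False.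
    move=> fF ii iN si si'; have [_ /(_ si')[_] + _] := selP _ (cellF f i' fF (ltnW iN)).
    rewrite afterE ?(ltnW iN) // => /hasPn/(_ i); rewrite mem_iota /= add0n ii => /(_ isT).
    by rewrite si.
  move=> fF jN jN' sj sj'; case: (ltngtP j j') => // lt.
    by case: (wl j j' fF lt jN' sj sj').
  by case: (wl j' j fF lt jN sj' sj).
have F0 : 0 < F by apply: leq_ltn_trans (leq0n _) F_gt.
(* The test family of [tau] cannot select a failing outcome, as this would force both cells 0 and 1
   of one family. The selected outcome thus passes, and its dependencies identify its entries with
   the values of [a]. *)
have row tau : size tau = R -> all (fun t => t < k.+2) tau ->
    check c k [seq a i | i <- iota 0 L] [seq (t, a (L + t)) | t <- tau] /\
    forall i, i \in iota 0 L ++ [seq L + t | t <- tau] -> a i < M.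
  move=> sz tk; have tT : tau \in tuples k by rewrite tuplesP sz eqxx.
  pose f := Lk + index tau (tuples k).
  have fF : f < F by rewrite ltn_add2l index_mem.
  have [aN sf] := aP f fF.
  have [_ _ /(_ sf) cl] := selP _ (cellF f (a f) fF (ltnW aN)).
  rewrite deps_cell ?(ltnW aN) // /dep /= ltnNge leq_addr ltn_eqF //= addKn nth_index // in cl.
  set v := nth [::] (values c) (a f) in cl.
  have : v \in values c by apply: mem_nth.
  rewrite valuesP => /andP[/eqP sv vM].
  move: cl; case: ifP => [ck cl|_ cl]; last first.
    have s0 := cl 0 (mem_head _ _); have s1 : sel 1 by apply: cl; rewrite !inE eqxx orbT.
    have N1 := N_gt1.
    by have := uniq_sel 0 0 1 F0 (ltnW N1) N1; rewrite mul0n => /(_ s0 s1).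
  have lab i p : (i, p) \in zip (iota 0 L) (take L v) ++ [seq (L + q.1, q.2) | q <- zip tau (drop L v)] ->
      i < Lk -> p < M -> a i = p.
    move=> ip iL pM; have iF : i < F by apply: ltn_trans F_gt.
    have [aiN si] := aP i iF; apply: (uniq_sel i) => //.
      exact: leq_trans M_le_N.
    by apply: cl; apply/mapP; exists (i, p).
  have st : size (take L v) = L by rewrite size_takel // sv leq_addr.
  have sd : size (drop L v) = R by rewrite size_drop sv addKn.
  have e1 : [seq a i | i <- iota 0 L] = take L v.
    apply: (@eq_from_nth _ 0); rewrite size_map size_iota ?st // => i iL.
    have iv : nth 0 (take L v) i \in take L v by rewrite mem_nth ?st.
    rewrite (nth_map 0) ?size_iota // nth_iota // add0n.
    apply: lab; [|exact: ltn_addr|exact: (allP vM _ (mem_take iv))].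
    rewrite mem_cat; apply/orP; left.
    rewrite (_ : (i, _) = nth (0, 0) (zip (iota 0 L) (take L v)) i).
      by rewrite mem_nth // size_zip size_iota st minnn.
    by rewrite nth_zip ?size_iota ?st // nth_iota.
  have e2 : [seq a (L + t) | t <- tau] = drop L v.
    apply: (@eq_from_nth _ 0); rewrite size_map sz ?sd // => i iR.
    have iv : nth 0 (drop L v) i \in drop L v by rewrite mem_nth ?sd.
    rewrite (nth_map 0) ?sz //.
    apply: lab; [|by rewrite ltn_add2l; apply: (allP tk); rewrite mem_nth ?sz|
      exact: (allP vM _ (mem_drop iv))].
    rewrite mem_cat; apply/orP; right; apply/mapP; exists (nth 0 tau i, nth 0 (drop L v) i) => //.
    rewrite -nth_zip ?sz ?sd // mem_nth // size_zip sz sd minnn //.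
  split.
    by rewrite e1 (_ : [seq (t, a (L + t)) | t <- tau] = zip tau (drop L v)) // -e2 -{2}[tau]map_id zip_map.
  move=> i; rewrite mem_cat => /orP[iL|/mapP[t tt ->]].
    have : a i \in take L v by rewrite -e1; apply: map_f.
    by move/mem_take; apply: (allP vM).
  have : a (L + t) \in drop L v by rewrite -e2; apply: (map_f (fun t => a (L + t))).
  by move/mem_drop; apply: (allP vM).
exists a; split=> [i iL|tau sz tk]; last by case: (row tau sz tk).
have R0 : 0 < R by rewrite muln_gt0 expn_gt0.
(* A value family also has cells outside the range of values. They are excluded by any test
   involving the family; for a position [t], the constant tuple is such a test. *)
pose t := if i < L then 0 else i - L.
have tk : t < k.+2 by rewrite /t; case: (ltnP i L) => // Li; rewrite ltn_subLR.
have [||_] := row (nseq R t); rewrite ?size_nseq ?all_nseq ?tk ?orbT //; apply.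
rewrite mem_cat mem_iota add0n leq0n /= map_nseq mem_nseq R0 /= /t.
by case: (ltnP i L) => //= Li; rewrite subnKC.
Qed.

Lemma count_closes : count (closes c k) (iota 0 (ncells c k)) = F.
Proof.
rewrite ncellsE; suff H f : f <= F -> count (closes c k) (iota 0 (f * N.+1)) = f by apply: H.
elim: f => // f IH fF; rewrite mulSn addnC iotaD count_cat (IH (ltnW fF)) add0n.
rewrite -[f * N.+1]addn0 iotaDl count_map.
have -> : iota 0 N.+1 = rcons (iota 0 N) N by rewrite -addn1 iotaD cats1.
rewrite -cats1 count_cat /= addn0 closes_cell // eqxx (eq_in_count (a2 := pred0)).
  by rewrite count_pred0 addn1.
by move=> j; rewrite mem_iota /= add0n => jN; rewrite closes_cell ?ltn_eqF // ltnW.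
Qed.
End CircuitCells.
End Reduction.

(** * The reduction takes polynomial time *)

#[export] Instance Enc_gate : Enc gate := Enc_prod Enc_op (Enc_seq Enc_nat).
#[export] Instance Pointed_gate : Pointed gate := (GIn, [::]).

Section CircuitData.
Context {A : Type} {eA : Enc A}.

Lemma ptime_memn (f : A -> nat) (l : A -> seq nat) : ptime f -> ptime l ->
  ptime (fun a => f a \in l a).
Proof.
move=> fP lP; apply: (ptime_ext (f := fun a => has (fun e => e == f a) (l a))) => [a|].
  by rewrite (has_pred1 (f a)).
apply: (ptime_has (f := fun a e => e == f a)) => //; apply: ptime_eqn.
  exact/ptime_snd/ptime_id.
by apply: (ptime_comp (g := f)) => //; apply/ptime_fst/ptime_id.
Qed.

Lemma ptime_mem_claim (f : A -> nat) (v : bool) (l : A -> seq (nat * bool)) :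
  ptime f -> ptime l -> ptime (fun a => (f a, v) \in l a).
Proof.
move=> fP lP; apply: (ptime_ext (f := fun a => has (fun e => (e.1 == f a) && if v then e.2 else ~~ e.2) (l a))) => [a|].
  rewrite -(has_pred1 (f a, v)); apply: eq_has => -[g w] /=.
  by rewrite -pair_eqE /pair_eq /=; case: v w => [] [].
apply: (ptime_has (f := fun a e => (e.1 == f a) && if v then e.2 else ~~ e.2)) => //.
apply: ptime_andb; first apply: ptime_eqn.
- exact/ptime_fst/ptime_snd/ptime_id.
- by apply: (ptime_comp (g := f)) => //; apply/ptime_fst/ptime_id.
- by case: v; [|apply: ptime_negb]; exact/ptime_snd/ptime_snd/ptime_id.
Qed.

Lemma ptime_op_code (f : A -> gate_op) : ptime f -> ptime (fun a => op_code (f a)).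
Proof. by apply: ptime_comp; apply: (ptime_expr (e := EVar 0)). Qed.

Lemma ptime_case_op {B} {eB : Enc B} (o : A -> gate_op) (f1 f2 f3 f4 : A -> B) :
  ptime o -> ptime f1 -> ptime f2 -> ptime f3 -> ptime f4 ->
  ptime (fun a => match o a with
    | GIn => f1 a | GNot => f2 a | GAnd => f3 a | GOr => f4 a end).
Proof.
move=> /ptime_op_code oP P1 P2 P3 P4.
apply: (ptime_ext (f := fun a => if op_code (o a) == 0 then f1 a else
  if op_code (o a) == 1 then f2 a else if op_code (o a) == 2 then f3 a else f4 a)).
  by move=> a; case: (o a).
by do 3?[apply: ptime_if; [apply: ptime_eqn => //; apply: ptime_const|by []|]].
Qed.

Lemma ptime_gates (f : A -> circuit) : ptime f -> ptime (fun a => gates (f a)).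
Proof. by apply: ptime_comp; apply: (ptime_expr (e := EHd (EVar 0))). Qed.

Lemma ptime_output (f : A -> circuit) : ptime f -> ptime (fun a => output (f a)).
Proof. by apply: ptime_comp; apply: (ptime_expr (e := ETl (EVar 0))). Qed.

Lemma ptime_rcons {E} {eE : Enc E} {pE : Pointed E} (l : A -> seq E) (x : A -> E) :
  ptime l -> ptime x -> ptime (fun a => rcons (l a) (x a)).
Proof.
move=> lP xP; apply: (ptime_ext (f := fun a => l a ++ [:: x a])) => [a|].
  by rewrite cats1.
by apply: ptime_cat => //; apply: ptime_cons => //; apply: ptime_const.
Qed.
End CircuitData.

Ltac pt_more := fail.
Local Opaque ptime.
Ltac pt1 := cbv beta; first [assumption | lazymatch goal with
  | |- ptime (fun _ => ?c) => exact: ptime_const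
  | |- ptime (fun a => a) => exact: ptime_id
  | |- ptime fst => exact: (ptime_fst (ptime_id))
  | |- ptime snd => exact: (ptime_snd (ptime_id))
  | |- ptime (fun a => fst (@?f a)) => refine (ptime_fst (f := f) _)
  | |- ptime (fun a => snd (@?f a)) => refine (ptime_snd (f := f) _)
  | |- ptime (fun a => (@?f a, @?g a)) => refine (ptime_pair (f := f) (g := g) _ _)
  | |- ptime (fun a => (@?f a) :: (@?g a)) => refine (ptime_cons (f := f) (g := g) _ _)
  | |- ptime (fun a => S (@?f a)) => refine (ptime_succ (f := f) _)
  | |- ptime (fun a => predn (@?f a)) => refine (ptime_pred (f := f) _)
  | |- ptime (fun a => addn (@?f a) (@?g a)) => refine (ptime_add (f := f) (g := g) _ _)
  | |- ptime (fun a => subn (@?f a) (@?g a)) => refine (ptime_sub (f := f) (g := g) _ _)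
  | |- ptime (fun a => muln (@?f a) (@?g a)) => refine (ptime_mul (f := f) (g := g) _ _)
  | |- ptime (fun a => leq (@?f a) (@?g a)) => refine (ptime_leq (f := f) (g := g) _ _)
  | |- ptime (fun a => eq_op (@?f a) (@?g a)) => refine (ptime_eqn (f := f) (g := g) _ _)
  | |- ptime (fun a => andb (@?f a) (@?g a)) => refine (ptime_andb (f := f) (g := g) _ _)
  | |- ptime (fun a => orb (@?f a) (@?g a)) => refine (ptime_orb (f := f) (g := g) _ _)
  | |- ptime (fun a => implb (@?f a) (@?g a)) => refine (ptime_implyb (f := f) (g := g) _ _)
  | |- ptime (fun a => negb (@?f a)) => refine (ptime_negb (f := f) _)
  | |- ptime (fun a => nilp (@?f a)) => refine (ptime_nilp (f := f) _)
  | |- ptime (fun a => head ?x (@?f a)) => refine (ptime_head x (f := f) _)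
  | |- ptime (fun a => nth ?x (@?l a) (@?i a)) => refine (ptime_nth x (n := i) (l := l) _ _)
  | |- ptime (fun a => take (@?i a) (@?l a)) => refine (ptime_take (n := i) (l := l) _ _)
  | |- ptime (fun a => drop (@?i a) (@?l a)) => refine (ptime_drop (n := i) (l := l) _ _)
  | |- ptime (fun a => size (@?l a)) => refine (ptime_size_seq (l := l) _)
  | |- ptime (fun a => iota (@?f a) (@?g a)) => refine (ptime_iota (f := f) (g := g) _ _)
  | |- ptime (fun a => zip (@?f a) (@?g a)) => refine (ptime_zip (l := f) (r := g) _ _)
  | |- ptime (fun a => cat (@?f a) (@?g a)) => refine (ptime_cat (l1 := f) (l2 := g) _ _)
  | |- ptime (fun a => rcons (@?f a) (@?g a)) => refine (ptime_rcons (l := f) (x := g) _ _)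
  | |- ptime (fun a => flatten (@?l a)) => refine (ptime_flatten (l := l) _)
  | |- ptime (fun a => map (@?f a) (@?l a)) => refine (ptime_map (f := f) (l := l) _ _)
  | |- ptime (fun a => filter (@?f a) (@?l a)) => refine (ptime_filter (p := f) (l := l) _ _)
  | |- ptime (fun a => has (@?f a) (@?l a)) => refine (ptime_has (f := f) (l := l) _ _)
  | |- ptime (fun a => all (@?f a) (@?l a)) => refine (ptime_all (f := f) (l := l) _ _)
  | |- ptime (fun a => gates (@?f a)) => refine (ptime_gates (f := f) _)
  | |- ptime (fun a => output (@?f a)) => refine (ptime_output (f := f) _)
  | |- ptime (fun a => op_code (@?f a)) => refine (ptime_op_code (f := f) _)
  | |- ptime (fun a => in_mem (@?f a, ?v) (mem (@?l a))) =>
      refine (ptime_mem_claim (f := f) v (l := l) _ _)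
  | |- ptime (fun a => in_mem (@?f a) (mem (@?l a))) =>
      refine (ptime_memn (f := f) (l := l) _ _)
  | |- _ => pt_more
  end].
Ltac pt := repeat pt1.

Lemma ptime_kstep : ptime (fun q : seq (nat * bool) * (seq (bool * bool) * gate) =>
  kstep q.1 q.2.1 q.2.2).
Proof.
rewrite /kstep /=; apply: ptime_pair; apply: ptime_orb.
all: pt; apply: ptime_case_op; pt.
Qed.

Lemma ptime_known : ptime (fun q : seq (nat * bool) * seq gate => known q.1 q.2).
Proof.
rewrite /known /node_attributes.
apply: (ptime_foldl (l := fun q : seq (nat * bool) * seq gate => q.2) (s0 := fun=> [::])
  (f := fun q vs g => rcons vs (kstep q.1 vs g)) (G := fun n => 1 + n * 8)).
- pt.
- pt.
- pt.
  apply: (ptime_comp (f := fun p : (seq (nat * bool) * seq gate) * gate * seq (bool * bool) =>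
    (p.1.1.1, (p.2, p.1.2))) ptime_kstep); pt.
- by polyb.
move=> [cl gs] i /= igs.
have szE : size (node_attributes (kstep cl) (take i gs)) <= size gs.
  by rewrite size_node_attributes size_takel.
(* A flag has size at most 3, a pair of flags at most 7, and the list adds one more per entry. *)
have bound (s : seq (bool * bool)) : size_of s <= 1 + size s * 8.
  elim: s => // -[a b] s IH; rewrite size_of_cons size_of_pair /= mulSn.
  have h (v : bool) : size_of v <= 3 by case: v.
  by have := h a; have := h b; lia.
apply: leq_trans (bound _) _; rewrite leq_add2l leq_mul2r /=.
apply: leq_trans szE _; apply: leq_trans (ltnW (size_le_size_of gs)) _.
by rewrite size_of_pair /=; lia.
Qed.

Section Checks.
Context {A : Type} {eA : Enc A}.

Lemma ptime_kn (c : A -> circuit) cl i : ptime c -> ptime cl -> ptime i ->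
  ptime (fun a => kn (c a) (cl a) (i a)).
Proof.
move=> cP clP iP; rewrite /kn; pt => //.
by apply: (ptime_comp (f := fun a => (cl a, gates (c a))) ptime_known); pt.
Qed.

Lemma ptime_is_input (g : A -> gate) : ptime g -> ptime (fun a => is_input (g a)).
Proof.
move=> gP; apply: ptime_case_op; pt; exact: gP.
Qed.

Lemma ptime_node (c : A -> circuit) i : ptime c -> ptime i ->
  ptime (fun a => node (c a) (i a)).
Proof. by move=> cP iP; rewrite /node; pt. Qed.

Lemma ptime_allowed (c : A -> circuit) gv : ptime c -> ptime gv ->
  ptime (fun a => allowed (c a) (gv a)).
Proof.
move=> cP gP; rewrite /allowed; apply: ptime_case_op; pt; try exact: gP.
all: by apply: ptime_node; pt.
Qed.

Lemma ptime_supports (c : A -> circuit) cl i v : ptime c -> ptime cl -> ptime i ->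
  ptime v -> ptime (fun a => supports (c a) (cl a) (i a) (v a)).
Proof.
by move=> cP clP iP vP; apply: ptime_if => //; pt; apply: ptime_kn.
Qed.

Lemma ptime_claim_of n x : ptime n -> ptime x ->
  ptime (fun a : A => claim_of (n a) (x a)).
Proof. by move=> nP xP; apply: ptime_if; pt. Qed.
End Checks.

Ltac pt_more ::= lazymatch goal with
  | |- ptime (fun a => kn (@?c a) (@?l a) (@?i a)) =>
      refine (ptime_kn (c := c) (cl := l) (i := i) _ _ _)
  | |- ptime (fun a => is_input (@?g a)) => refine (ptime_is_input (g := g) _)
  | |- ptime (fun a => node (@?c a) (@?i a)) => refine (ptime_node (c := c) (i := i) _ _)
  | |- ptime (fun a => allowed (@?c a) (@?g a)) =>
      refine (ptime_allowed (c := c) (gv := g) _ _)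
  | |- ptime (fun a => supports (@?c a) (@?l a) (@?i a) (@?v a)) =>
      refine (ptime_supports (c := c) (cl := l) (i := i) (v := v) _ _ _ _)
  | |- ptime (fun a => claim_of (@?n a) (@?x a)) =>
      refine (ptime_claim_of (n := n) (x := x) _ _)
  end.

Lemma ptime_pos_claims :
  ptime (fun q : circuit * (nat * seq (nat * nat)) => pos_claims q.1 q.2.1 q.2.2).
Proof. by rewrite /pos_claims; pt. Qed.

Lemma ptime_check : ptime (fun q : circuit * (nat * (seq nat * seq (nat * nat))) =>
  check q.1 q.2.1 q.2.2.1 q.2.2.2).
Proof.
rewrite /check /allowed_claim /pos_ok /pos_incr; pt.
apply: (ptime_comp (f := fun q : circuit * (nat * (seq nat * seq (nat * nat))) * (nat * bool) =>
  (q.1.1, (q.1.2.1, q.1.2.2.2))) ptime_pos_claims); pt.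
Qed.

(** The length [r] is a constant of the program: the induction nests one more loop for each [r],
    which keeps the time polynomial. *)
Lemma ptime_allseqs {A} {eA : Enc A} {E} {eE : Enc E} {pE : Pointed E} (r : nat) (l : A -> seq E) :
  ptime l -> ptime (fun a => allseqs r (l a)).
Proof.
move=> lP; elim: r => [|r IH] /=; pt.
by refine (ptime_comp (f := fun q => q.1) IH _); pt.
Qed.

Section CellLists.
Variable d : nat.
Context {A : Type} {eA : Enc A}.

Lemma ptime_values (c : A -> circuit) : ptime c -> ptime (fun a => values d (c a)).
Proof. by move=> cP; apply: ptime_allseqs; pt. Qed.

Lemma ptime_nval (c : A -> circuit) : ptime c -> ptime (fun a => nval d (c a)).
Proof. by move=> cP; rewrite /nval; pt; apply: ptime_values. Qed.

Lemma ptime_tuples (k : A -> nat) : ptime k -> ptime (fun a => tuples d (k a)).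
Proof. by move=> kP; apply: ptime_allseqs; pt. Qed.

Lemma ptime_nfam (k : A -> nat) : ptime k -> ptime (fun a => nfam d (k a)).
Proof. by move=> kP; rewrite /nfam; pt; apply: ptime_tuples. Qed.
End CellLists.

Lemma ptime_cells d : ptime (fun q : circuit * nat => cells d q.1 q.2).
Proof. by rewrite /cells; pt; [apply: ptime_nfam|apply: ptime_nval]; pt. Qed.

Lemma ptime_dep d : ptime (fun q : (circuit * nat) * (nat * nat) => dep d q.1.1 q.1.2 q.2).
Proof.
rewrite /dep; apply: ptime_if; [|pt|apply: ptime_if]; pt.
- by apply: ptime_nval; pt.
- apply: (ptime_comp (f := fun a : circuit * nat * (nat * nat) => (a.1.1, (a.1.2,
    (take (2 ^ d) (nth [::] (values d a.1.1) a.2.2),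
     zip (nth [::] (tuples d a.1.2) (a.2.1 - (2 ^ d + a.1.2.+2)))
       (drop (2 ^ d) (nth [::] (values d a.1.1) a.2.2)))))) ptime_check).
  by pt; try (apply: ptime_values; pt); apply: ptime_tuples; pt.
- by apply: ptime_values; pt.
- by apply: ptime_tuples; pt.
- by apply: ptime_values; pt.
- by apply: ptime_nval; pt.
Qed.

Lemma ptime_adj :
  ptime (fun q : (nat * (seq bool * seq (seq nat))) * ((nat * (nat * nat)) * (nat * (nat * nat))) =>
    adj q.1.1 (nth false q.1.2.1) (nth [::] q.1.2.2) q.2.1 q.2.2).
Proof. rewrite /adj /vert /firstdep /nextdep; cbv zeta. pt. Qed.

(** The loops produce the persons in the order of their codes, so that the program never has to
    divide. *)
Definition all_persons (C : nat) : seq (nat * (nat * nat)) :=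
  flatten [seq flatten [seq [seq (t, (u, v)) | v <- iota 0 C] | u <- iota 0 C] | t <- iota 0 7].

Lemma all_personsE C : 0 < C -> all_persons C = [seq decode C x | x <- iota 0 (7 * (C * C))].
Proof.
move=> C0; rewrite /all_persons.
under eq_map => t do rewrite (flatten_pairs (fun u v => (t, (u, v)))) //.
rewrite (flatten_pairs (fun t x => (t, (x %/ C, x %% C)))) ?muln_gt0 ?C0 //.
by apply: eq_map => x; rewrite /decode modn_dvdm ?dvdn_mull // modn_divl.
Qed.

Definition numbered (C : nat) : seq (nat * (nat * (nat * nat))) :=
  zip (iota 0 (size (all_persons C))) (all_persons C).

Definition market_lists (q : nat * (seq bool * seq (seq nat))) :
    (seq (seq nat) * seq (seq nat)) * (seq nat * seq nat) :=
  let a := adj q.1 (nth false q.2.1) (nth [::] q.2.2) in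
  (([seq [seq w.1 | w <- numbered q.1 & a m w.2] | m <- all_persons q.1],
    [seq [seq m.1 | m <- numbered q.1 & a m.2 w] | w <- all_persons q.1]),
   ([seq w.1 | w <- numbered q.1 & [&& 4 < w.2.1, w.2.2.1 == 0 & w.2.2.2 == 0]], [::])).

Lemma ptime_all_persons {A} {eA : Enc A} (f : A -> nat) : ptime f ->
  ptime (fun a => all_persons (f a)).
Proof.
by apply: ptime_comp; rewrite /all_persons; pt.
Qed.

Lemma ptime_market_lists : ptime market_lists.
Proof.
rewrite /market_lists; cbv zeta; rewrite /numbered; pt.
all: try (apply: ptime_all_persons; pt).
  by apply: (ptime_comp (f := fun q : nat * (seq bool * seq (seq nat)) * (nat * (nat * nat)) *
    (nat * (nat * (nat * nat))) => (q.1.1, (q.1.2, q.2.2))) ptime_adj); pt.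
by apply: (ptime_comp (f := fun q : nat * (seq bool * seq (seq nat)) * (nat * (nat * nat)) *
  (nat * (nat * (nat * nat))) => (q.1.1, (q.2.2, q.1.2))) ptime_adj); pt.
Qed.

Lemma enc_seq_map (T U : Type) (e : U -> tree) (f : T -> U) s :
  enc_seq e (map f s) = enc_seq (fun x => e (f x)) s.
Proof. by elim: s => //= x s ->. Qed.

Lemma enc_ordered_market n (a : rel nat) (dw : pred nat) :
  enc_smc (SMCInstance (ordered_market n a dw)) =
  encoding (([seq [seq j <- iota 0 n | a i j] | i <- iota 0 n],
             [seq [seq i <- iota 0 n | a i j] | j <- iota 0 n]),
            ([seq j <- iota 0 n | dw j], [::] : seq nat)).
Proof.
have ordE (s : seq 'I_n) : enc_seq (@enc_ord n) s = encoding (map val s).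
  by rewrite /encoding /Enc_seq enc_seq_map.
have listE (r : rel nat) (f : {ffun 'I_n -> seq 'I_n}) :
    (forall i, f i = [seq j : 'I_n <- enum 'I_n | r i j]) ->
    enc_seq (enc_seq (@enc_ord n)) (codom f) =
    encoding [seq [seq j <- iota 0 n | r i j] | i <- iota 0 n].
  have ordsE (s : seq (seq 'I_n)) :
      enc_seq (enc_seq (@enc_ord n)) s = encoding (map (map val) s).
    by elim: s => //= x s ->; rewrite ordE.
  move=> fE; rewrite ordsE codomE -val_enum_ord; move: (enum 'I_n) fE => e fE.
  by rewrite -!map_comp; congr encoding; apply: eq_map => i /=; rewrite fE filter_map.
rewrite /enc_smc /= (listE a) => [|i]; last by rewrite ffunE.
rewrite (listE (fun j i => a i j)) => [|i]; last by rewrite ffunE.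
rewrite !ordE enum_set0; congr (Defs.Cons _ (Defs.Cons _ _)).
have -> : enum [set j : 'I_n | dw j] = [seq j : 'I_n <- enum 'I_n | dw j].
  by rewrite enumT; apply: eq_filter => j; rewrite !inE.
by rewrite -val_enum_ord filter_map.
Qed.

Lemma enc_cell_market C y D (Yl : seq bool) (Dl : seq (seq nat)) : 0 < C ->
  y = nth false Yl -> D = nth [::] Dl ->
  enc_smc (SMCInstance (cell_market C y D)) = encoding (market_lists (C, (Yl, Dl))).
Proof.
move=> C0 -> ->; rewrite enc_ordered_market /market_lists /numbered /= all_personsE //.
set n := 7 * (C * C); rewrite size_map size_iota.
have -> : zip (iota 0 n) (map (decode C) (iota 0 n)) = [seq (x, decode C x) | x <- iota 0 n].
  by rewrite -{1}[iota 0 n]map_id zip_map.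
have filterE (p : pred (nat * (nat * (nat * nat)))) :
    [seq w.1 | w <- [seq (x, decode C x) | x <- iota 0 n] & p w] =
    [seq x <- iota 0 n | p (x, decode C x)].
  by rewrite filter_map -map_comp map_id.
congr encoding; rewrite !filterE -!map_comp; congr (_, _, (_, _)).
- by apply: eq_map => i /=; rewrite filterE.
- by apply: eq_map => j /=; rewrite filterE.
Qed.

Section Market.
Variable d : nat.

Definition reduction (x : circuit * nat) : smc_instance * nat :=
  (SMCInstance (cell_market (ncells d x.1 x.2) (closes d x.1 x.2) (deps d x.1 x.2)),
   nfam d x.2).

(** The instance as plain lists of numbers, free of finite types and proofs; it has the same code as
    the instance and is accessible to the calculus of polynomial time. *)
Definition reduction_data (x : circuit * nat) :=
  (market_lists (size (cells d x.1 x.2), ([seq p.2 == nval d x.1 | p <- cells d x.1 x.2],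
     [seq dep d x.1 x.2 p | p <- cells d x.1 x.2])), nfam d x.2).

Lemma enc_reduction x : encode (p := SMC_problem) (reduction x) = encoding (reduction_data x).
Proof.
by congr Defs.Cons; apply: enc_cell_market => //; apply: ncells_gt0.
Qed.

Lemma ptime_reduction_data : ptime reduction_data.
Proof.
rewrite /reduction_data; pt; last by apply: ptime_nfam; pt.
apply: (ptime_comp ptime_market_lists); pt.
- exact: ptime_cells.
- exact: ptime_cells.
- by apply: ptime_nval; pt.
- exact: ptime_cells.
- exact: ptime_dep.
Qed.

Lemma ncells_split c k : wf_circuit c -> exists V, [/\ V <= ncells d c k, closes d c k V.-1,
  forall e, e < V -> deps d c k e = [::] &
  forall e u, u \in deps d c k e -> u < V /\ ~~ closes d c k u].
Proof.
move=> wf; exists ((2 ^ d + k.+2) * (nval d c).+1); split.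
- by rewrite ncellsE leq_mul2r ltnW ?orbT // F_gt.
- rewrite addnS mulSn addSn /= addnC closes_cell //.
  by have := F_gt d k; rewrite addnS => /ltnW.
- exact: deps_small.
- by move=> e u; apply: deps_sub.
Qed.

Lemma reduction_correct c k : wf_circuit c -> weft c <= 1 -> depth c <= d ->
  yes (p := SMC_problem) (reduction (c, k)) <-> has_weight_sat c k.
Proof.
move=> wf wc dc; have [V [VC yV D0 Dsub]] := ncells_split k wf.
rewrite /yes /= -(count_closes d c k).
have D00 : deps d c k 0 = [::] by apply: deps_small; rewrite muln_gt0 addn_gt0 orbT.
rewrite (cell_market_correct (ncells_gt0 _ _ _) (closes_last _ _ _) D00 (@deps_closes _ _ _) VC yV D0 Dsub).
split=> [[sel /(selection_consistent wf)[a]]|]; first exact: consistent_sat.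
by move/(sat_consistent wf wc dc) => [a /consistent_selection].
Qed.
End Market.

(** * Composition with fpt-reductions *)

Lemma computable_comp f h : computable f -> ptime h -> computable (fun n : nat => h (f n)).
Proof.
move=> [p Hp] [q [c Hq]]; exists (ccomp p q) => n; have [t Ht] := Hp n.
by eexists; apply: runs_comp Ht (Hq (f n)).
Qed.

Lemma ptime_exp {A} {eA : Enc A} (f : A -> nat) k : ptime f -> ptime (fun a => f a ^ k).
Proof.
move=> fP; elim: k => [|k IH]; first exact: ptime_const.
by apply: (ptime_ext (f := fun a => f a * f a ^ k)) => [a|]; [rewrite expnS|apply: ptime_mul].
Qed.

(** [h] has to be monotone because [g] only bounds the parameter of the intermediate instance. *)
Lemma fpt_reducible_ptime (P Q R : pproblem) (rho : carrier Q -> carrier R) p c h :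
  fpt_reducible P Q ->
  (forall x, runs_within p (encode x) (encode (rho x)) (c * Defs.tsize (encode x) ^ c)) ->
  (forall x, valid x ->
     [/\ valid (rho x), yes x <-> yes (rho x) & param (rho x) <= h (param x)]) ->
  {homo h : m n / m <= n} -> ptime h ->
  fpt_reducible P R.
Proof.
move=> [r [q [f [g [b [fC gC H]]]]]] Hp Hrho hM hP.
pose T n := 2 * (n + c * n ^ c + n + cbound q + cbound p) + 2 * (n + n) + 10.
have [K HK] : poly_bounded T by rewrite /T; polyb.
exists (fun x => rho (r x)), (ccomp q p), (fun k => K * (f k).+1 ^ K), (fun k => h (g k)),
  (b.+1 * K); split.
- apply: (computable_comp (h := fun m => K * m.+1 ^ K)) => //; pt.
  by apply: (ptime_exp (f := fun m => m.+1)); pt.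
- exact: computable_comp.
move=> x vx; have [v1 y1 p1 c1] := H x vx; have [v2 y2 p2] := Hrho _ v1.
split=> //; first by rewrite y1.
  by apply: leq_trans p2 _; apply: hM.
have c2 := Hp (r x); apply: runs_weaken (runs_comp c1 c2) _.
set n := Defs.tsize (encode x) in c1 *; set u := Defs.tsize (encode (r x)) in c2 *.
set k := f _ in c1 *.
have n0 : 0 < n by apply: tsize_gt0.
(* [m] dominates the input, the running time of the first reduction and its output. The total time
   is polynomial in [m], and a power of [m] splits into a function of the parameter times a power of
   [n]. *)
pose m := k.+1 * n ^ b.+1.
have nm : n <= m by rewrite /m expnS mulnCA leq_pmulr // muln_gt0 expn_gt0 n0.
have n1m : k * n ^ b + n <= m.
  rewrite /m mulSn addnC leq_add // ?expnS ?leq_pmulr ?expn_gt0 ?n0 //.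
  by rewrite leq_mul // leq_pmull.
have um : u <= m by apply: leq_trans (runs_size c1) _; rewrite addnC.
have kn : k * n ^ b <= m by apply: leq_trans n1m; apply: leq_addr.
have m0 : 0 < m by apply: leq_trans nm.
apply: (@leq_trans (T m)).
  have le : c * u ^ c <= c * m ^ c by rewrite leq_mul // leq_expr.
  by rewrite /T; move: (c * u ^ c) (c * m ^ c) le => x1 x2; clear -kn nm um; lia.
apply: leq_trans (HK m m0) _.
by rewrite /m expnMn -expnM mulnA.
Qed.

Theorem theorem6 :
  W_hard 1 (@restrict SMC1_problem (fun x : smc_instance * nat =>
    [/\ master_list_over_men x.1,
        master_list_over_women x.1,
        #|dist_women x.1| = 2,
        max_woman_list x.1 <= 3 &
        forall w, w \in dist_women x.1 -> size (woman_list x.1 w) = 1])).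
Proof.
move=> Q [d red]; have [p [c Hp]] := ptime_reduction_data d.
refine (fpt_reducible_ptime (Q := WCS 1 d) (R := restrict (P := SMC1_problem) _)
  (rho := reduction d) (p := p) (c := c) (h := fun k => nfam d k + (nfam d k + 5)) red _ _ _ _).
- by move=> x; move: (Hp x); rewrite -enc_reduction.
- move=> [cc k] /= [wf wc dc]; split; last 2 first.
  + by symmetry; apply: reduction_correct.
  (* The budget is the number of families, which is also the number of closing cells in the bound on
     the men's lists. *)
  + rewrite leq_add2l -[X in _ <= X + _](count_closes d cc k).
    exact: (@men_degree _ _ (deps d cc k) (ncells_gt0 _ _ _) (closes_last _ _ _) _ (leqnn _)).
  have [V [VC yV _ _]] := ncells_split d k wf.
  have C0 := ncells_gt0 d cc k; have yl := closes_last d cc k.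
  split; first by [].
  split.
  + exact: (ordered_market_master _ _ _).1.
  + exact: (ordered_market_master _ _ _).2.
  + exact: (@card_dist_women _ _ (deps d cc k) C0 yl _ VC yV).
  + exact: (women_degree C0 yl (@deps_closes d cc k) VC yV).
  + exact: (@size_dist_woman _ _ (deps d cc k) C0 yl _ VC yV).
- move=> a b ab; rewrite /nfam /tuples !size_allseqs !size_iota.
  by rewrite !leq_add // leq_expr.
- by pt; apply: ptime_nfam; pt.
Qed.
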